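(* Let $m$ be a positive integer and $\gamma\in(0,1)$. For every non-empty open set $\Omega\subseteq\mathbb{R}^m$ of finite Lebesgue measure, $$\mathfrak{C}_{+}(\Omega,\gamma)=\gamma|\Omega|.$$
   Context: $|E|$ denotes the Lebesgue measure of $E\subseteq\mathbb{R}^m$. For an open set $\Omega\subseteq\mathbb{R}^m$, $\lambda(\Omega)=\inf\{\int_\Omega|D\varphi|^2/\int_\Omega\varphi^2:\varphi\in H_0^1(\Omega)\setminus\{0\}\}$ is the bottom of the spectrum of the Dirichlet Laplacian; $\lambda(\Omega)>0$ whenever $|\Omega|<\infty$. For $\Omega$ open with $\lambda(\Omega)>0$, $\gamma\in(0,1)$ and $A\subset\Omega$ measurable, $v_{\Omega,A,\gamma}$ is the weak solution of $$-\Delta v=\gamma\mathbf{1}_{\Omega\setminus A}-(1-\gamma)\mathbf{1}_A \text{ in }\Omega,\qquad v=0\text{ on }\partial\Omega .$$ If $|\Omega|<\infty$ this is the unique weak solution in $H^1_0(\Omega)$. Essential infima are taken over $\Omega$. Define $$\mathfrak{C}_{+}(\Omega,\gamma)=\inf\{c\ge 0:\ \text{for all measurable } A\subset\Omega \text{ with } |A|>c,\ \operatorname{ess\,inf} v_{\Omega,A,\gamma}<0\}.$$ *)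

(* Defs.v *)
(* R^m with m >= 1 is rendered as 'rV[R]_n.+1, m = n.+1. *)
From HB Require Import structures.
From mathcomp Require Import all_boot all_order all_algebra.
From mathcomp Require Import all_classical all_reals all_analysis.
From mathcomp Require Import ess_sup_inf.

Set Implicit Arguments.
Unset Strict Implicit.
Unset Printing Implicit Defensive.

Import Order.TTheory GRing.Theory Num.Theory.
Import numFieldNormedType.Exports.

Local Open Scope classical_set_scope.
Local Open Scope ring_scope.

Section lebesgue.
Context (R : realType) (n : nat).
Notation V := 'rV[R]_n.+1.

Definition box (c : V * V) : set V :=
  [set x | forall i, x 0 i \in `]c.1 0 i, c.2 0 i]].

(* The box is empty as soon as one side is; the truncation makes its volume 0
   in that case. *)
Definition box_volume (c : V * V) : R :=
  \prod_(i < n.+1) Num.max 0 (c.2 0 i - c.1 0 i).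

Definition lebesgue_outer (E : set V) : \bar R :=
  ereal_inf [set (\sum_(0 <= k <oo) (box_volume (c k))%:E)%E
            | c in [set c : nat -> V * V | E `<=` \bigcup_k box (c k)]].

Lemma box_volume_ge0 c : (0 <= (box_volume c)%:E)%E.
Proof. by rewrite lee_fin prodr_ge0// => i _; rewrite le_max lexx. Qed.

Local Open Scope ereal_scope.

Lemma lebesgue_outer_ge0 E : 0 <= lebesgue_outer E.
Proof.
apply: le_ereal_inf_tmp => _ [c _ <-].
by apply: nneseries_ge0 => k _ _; exact: box_volume_ge0.
Qed.

Lemma lebesgue_outer0 : lebesgue_outer set0 = 0.
Proof.
apply/eqP; rewrite eq_le lebesgue_outer_ge0 andbT.
apply: ereal_inf_lbound; exists (fun=> (0, 0)%R); first by [].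
rewrite eseries0// => k _ _.
by rewrite /box_volume big_ord_recl/= subrr maxxx mul0r.
Qed.

Lemma le_lebesgue_outer : {homo lebesgue_outer : A B / A `<=` B >-> A <= B}.
Proof.
move=> A B AB; apply/ereal_inf_le_tmp => _ [c Bc <-].
by exists c => //; exact: subset_trans AB Bc.
Qed.

Lemma lebesgue_outer_sigma_subadditive : sigma_subadditive lebesgue_outer.
Proof.
move=> A; have [[i ioo]|] := pselect (exists i, lebesgue_outer (A i) = +oo).
  rewrite (eseries_pinfty _ _ ioo) ?leey// => k _.
  by rewrite -ltNye (lt_le_trans _ (lebesgue_outer_ge0 _)).
rewrite -forallNE => Aoo.
apply/lee_addgt0Pr => _/posnumP[e].
rewrite (le_trans _ (epsilon_trick _ _ _))//; last first.
  by move=> k; exact: lebesgue_outer_ge0.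
pose P k (c : nat -> V * V) := A k `<=` \bigcup_j box (c j) /\
  \sum_(0 <= j <oo) (box_volume (c j))%:E
    <= lebesgue_outer (A k) + (e%:num / (2 ^ k.+1)%:R)%:E.
have [G PG] : {G : nat -> nat -> V * V & forall k, P k (G k)}.
  apply: (@choice _ _ P) => k; rewrite /P.
  have en1 : (0 < e%:num / (2 ^ k.+1)%:R :> R)%R by [].
  have fink : lebesgue_outer (A k) \is a fin_num.
    by rewrite ge0_fin_numE ?lebesgue_outer_ge0// ltey; apply/eqP; exact: Aoo.
  have [_ [c Ac <-] /ltW] := lb_ereal_inf_adherent en1 fink.
  by exists c.
have /card_esym/ppcard_eqP[f] := card_nat2.
pose v (p : nat * nat) := (box_volume (G p.1 p.2))%:E.
have v_ge0 p : 0 <= v p by exact: box_volume_ge0.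
apply: (@le_trans _ _ (\esum_(i in setT) v i)).
  apply: ereal_inf_lbound => /=.
  exists (fun k => G (f k).1 (f k).2).
    move=> t [i _ /(PG i).1[j _ Gt]]; exists (f^-1%FUN (i, j)) => //=.
    by rewrite invK ?inE.
  rewrite -[LHS](esum_pred_image v f xpredT) ?[fun=> _]set_true//.
  by rewrite image_eq.
pose J : nat -> set (nat * nat) := fun i => [set (i, j) | j in setT].
rewrite (_ : setT = \bigcup_k J k); last first.
  by rewrite predeqE => -[a b]; split => // _; exists a => //; exists b.
rewrite esum_bigcupT /=; last 2 first.
  - apply/trivIsetP => i j _ _ ij.
    rewrite predeqE => -[p q] /=; split => //= -[] [_] _ [<-{p} _].
    by move=> [q' _] [] /esym/eqP; rewrite (negbTE ij).
  - by move=> p; exact: v_ge0.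
rewrite -(image_id [set: nat]) -fun_true esum_pred_image//; last first.
  by move=> k _; exact: esum_ge0.
apply: lee_nneseries => [k _ _|k _]; first exact: esum_ge0.
apply: le_trans (PG k).2.
rewrite /J -fun_true (esum_pred_image v (pair k) xpredT)//=.
by move=> ? ? _ _ [].
Qed.

HB.instance Definition _ := isOuterMeasure.Build R V lebesgue_outer
  lebesgue_outer0 lebesgue_outer_ge0 le_lebesgue_outer
  lebesgue_outer_sigma_subadditive.

Definition lebesgue_outer_measure : {outer_measure set V -> \bar R} :=
  lebesgue_outer.

(* R^m with the sigma-algebra of the Lebesgue-measurable sets. *)
Definition lebesgue_space := caratheodory_type lebesgue_outer_measure.

HB.instance Definition _ := Measurable.on lebesgue_space.

Definition leb : {measure set lebesgue_space -> \bar R} :=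
  (lebesgue_outer_measure : set (caratheodory_type lebesgue_outer_measure) -> _).

End lebesgue.
Arguments leb {R n}.

Section dirichlet.
Context (R : realType) (n : nat).
Notation V := 'rV[R]_n.+1.
Implicit Types (Omega A : set V) (f v w phi : V -> R) (Dv Dw : 'I_n.+1 -> V -> R).

Definition measurable_set A : Prop := measurable (A : set (lebesgue_space R n)).

Definition partial (i : 'I_n.+1) f : V -> R :=
  fun x => 'D_(delta_mx 0 i : V) f x.

(* C^infinity: every iterated partial derivative exists and is continuous. *)
Definition smooth f : Prop := forall s : seq 'I_n.+1,
  let g := foldr partial f s in
  continuous g /\ forall i x, derivable g x (delta_mx 0 i : V).

Definition supp f : set V := closure [set x | f x != 0].

Definition test_function Omega phi : Prop :=
  [/\ smooth phi, compact (supp phi) & supp phi `<=` Omega].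

Definition L2 Omega f : Prop :=
  measurable_fun (Omega : set (lebesgue_space R n)) f /\
  (\int[leb]_(x in Omega) (f x ^+ 2)%:E < +oo)%E.

Definition L2_cvg Omega (f_ : nat -> V -> R) f : Prop :=
  (\int[leb]_(x in Omega) ((f_ k x - f x) ^+ 2)%:E)%E @[k --> \oo] --> 0%E.

(* v is in H^1(Omega), with weak gradient Dv. *)
Definition H1 Omega v Dv : Prop :=
  [/\ L2 Omega v, forall i, L2 Omega (Dv i) &
      forall phi i, test_function Omega phi ->
        (\int[leb]_(x in Omega) (v x * partial i phi x)%:E =
         - \int[leb]_(x in Omega) (Dv i x * phi x)%:E)%E].

(* H^1_0(Omega) is the closure of the test functions in H^1(Omega). *)
Definition H10 Omega v Dv : Prop :=
  H1 Omega v Dv /\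
  exists phi_ : nat -> V -> R,
    [/\ forall k, test_function Omega (phi_ k), L2_cvg Omega phi_ v &
        forall i, L2_cvg Omega (fun k => partial i (phi_ k)) (Dv i)].

(* -Laplacian v = f in Omega, v = 0 on the boundary. *)
Definition weak_solution Omega f v : Prop :=
  exists2 Dv, H10 Omega v Dv & forall w Dw, H10 Omega w Dw ->
    (\int[leb]_(x in Omega) (\sum_(i < n.+1) Dv i x * Dw i x)%:E =
     \int[leb]_(x in Omega) (f x * w x)%:E)%E.

Definition source Omega A (gamma : R) : V -> R :=
  fun x => gamma * \1_(Omega `\` A) x - (1 - gamma) * \1_A x.

(* v_{Omega,A,gamma}; as an element of H^1_0(Omega) it is unique only almost
   everywhere on Omega, so that a representative is chosen. *)
Definition dirichlet_sol Omega A (gamma : R) : V -> R :=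
  xget (cst 0) [set v | weak_solution Omega (source Omega A gamma) v].

(* The value +oo outside Omega does not contribute to the essential infimum. *)
Definition ess_inf_on Omega f : \bar R :=
  ess_inf leb (patch (cst +oo%E) Omega (EFin \o f)).

Definition C_plus Omega (gamma : R) : \bar R :=
  ereal_inf [set c%:E | c in [set c : R | 0 <= c /\
    forall A, measurable_set A -> A `<=` Omega -> (c%:E < leb A)%E ->
      (ess_inf_on Omega (dirichlet_sol Omega A gamma) < 0)%E]].

End dirichlet.

(* Main.v *)
(* If v >= 0 a.e. then the source f has nonnegative integral: testing the weak
   equation for v + tau b, with b a smooth exhaustion of Omega, against a smooth
   truncation T(v + tau b) of it gives int (f - tau Delta b) T(v + tau b) >= 0,
   and T(v + tau b) tends to 1 on Omega as tau and the width of the truncation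
   tend to 0.  Hence |A| > gamma |Omega| forces ess inf v < 0.
   Conversely, when c < gamma |Omega|, a test function w >= 0 with
   Delta w >= -f gives v >= w >= 0.  It is a laminate
   w(x) = eta(x) e^2 q(x_0 / e + j), where eta is a cutoff and q >= 0 is a
   periodic profile with q'' >= -gamma everywhere and q'' = 1 - gamma on nearly a
   fraction gamma of each period; A is the part of {eta = 1} where
   q'' >= 1 - gamma.  Averaging over the shifts j shows that some j gives
   |A| > c.  *)
Require Import Defs.
From HB Require Import structures.
From mathcomp Require Import all_boot all_order all_algebra.
From mathcomp Require Import all_classical all_reals all_analysis.
From mathcomp Require Import measurable_realfun ess_sup_inf.
From mathcomp Require Import ring lra zify.

Set Implicit Arguments.
Unset Strict Implicit.
Unset Printing Implicit Defensive.

Import Order.TTheory GRing.Theory Num.Theory.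
Import numFieldNormedType.Exports.

Local Open Scope classical_set_scope.
Local Open Scope ring_scope.

(** [Omega] may be unbounded and have an irregular boundary; only its measure is finite. Existence
    of [v] therefore rests on a Poincare inequality for sets of finite measure, obtained by
    averaging translates over a box much larger than [Omega], and on minimising the energy over test
    functions. Nonlinear arguments are carried out on approximating test functions: composed with a
    smooth [T] vanishing at 0 they remain test functions, and only the resulting inequalities are
    passed to the limit. This is why positive part, negative part and sign function appear as smooth
    ramps and steps. The term [tau b] takes care of the set where [v = 0]: truncations of [v] itself
    vanish there, so that this set would be lost from the integral of [f]. In the laminate, [q'']
    has mean zero over a period; with the lower bound [- gamma] this forces the fraction where
    [q'' = 1 - gamma] to be at most [gamma], which is where the constant comes from. The factor
    [e ^ 2] makes all terms in which a derivative falls on the cutoff of order [e], while [q'']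
    keeps its size. *)

Arguments leb {R n} : simpl never.

(** * Measurability, translation invariance and size of Lebesgue measure *)

Section lebesgue_measurability.
Context (R : realType) (n : nat).
Notation V := 'rV[R]_n.+1.
Notation X := (lebesgue_space R n).

Lemma lebesgue_outer_box_le (c : V * V) :
  (lebesgue_outer (box c) <= (box_volume c)%:E)%E.
Proof.
apply: ereal_inf_lbound => /=.
exists (fun k => if k is 0%N then c else ((0, 0) : V * V)).
  by move=> x cx; exists 0%N.
rewrite nneseries_recl//; last first.
  by move=> k _; exact: box_volume_ge0.
rewrite [X in (_ + X)%E](_ : _ = 0%E) ?adde0//.
rewrite eseries_cond/= eseries0// => -[|k]//= _ _.
by rewrite /box_volume big_ord_recl/= subrr maxxx mul0r.
Qed.

Let upd (i : 'I_n.+1) (x : V) (a : R) : V :=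
  \row_j if j == i then a else x 0 j.

(** The hyperplane [x 0 i = a] cuts each box of a cover into two boxes, [lo] and [hi], that are
    half-open in the same sense and whose truncated volumes add up. A cover of [E] thus splits into
    covers of its two parts at no cost, which is the Caratheodory criterion. *)
Lemma measurable_halfspace (i : 'I_n.+1) (a : R) :
  measurable ([set x : V | x 0 i <= a] : set X).
Proof.
apply: le_caratheodory_measurable => E.
apply: le_ereal_inf_tmp => _ [c Ec <-].
pose lo k : V * V := ((c k).1, upd i (c k).2 (Num.min a ((c k).2 0 i))).
pose hi k : V * V := (upd i (c k).1 (Num.max a ((c k).1 0 i)), (c k).2).
have -> : (\sum_(0 <= k <oo) (box_volume (c k))%:E =
    \sum_(0 <= k <oo) (box_volume (lo k))%:E +
    \sum_(0 <= k <oo) (box_volume (hi k))%:E)%E.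
  rewrite -nneseriesD; [|by move=> *; exact: box_volume_ge0..].
  apply: eq_eseriesr => k _; rewrite -EFinD; congr (_%:E).
  have D1 (F : 'I_n.+1 -> R) : \prod_j F j = F i * \prod_(j | j != i) F j.
    by rewrite (bigD1 i).
  rewrite /box_volume !D1/= !mxE eqxx.
  under [in RHS]eq_bigr => j ji do rewrite mxE (negbTE ji).
  under [X in _ = _ + _ * X]eq_bigr => j ji do rewrite mxE (negbTE ji).
  rewrite -mulrDl; congr (_ * _).
  set p := (c k).1 0 i; set q := (c k).2 0 i.
  have [aq|aq] := leP a q; have [ap|ap] := leP a p;
    do !case: (lerP 0 _) => ?; lra.
apply: leeD.
  apply: ereal_inf_lbound => /=; exists lo => // x [Ex xa].
  have [k _ kx] := Ec _ Ex; exists k => // j; have := kx j.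
  rewrite !in_itv/= mxE; case: eqP => [->|_ //] /andP[-> xb].
  by rewrite le_min xb xa.
apply: ereal_inf_lbound => /=; exists hi => // x [Ex /negP xa].
have [k _ kx] := Ec _ Ex; exists k => // j; have := kx j.
rewrite !in_itv/= mxE; case: eqP => [->|_ //] /andP[bx ->].
by rewrite gt_max bx ltNge xa.
Qed.

Lemma measurable_coord (i : 'I_n.+1) :
  measurable_fun [set: X] (fun x : X => (x : V) 0 i).
Proof.
apply: (measurability _ (RGenOInfty.measurableE R)) => _ [_ [a ->] <-].
rewrite setTI.
have -> : (fun x : X => (x : V) 0 i) @^-1` `]a, +oo[ =
    ~` ([set x : V | x 0 i <= a] : set X).
  by apply/seteqP; split => x /=; rewrite in_itv/= andbT ltNge => /negP.
by apply: measurableC; exact: measurable_halfspace.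
Qed.

Definition cube (c : V) (r : R) : set V := [set y | forall i, `|c 0 i - y 0 i| < r].

Lemma measurable_cube c r : measurable (cube c r : set X).
Proof.
have -> : cube c r =
   \bigcap_(i in [set: 'I_n.+1]) ((fun x : X => (x : V) 0 i) @^-1` ball (c 0 i) r).
  by apply/seteqP; split => [y cy i _|y cy i]; [exact: cy|exact: (cy i I)].
apply: fin_bigcap_measurable => // i _.
rewrite -[X in measurable X]setTI.
by apply: measurable_coord => //; exact: measurable_ball.
Qed.

Lemma ball_cube (c : V) r : ball c r = cube c r.
Proof.
apply/seteqP; split=> y /=; first by move=> [_ h] i; exact: (h 0 i).
move=> h; split=> [|i j]; last by rewrite ord1; exact: h.
by have := h 0; exact: le_lt_trans.
Qed.

(** An enumeration of all cubes with rational centre and radius; an integer that encodes nothing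
    gives radius 0, hence an empty open cube. *)
Definition rat_cube (k : nat) : V * R :=
  if unpickle k is Some p then (map_mx ratr (p : 'rV[rat]_n.+1 * rat).1, ratr p.2)
  else (0, 0).

(** A rational radius below [e / 2] and a centre within that radius of [x] keep the closed cube
    inside the [e]-ball. The closed cube is asked to lie in [O] because it will carry the support of
    a bump. *)
Lemma rat_cube_basis (O : set V) (x : V) : open O -> O x -> exists k,
  cube (rat_cube k).1 (rat_cube k).2 x /\
  forall y : V, (forall i, `|(rat_cube k).1 0 i - y 0 i| <= (rat_cube k).2) -> O y.
Proof.
rewrite openE => /[apply] /nbhs_ballP[e /= e0]; rewrite ball_cube => eO.
have e20 : 0 < e / 2 by rewrite divr_gt0.
have [r] := rat_in_itvoo e20; rewrite in_itv/= => /andP[r0 re].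
have [c cP] : {c : 'I_n.+1 -> rat & forall i, `|ratr (c i) - x 0 i| < ratr r}.
  apply: (@choice _ _ (fun i q => `|ratr q - x 0 i| < ratr r)) => i.
  have xr : x 0 i < x 0 i + ratr r by rewrite ltrDl.
  have [q] := rat_in_itvoo xr; rewrite in_itv/= => /andP[q1 q2].
  by exists q; rewrite ger0_norm ?subr_ge0 ?(ltW q1)// ltrBlDr addrC.
exists (pickle ((\row_i c i) : 'rV[rat]_n.+1, r)).
rewrite /rat_cube pickleK/=; split => [i|y yr]; first by rewrite !mxE cP.
apply: eO => i; have := cP i; have := yr i; rewrite !mxE => h1 h2.
rewrite distrC in h2.
have := ler_distD (ratr (c i)) (x 0 i) (y 0 i); lra.
Qed.

Lemma open_measurable_leb (O : set V) : open O -> measurable (O : set X).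
Proof.
move=> oO.
pose C k : set X := if `[< cube (rat_cube k).1 (rat_cube k).2 `<=` O >]
  then cube (rat_cube k).1 (rat_cube k).2 else set0.
have -> : O = \bigcup_k C k.
  apply/seteqP; split => [x Ox|x [k _]]; last first.
    by rewrite /C; case: asboolP => // h; exact: h.
  have [k [kx ky]] := rat_cube_basis oO Ox; exists k => //.
  rewrite /C; case: asboolP => // -[] y /= yk.
  by apply: ky => i; apply: ltW; exact: yk.
apply: bigcupT_measurable => k; rewrite /C; case: ifP => // _.
exact: measurable_cube.
Qed.

Lemma continuous_measurable_leb (f : V -> R) : continuous f ->
  measurable_fun [set: X] (f : X -> R).
Proof.
move=> /continuousP cf.
apply: (measurability _ (RGenOpens.measurableE R)) => _ [_ [a [b ->] <-]].
by rewrite setTI; apply: open_measurable_leb; apply: cf; exact: interval_open.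
Qed.

(* Continuity does not give measurability for the product of the Lebesgue
   sigma-algebras unless open sets of the product are countable unions of
   products of cubes. *)
Lemma continuous_measurable_leb2 (f : V * V -> R) : continuous f ->
  measurable_fun [set: X * X] (f : X * X -> R).
Proof.
move=> /continuousP cf.
apply: (measurability _ (RGenOpens.measurableE R)) => _ [_ [a [b ->] <-]].
rewrite setTI.
have : open (f @^-1` `]a, b[) by apply: cf; exact: interval_open.
set O : set (V * V) := _ @^-1` _ => oO.
pose cu k := cube (rat_cube k).1 (rat_cube k).2.
pose C k l : set (X * X) := if `[< cu k `*` cu l `<=` O >] then cu k `*` cu l
  else set0.
have -> : O = \bigcup_k \bigcup_l C k l.
  apply/seteqP; split => [[x y] Oxy|x [k _ [l _]]]; last first.
    by rewrite /C; case: asboolP => // h; exact: h.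
  move: oO; rewrite openE => /(_ _ Oxy)[[P Q] /= [Px Qy] PQ].
  have [k [kx ky]] := rat_cube_basis (@open_interior _ P) Px.
  have [l [lx ly]] := rat_cube_basis (@open_interior _ Q) Qy.
  exists k => //; exists l => //.
  rewrite /C; case: asboolP => // -[] [s t] /= [sk tl]; apply: PQ; split => /=.
    by apply: interior_subset; apply: ky => i; apply: ltW; exact: sk.
  by apply: interior_subset; apply: ly => i; apply: ltW; exact: tl.
apply: bigcupT_measurable => k; apply: bigcupT_measurable => l.
rewrite /C; case: ifP => // _.
by apply: measurableX; exact: measurable_cube.
Qed.

Lemma lebesgue_outer_shift (h : V) (E : set V) :
  lebesgue_outer [set x | E (x + h)] = lebesgue_outer E.
Proof.
suff le_shift (g : V) (F : set V) : (lebesgue_outer [set x | F (x + g)%R] <= lebesgue_outer F)%E.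
  apply/eqP; rewrite eq_le le_shift/=.
  have := le_shift (- h) [set x | E (x + h)].
  by under [X in lebesgue_outer X]eq_set => x /= do rewrite subrK.
apply: le_ereal_inf_tmp => _ [c Fc <-].
apply: ereal_inf_lbound => /=.
exists (fun k => ((c k).1 - g, (c k).2 - g)).
  move=> x /= /Fc[k _ kx]; exists k => // i; have := kx i.
  by rewrite /= !in_itv/= !mxE lerBrDr ltrBlDr.
apply: eq_eseriesr => k _; rewrite /box_volume; congr (_%:E).
by apply: eq_bigr => i _ /=; rewrite !mxE; congr Num.max; ring.
Qed.

(** The Caratheodory condition for the translate, tested on [Y], is the one for [E] tested on the
    translate of [Y] the other way. *)
Lemma measurable_shift (h : V) (E : set X) : measurable E ->
  measurable ([set x : V | E (x + h)] : set X).
Proof.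
move=> mE; apply: le_caratheodory_measurable => Y /=.
have := mE [set x | Y (x - h)].
rewrite /lebesgue_outer_measure/=.
rewrite -(lebesgue_outer_shift h [set x | Y (x - h)]).
rewrite -(lebesgue_outer_shift h ([set x | Y (x - h)] `&` E)).
rewrite -(lebesgue_outer_shift h ([set x | Y (x - h)] `&` ~` E)) /=.
under [X in lebesgue_outer X = _]eq_set => x do rewrite addrK.
under [X in _ = (lebesgue_outer X + _)%E]eq_set => x do rewrite addrK.
under [X in _ = (_ + lebesgue_outer X)%E]eq_set => x do rewrite addrK.
by move=> ->.
Qed.

Lemma measurable_fun_shift (h : V) :
  measurable_fun [set: X] ((fun x : V => x + h) : X -> X).
Proof. by move=> _ E mE; rewrite setTI; exact: measurable_shift. Qed.

Lemma ge0_integral_shift (h : V) (f : X -> \bar R) :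
  measurable_fun setT f -> (forall x, 0 <= f x)%E ->
  (\int[leb]_x f ((x : V) + h)%R = \int[leb]_x f x)%E.
Proof.
move=> mf f0.
have := ge0_integral_pushforward (measurable_fun_shift h) leb measurableT mf
  (fun x _ => f0 x).
rewrite preimage_setT => <-.
apply: (eq_measure_integral leb); first exact: measurable_fun_shift.
move=> ? E _ _; exact: (lebesgue_outer_shift h E).
Qed.

Lemma le_norm_coord (x : V) i : `|x 0 i| <= `|x|.
Proof.
rewrite [leRHS]/Num.norm/= mx_normrE.
exact: (le_bigmax _ (fun ij => `|x ij.1 ij.2|) (0, i)).
Qed.

Definition big_box (k : nat) : set V := box (const_mx (- k%:R), const_mx k%:R).

Lemma measurable_box (c : V * V) : measurable (box c : set X).
Proof.
have -> : box c = \bigcap_(i in [set: 'I_n.+1])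
    ((fun x : X => (x : V) 0 i) @^-1` `]c.1 0 i, c.2 0 i]).
  by apply/seteqP; split => [y cy i _|y cy i]; [exact: cy|exact: (cy i I)].
apply: fin_bigcap_measurable => // i _.
by rewrite -[X in measurable X]setTI; exact: measurable_coord.
Qed.

Lemma leb_box_lty (c : V * V) : (leb (box c : set X) < +oo)%E.
Proof. by apply: le_lt_trans (lebesgue_outer_box_le c) _; exact: ltry. Qed.

Lemma big_box_nondecreasing : {homo big_box : k l / (k <= l)%N >-> (k <= l)%O}.
Proof.
move=> k l kl; apply/subsetPset => x /= xk i; have := xk i.
have : (k%:R <= l%:R :> R) by rewrite ler_nat.
by rewrite !in_itv/= !mxE => ? /andP[? ?]; apply/andP; split; lra.
Qed.

Lemma big_box_norm (x : V) k : `|x| < k%:R -> big_box k x.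
Proof.
move=> xk i; rewrite in_itv/= !mxE.
have : `|x 0 i| < k%:R by apply: le_lt_trans xk; exact: le_norm_coord.
by rewrite ltr_norml => /andP[-> /ltW].
Qed.

Lemma bigcup_big_box : \bigcup_k big_box k = setT.
Proof.
apply/seteqP; split => // x _; exists (Num.truncn `|x|).+1 => //.
by apply: big_box_norm; exact: truncnS_gt.
Qed.

Lemma leb_sigma_finite : sigma_finite [set: X] (leb : set X -> \bar R).
Proof.
exists (big_box : nat -> set X); first by rewrite bigcup_big_box.
by move=> k; split; [exact: measurable_box|exact: leb_box_lty].
Qed.

(** A copy of [leb] that carries the sigma-finite structure asked for by Fubini-Tonelli; integrals
    against the two agree. *)
Definition leb_sfin : set X -> \bar R := leb.

Let leb_sfin0 : leb_sfin set0 = 0%E. Proof. exact: measure0. Qed.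
Let leb_sfin_ge0 E : (0 <= leb_sfin E)%E. Proof. exact: measure_ge0. Qed.
Let leb_sfin_sigma : semi_sigma_additive leb_sfin.
Proof. exact: measure_semi_sigma_additive. Qed.

HB.instance Definition _ := isMeasure.Build _ _ _ leb_sfin
  leb_sfin0 leb_sfin_ge0 leb_sfin_sigma.
HB.instance Definition _ := Measure_isSigmaFinite.Build _ _ _ leb_sfin
  leb_sigma_finite.

Lemma leb_tonelli (f : V * V -> R) : continuous f -> (forall z, 0 <= f z) ->
  (\int[leb]_(x in [set: X]) \int[leb]_(y in [set: X]) (f (x, y))%:E =
   \int[leb]_(y in [set: X]) \int[leb]_(x in [set: X]) (f (x, y))%:E)%E.
Proof.
move=> cf f0.
have lebE (g : X -> \bar R) :
    (\int[leb]_(x in [set: X]) g x = \int[leb_sfin]_(x in [set: X]) g x)%E.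
  exact: eq_measure_integral.
rewrite [LHS]lebE [RHS]lebE.
under [LHS]eq_integral do rewrite lebE.
under [RHS]eq_integral do rewrite lebE.
apply: (@fubini_tonelli _ _ X X R leb_sfin leb_sfin (EFin \o f)).
- by apply/measurable_EFinP; exact: continuous_measurable_leb2.
- by move=> z; rewrite lee_fin.
Qed.

Lemma measurable_integral_leb (f : V * V -> R) : continuous f ->
  (forall z, 0 <= f z) ->
  measurable_fun [set: X] (fun y : X => (\int[leb]_(x in [set: X]) (f (x, y))%:E)%E).
Proof.
move=> cf f0.
have lebE (g : X -> \bar R) :
    (\int[leb]_(x in [set: X]) g x = \int[leb_sfin]_(x in [set: X]) g x)%E.
  exact: eq_measure_integral.
under eq_fun do rewrite lebE.
apply: (@measurable_fun_fubini_tonelli_G _ _ X X R leb_sfin (EFin \o f)).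
- by apply/measurable_EFinP; exact: continuous_measurable_leb2.
- by move=> z; rewrite lee_fin.
Qed.

(* By translation, twice the measure of a box is at most the total measure. *)
Lemma leb_setT_dichotomy : leb [set: X] = 0%E \/ leb [set: X] = +oo%E.
Proof.
have cvgT : (leb (big_box k : set X) @[k --> \oo] --> leb [set: X])%E.
  rewrite -bigcup_big_box; apply: nondecreasing_cvg_mu.
  - by move=> k; exact: measurable_box.
  - by rewrite bigcup_big_box.
  - exact: big_box_nondecreasing.
have double k : (2%:E * leb (big_box k : set X) <= leb [set: X])%E.
  have [->|k0] := eqVneq k 0%N.
    rewrite (_ : big_box 0 = set0) ?measure0 ?mule0//.
    apply/seteqP; split => // x /(_ 0); rewrite in_itv/= !mxE oppr0.
    by move=> /andP[/lt_le_trans/[apply]]; rewrite ltxx.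
  (* The box has sides of length [2k], so its translate by [2k] in every coordinate is disjoint from
     it. *)
  pose h : V := const_mx (- (k%:R *+ 2)).
  pose B' : set X := [set x | big_box k (x + h)].
  have -> : (2%:E * leb (big_box k : set X) = leb (big_box k : set X) + leb B')%E.
    have -> : leb B' = leb (big_box k : set X).
      exact: (lebesgue_outer_shift h (big_box k)).
    by rewrite mule_natl mule2n.
  rewrite -measureU//; last 3 first.
  - exact: measurable_box.
  - by apply: measurable_shift; exact: measurable_box.
  - apply/seteqP; split => // x [/(_ 0)] /= + /(_ 0).
    rewrite !in_itv/= !mxE => /andP[_ h1] /andP[h2 _]; lra.
  by apply: le_measure; rewrite ?inE//; apply: measurableU;
    [exact: measurable_box|apply: measurable_shift; exact: measurable_box].
have [->|Tfin] := eqVneq (leb [set: X]) +oo%E; first by right.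
have Tnum : leb [set: X] \is a fin_num by rewrite ge0_fin_numE// ltey.
left; apply/eqP; rewrite eq_le measure_ge0 andbT.
have : (2%:E * leb [set: X] <= leb [set: X])%E.
  have c2 : (2%:E * leb (big_box k : set X) @[k --> \oo] --> 2%:E * leb [set: X])%E.
    by apply: cvgeZl.
  rewrite -(cvg_lim _ c2)//; apply: lime_le; first by apply/cvg_ex; eexists; exact: c2.
  by apply: nearW => k; exact: double.
by rewrite -(fineK Tnum) -EFinM !lee_fin; lra.
Qed.

(** Provides the Poincare inequality with boxes large compared to [Omega]; in the degenerate
    alternative all integrals vanish. *)
Lemma big_box_unbounded (M : R) : leb [set: X] = 0%E \/
  exists k, (M%:E <= leb (big_box k : set X))%E.
Proof.
have [->|Too] := leb_setT_dichotomy; [by left|right].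
have : (leb (big_box k : set X) @[k --> \oo] --> +oo)%E.
  rewrite -Too -bigcup_big_box; apply: nondecreasing_cvg_mu.
  - by move=> k; exact: measurable_box.
  - by rewrite bigcup_big_box.
  - exact: big_box_nondecreasing.
move=> /cvgeyPge/(_ M)[k _ kM]; exists k; exact: (kM k (leqnn k)).
Qed.

End lebesgue_measurability.

(** * Directional derivatives and their reduction to lines *)

Section directional_derivatives.
Context (R : realType) (U : normedModType R).
Implicit Types (f g : U -> R) (a v : U).

Lemma cvg_is_derive f a v df :
  h^-1 *: (f (h *: v + a) - f a) @[h --> 0^'] --> df -> is_derive a v f df.
Proof.
by move=> fdf; apply: DeriveDef; [apply/cvg_ex; exists df|exact: cvg_lim].
Qed.

Lemma is_derive_cvg f a v df : is_derive a v f df ->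
  h^-1 *: (f (h *: v + a) - f a) @[h --> 0^'] --> df.
Proof. by move=> [fav <-]; exact: fav. Qed.

End directional_derivatives.
Arguments is_derive_cvg {R U f a v df}.

Section derivatives_along_lines.
Context (R : realType) (U : normedModType R).
Implicit Types (f : U -> R) (a v : U).

Let is_derive_line_quotient f a v (s : R) :
  (fun h : R => h^-1 *: (f (h *: v + (a + s *: v)) - f (a + s *: v))) =
  (fun h : R => h^-1 *: (f (a + (h *: (1 : R) + s) *: v) - f (a + s *: v))).
Proof.
apply/funext => h; rewrite -[h *: 1]/(h * 1) mulr1 scalerDl.
by congr (_ *: (f _ - _)); rewrite addrCA.
Qed.

Lemma is_derive_line f a v (s : R) df : is_derive (a + s *: v) v f df ->
  is_derive s 1 (fun t : R => f (a + t *: v)) df.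
Proof.
move=> h; have {h} := is_derive_cvg h; rewrite is_derive_line_quotient.
exact: (@cvg_is_derive _ R (fun t : R => f (a + t *: v))).
Qed.

Lemma line_is_derive f a v (s : R) df :
  is_derive s 1 (fun t : R => f (a + t *: v)) df -> is_derive (a + s *: v) v f df.
Proof.
move=> h; apply: cvg_is_derive; rewrite is_derive_line_quotient.
exact: is_derive_cvg h.
Qed.

(** Restriction to the line through [a] along [v] reduces the claim to the chain rule in one
    variable, so only the derivative along [v] enters. *)
Lemma is_derive_comp1 (g : R -> R) f a v dg df :
  is_derive (f a) 1 g dg -> is_derive a v f df -> is_derive a v (g \o f) (dg * df).
Proof.
move=> Hg; have -> : a = a + 0 *: v by rewrite scale0r addr0.
move/is_derive_line => Hf; apply: line_is_derive.
apply: is_derive1_comp => //.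
by rewrite scale0r addr0.
Qed.

End derivatives_along_lines.

(** * Stability of smoothness under algebra and composition *)

Section smoothness.
Context (R : realType) (U : normedModType R) (I : Type) (e : I -> U).
Implicit Types f g : U -> R.

(* [f] has continuous iterated derivatives up to order [k] in the directions
   [e i]; a fuelled version of [smooth], which is also used for functions of a
   real variable. *)
Fixpoint Ck (k : nat) f : Prop := continuous f /\
  if k is k'.+1 then forall i, exists2 f', (forall x, is_derive x (e i) f (f' x)) & Ck k' f'
  else True.

Lemma Ck_continuous k f : Ck k f -> continuous f.
Proof. by case: k => [|k] []. Qed.

Lemma CkW k f : Ck k.+1 f -> Ck k f.
Proof.
elim: k f => [f [] //|k ih f [cf df]]; split => // i.
by have [f' ff' /ih f'k] := df i; exists f'.
Qed.

Lemma Ck_cst k (c : R) : Ck k (fun=> c).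
Proof.
elim: k c => [c|k ih c]; split => //; try by move=> x; exact: cvg_cst.
by move=> i; exists (fun=> 0) => // x; exact: is_derive_cst.
Qed.

Lemma CkD k f g : Ck k f -> Ck k g -> Ck k (fun x => f x + g x).
Proof.
elim: k f g => [f g [cf _] [cg _]|k ih f g [cf df] [cg dg]].
  by split => // x; apply: cvgD; [exact: cf|exact: cg].
split=> [x|i]; first by apply: cvgD; [exact: cf|exact: cg].
have [f' ff' kf'] := df i; have [g' gg' kg'] := dg i.
by exists (fun x => f' x + g' x); [move=> x; exact: is_deriveD|exact: ih].
Qed.

Lemma CkM k f g : Ck k f -> Ck k g -> Ck k (fun x => f x * g x).
Proof.
elim: k f g => [f g [cf _] [cg _]|k ih f g kf kg].
  by split => // x; apply: cvgM; [exact: cf|exact: cg].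
split=> [x|i].
  by apply: cvgM; [exact: (Ck_continuous kf)|exact: (Ck_continuous kg)].
have [f' ff' kf'] := kf.2 i; have [g' gg' kg'] := kg.2 i.
exists (fun x => f x * g' x + g x * f' x).
  by move=> x; exact: is_deriveM.
by apply: CkD; apply: ih => //; exact: CkW.
Qed.

Lemma CkZ k (c : R) f : Ck k f -> Ck k (fun x => c * f x).
Proof. by move=> kf; apply: CkM => //; exact: Ck_cst. Qed.

Lemma CkN k f : Ck k f -> Ck k (fun x => - f x).
Proof.
by move=> kf; rewrite (_ : (fun x => _) = (fun x => -1 * f x)); [exact: CkZ|
  apply/funext => x; rewrite mulN1r].
Qed.

Lemma CkB k f g : Ck k f -> Ck k g -> Ck k (fun x => f x - g x).
Proof. by move=> kf kg; apply: CkD => //; exact: CkN. Qed.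

Lemma Ck_sum (J : Type) (r : seq J) (P : pred J) k (f : J -> U -> R) :
  (forall j, Ck k (f j)) -> Ck k (fun x => \sum_(j <- r | P j) f j x).
Proof.
move=> kf; elim: r => [|j r ih].
  by under eq_fun do rewrite big_nil; exact: Ck_cst.
under eq_fun do rewrite big_cons; case: (P j) => //.
by apply: CkD.
Qed.

Lemma Ck_prod (J : Type) (r : seq J) k (f : J -> U -> R) :
  (forall j, Ck k (f j)) -> Ck k (fun x => \prod_(j <- r) f j x).
Proof.
move=> kf; elim: r => [|j r ih].
  by under eq_fun do rewrite big_nil; exact: Ck_cst.
by under eq_fun do rewrite big_cons; apply: CkM.
Qed.

Lemma Ck_primitive k f (f' : I -> U -> R) : continuous f ->
  (forall i x, is_derive x (e i) f (f' i x)) -> (forall i, Ck k (f' i)) -> Ck k.+1 f.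
Proof. by move=> cf df kf; split => // i; exists (f' i). Qed.

End smoothness.

Section smooth_real.
Context (R : realType).
Implicit Types f g : R -> R.

Definition smooth1 f := forall k, @Ck R R^o unit (fun=> 1) k f.

Lemma is_derive1_continuous f f' : (forall x : R, is_derive x 1 f (f' x)) -> continuous f.
Proof.
move=> ff' x; apply: differentiable_continuous; apply/derivable1_diffP.
exact: ex_derive.
Qed.

Lemma smooth1_primitive f f' : (forall x : R, is_derive x 1 f (f' x)) -> smooth1 f' ->
  smooth1 f.
Proof.
move=> ff' sf' [|k]; first by split=> //; exact: is_derive1_continuous ff'.
by apply: (@Ck_primitive _ _ _ _ _ _ (fun=> f')) => //; exact: is_derive1_continuous ff'.
Qed.

(** The derivative is [(g' \o f) * f'], hence the induction on [k] with [g] generalised: it is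
    applied to [g']. *)
Lemma Ck_comp (U : normedModType R) (I : Type) (e : I -> U) k (g : R -> R)
    (f : U -> R) : smooth1 g -> Ck e k f -> Ck e k (g \o f).
Proof.
elim: k g f => [g f /(_ 0%N)[cg _] [cf _]|k ih g f sg kf].
  by split => // x; apply: continuous_comp; [exact: cf|exact: cg].
split=> [x|i].
  by apply: continuous_comp; [exact: (Ck_continuous kf)|exact: (Ck_continuous (sg 0%N))].
have [f' ff' kf'] := kf.2 i.
have [g' gg' _] := (sg 1%N).2 tt.
(* Each order of [smooth1 g] comes with its own derivative of [g]; uniqueness of derivatives
   identifies them all with [g']. *)
have sg' : smooth1 g'.
  move=> l; have [_ /(_ tt)[g'' gg'' kg'']] := sg l.+1.
  rewrite (_ : g' = g'')//; apply/funext => x.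
  by rewrite -(@derive_val _ _ _ _ _ _ _ (gg' x)) -(@derive_val _ _ _ _ _ _ _ (gg'' x)).
exists (fun x => (g' \o f) x * f' x).
  by move=> x; apply: is_derive_comp1.
by apply: CkM => //; apply: ih => //; exact: CkW.
Qed.

Lemma smooth1_id : smooth1 id.
Proof.
by apply: (@smooth1_primitive _ (fun=> 1)) => k; exact: Ck_cst.
Qed.

Lemma smooth1_affine (a b : R) : smooth1 (fun x => a * x + b).
Proof. by move=> k; apply: CkD; [apply: CkZ; exact: smooth1_id|exact: Ck_cst]. Qed.

Lemma smooth1_comp f g : smooth1 f -> smooth1 g -> smooth1 (f \o g).
Proof. by move=> sf sg k; apply: Ck_comp. Qed.

Lemma derive_affine f f' (a b x : R) : (forall y : R, is_derive y 1 f (f' y)) ->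
  is_derive x 1 (fun x => f (a * x + b)) (a * f' (a * x + b)).
Proof.
move=> ff'; rewrite mulrC -[X in is_derive x 1 X]/(f \o (fun x => a * x + b)).
apply: is_derive1_comp.
have -> : (fun x => a * x + b) = (a \*: id) + cst b by apply/funext.
rewrite -[X in is_derive _ _ _ X](_ : a *: (1 : R) + 0 = a); last first.
  by rewrite addr0 /GRing.scale/= mulr1.
apply: is_deriveD; apply: is_deriveZ.
Qed.

Lemma derive_ge0_le f f' : (forall x : R, is_derive x 1 f (f' x)) ->
  (forall x, 0 <= f' x) -> {homo f : x y / x <= y}.
Proof.
move=> ff' f'0 x y; rewrite le_eqVlt => /predU1P[->//|xy].
have [|c _ fc] := MVT xy (fun z _ => ff' z).
  by apply: continuous_subspaceT; exact: is_derive1_continuous ff'.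
by rewrite -subr_ge0 fc mulr_ge0// subr_ge0 ltW.
Qed.

Lemma derive_mvt f f' (x y : R) : (forall x : R, is_derive x 1 f (f' x)) -> x <= y ->
  exists2 c, x <= c <= y & f y - f x = f' c * (y - x).
Proof.
move=> ff' xy; have [|c cxy fc] := MVT_segment xy (fun z _ => ff' z).
  by apply: continuous_subspaceT; exact: is_derive1_continuous ff'.
by exists c => //; move: cxy; rewrite in_itv.
Qed.

Lemma is_derive_flat f (C : R) : (forall h, `|f h| <= C * h ^+ 2) ->
  is_derive (0 : R) 1 f 0.
Proof.
move=> fC; have f0 : f 0 = 0.
  by apply/eqP; rewrite -normr_le0 (le_trans (fC _))// expr0n/= mulr0.
have C0 : 0 <= C.
  by have := le_trans (normr_ge0 _) (fC 1); rewrite expr1n mulr1.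
apply: cvg_is_derive; apply/cvgrPdist_le => eps eps0; near=> h.
rewrite sub0r normrN f0 subr0 addr0 -[h *: 1]/(h * 1) mulr1.
rewrite -[_ *: _]/(_ * _) normrM normfV.
have h0 : 0 < `|h| by rewrite normr_gt0; near: h; exact: nbhs_dnbhs_neq.
rewrite ler_pdivrMl//; apply: le_trans (fC h) _.
rewrite -real_normK ?num_real// expr2 mulrCA ler_wpM2l//.
have : `|h| <= eps / (C + 1).
  near: h; apply: dnbhs0_le.
  by rewrite divr_gt0// ltr_wpDl.
rewrite ler_pdivlMr ?ltr_wpDl//; apply: le_trans.
by rewrite mulrC ler_wpM2l// lerDl.
Unshelve. all: by end_near. Qed.

End smooth_real.

(** * Smooth steps and ramps on the real line *)

Section smooth_step.
Context (R : realType).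

(* All derivatives of [exp (- 1 / x)] are combinations of these functions. *)
Definition flat (k : nat) (x : R) : R :=
  if 0 < x then x^-1 ^+ k * expR (- x^-1) else 0.

(** [expR y] is the [m]-th power of [expR (y / m)], which is at least [y / m]. *)
Lemma pow_le_expR (m : nat) (y : R) : 0 <= y -> y ^+ m <= m%:R ^+ m * expR y.
Proof.
move=> y0; have [->|m0] := eqVneq m 0%N.
  by rewrite !expr0 mul1r -expR0 ler_expR.
have m_gt0 : 0 < m%:R :> R by rewrite ltr0n lt0n.
have yE : y = m%:R * (y / m%:R) by rewrite mulrCA divff ?mulr1// gt_eqF.
rewrite [in leRHS]yE expRM_natl -exprMn.
apply: lerXn2r; rewrite ?nnegrE ?mulr_ge0 ?expR_ge0 ?(ltW m_gt0)//.
rewrite {1}yE ler_pM2l//.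
by apply: le_trans (expR_ge1Dx _); rewrite lerDr ler01.
Qed.

(** Apply [pow_le_expR] to [1 / x] with exponent [k + m]: the extra [m] powers of [1 / x] become the
    factor [x ^+ m]. The case [m = 2] yields a zero derivative at 0. *)
Lemma flat_le (k m : nat) (x : R) :
  `|flat k x| <= (k + m)%:R ^+ (k + m) * `|x| ^+ m.
Proof.
rewrite /flat; case: ltP => [x0|_]; last first.
  by rewrite normr0 mulr_ge0 ?exprn_ge0.
rewrite !gtr0_norm// ?mulr_gt0 ?exprn_gt0 ?invr_gt0 ?expR_gt0//.
have /(pow_le_expR (k + m)) : 0 <= x^-1 by rewrite invr_ge0 ltW.
rewrite exprD expRN (exprVn _ m).
rewrite -ler_pdivrMr ?expR_gt0// mulrAC ler_pdivrMr ?exprn_gt0//.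
Qed.

Lemma flat_le0 k x : x <= 0 -> flat k x = 0.
Proof. by rewrite /flat ltNge => ->. Qed.

(** The linear span of the functions [flat k] is closed under differentiation, hence consists of
    smooth functions. For [x > 0], [flat k] is [t ^+ k * expR (- t)] at [t = 1 / x]; at 0 the
    quadratic bound of [flat_le] applies. *)
Lemma is_derive_flat_fun k (x : R) :
  is_derive x 1 (flat k) (flat k.+2 x - k%:R * flat k.+1 x).
Proof.
have [x0|x0|->] := ltgtP x 0.
- rewrite !(flat_le0 _ (ltW x0)) mulr0 subr0.
  have h0 : is_derive x 1 (cst 0 : R -> R) 0 by exact: is_derive_cst.
  apply: near_eq_is_derive h0.
  near=> y; rewrite flat_le0// ltW//; near: y; exact: lt_nbhsl.
- pose g (t : R) := t ^+ k * expR (- t).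
  have dg : is_derive x^-1 1 g
      (x^-1 ^+ k * (expR (- x^-1) * -1) + expR (- x^-1) * (k%:R * x^-1 ^+ k.-1)).
    have dX : is_derive (x^-1 : R) 1 (fun t : R => t ^+ k) (k%:R * x^-1 ^+ k.-1).
      have := @is_deriveX _ _ (@id R) k (x^-1) 1 1 (is_derive_id _ _).
      rewrite -[X in is_derive _ _ _ X]/(_ * 1) mulr1.
      by rewrite exprfctE.
    have dE : is_derive (x^-1 : R) 1 (fun t : R => expR (- t)) (expR (- x^-1) * -1).
      have hN : is_derive (x^-1 : R) 1 (fun t : R => - t) (-1).
        exact: (is_deriveN (is_derive_id _ _)).
      exact: (@is_derive1_comp _ expR (fun t : R => - t)).
    exact: (@is_deriveM _ _ (fun t : R => t ^+ k) (fun t => expR (- t))).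
  have dV : is_derive x 1 (fun y : R => y^-1) (- x ^- 2).
    have := @is_deriveV R id x 1 1 _ (is_derive_id _ _).
    rewrite -[_ *: 1]/(_ * 1) mulr1; apply; exact: lt0r_neq0.
  have dgV := is_derive1_comp dg dV.
  have -> : flat k.+2 x - k%:R * flat k.+1 x =
      (x^-1 ^+ k * (expR (- x^-1) * -1) + expR (- x^-1) * (k%:R * x^-1 ^+ k.-1)) *
      - x ^- 2.
    rewrite /flat x0 -exprVn; case: (k) => [|j]/=; first by ring.
    by rewrite !exprS; ring.
  apply: near_eq_is_derive dgV; near=> y.
  by rewrite /flat/= ifT//; near: y; exact: lt_nbhsr.
rewrite !(flat_le0 _ (lexx _)) mulr0 subr0.
apply: (@is_derive_flat _ _ ((k + 2)%:R ^+ (k + 2))) => h.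
by have := flat_le k 2 h; rewrite real_normK ?num_real.
Unshelve. all: by end_near. Qed.

Lemma smooth1_flat k : smooth1 (flat k).
Proof.
move=> l; elim: l k => [|l ih] k.
  by split=> //; exact: is_derive1_continuous (is_derive_flat_fun k).
split=> [|_]; first exact: is_derive1_continuous (is_derive_flat_fun k).
exists (fun x => flat k.+2 x - k%:R * flat k.+1 x).
  by move=> x; exact: is_derive_flat_fun.
by apply: CkB => //; exact: CkZ.
Qed.

Lemma flat0_gt0 x : 0 < x -> 0 < flat 0 x.
Proof. by rewrite /flat => x0; rewrite x0 expr0 mul1r expR_gt0. Qed.

Lemma flat0_ge0 x : 0 <= flat 0 x.
Proof. by rewrite /flat; case: ifP => // _; rewrite expr0 mul1r expR_ge0. Qed.

(* Meant for functions vanishing on the negative half-line, where the choice of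
   the starting point is immaterial. *)
Definition primitive (g : R -> R) (x : R) : R :=
  \int[lebesgue_measure]_(t in `[-1, x]) g t.

Lemma primitive_le0 g x : (forall y : R, y <= 0 -> g y = 0) -> x <= 0 -> primitive g x = 0.
Proof.
move=> g0 x0; rewrite /primitive.
rewrite (@eq_Rintegral _ _ _ _ _ (cst 0)).
  by rewrite Rintegral_cst// mul0r.
by move=> y; rewrite inE/= in_itv/= => /andP[_ yx]; rewrite g0// (le_trans yx).
Qed.

Lemma is_derive_primitive (g : R -> R) (x : R) : continuous g -> (forall y : R, y <= 0 -> g y = 0) ->
  is_derive x 1 (primitive g) (g x).
Proof.
move=> cg g0; have [x0|x0] := ltP x 0.
  rewrite g0 ?ltW//.
  have h0 : is_derive x 1 (cst 0 : R -> R) 0 by exact: is_derive_cst.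
  apply: near_eq_is_derive h0.
  by near=> y; rewrite primitive_le0// ltW//; near: y; exact: lt_nbhsl.
have x1 : -1 < x by rewrite (lt_le_trans _ x0).
have [] := @continuous_FTC1_closed _ g (-1) x (x + 1) _ _ x1 (cg x).
- by rewrite ltrDl.
- apply: continuous_compact_integrable; first exact: segment_compact.
  exact: continuous_subspaceT.
- by move=> dF F'; apply: DeriveDef => //; rewrite -derive1E.
Unshelve. all: by end_near. Qed.

Definition bump (x : R) := flat 0 x * flat 0 (1 - x).

Lemma smooth1_bump : smooth1 bump.
Proof.
move=> k; apply: CkM; first exact: smooth1_flat.
have := smooth1_comp (smooth1_flat 0) (smooth1_affine (-1) 1) k.
by congr Ck; apply/funext => x /=; congr flat; ring.
Qed.

Lemma bump_le0 x : x <= 0 -> bump x = 0.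
Proof. by move=> x0; rewrite /bump flat_le0// mul0r. Qed.

Definition step (x : R) := (primitive bump 1)^-1 * primitive bump x.

Lemma primitive_bump_gt0 : 0 < primitive bump 1.
Proof.
have dp (x : R) : is_derive x 1 (primitive bump) (bump x).
  apply: is_derive_primitive; last exact: bump_le0.
  exact: Ck_continuous (smooth1_bump 0).
have [|c + pc] := MVT (@ltr01 R) (fun z _ => dp z).
  by apply: continuous_subspaceT; exact: is_derive1_continuous dp.
move: pc; rewrite (primitive_le0 bump_le0 (lexx 0)) !subr0 mulr1 => ->.
by rewrite in_itv/= => /andP[c0 c1]; rewrite mulr_gt0// flat0_gt0// subr_gt0.
Qed.

Lemma is_derive_step (x : R) : is_derive x 1 step ((primitive bump 1)^-1 * bump x).
Proof.
apply: is_deriveZ; apply: is_derive_primitive; last exact: bump_le0.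
exact: Ck_continuous (smooth1_bump 0).
Qed.

Lemma smooth1_step : smooth1 step.
Proof.
apply: smooth1_primitive is_derive_step _ => k.
by apply: CkZ; exact: smooth1_bump.
Qed.

Lemma step_le0 x : x <= 0 -> step x = 0.
Proof. by move=> x0; rewrite /step (primitive_le0 bump_le0 x0) mulr0. Qed.

Lemma step_homo : {homo step : x y / x <= y}.
Proof.
apply: derive_ge0_le is_derive_step _ => x.
by rewrite mulr_ge0 ?invr_ge0 ?(ltW primitive_bump_gt0)// mulr_ge0 ?flat0_ge0.
Qed.

(** The derivative [bump] vanishes beyond 1, and the normalisation gives the value 1 there. *)
Lemma step_ge1 x : 1 <= x -> step x = 1.
Proof.
move=> x1; have [c /andP[c1 cx]] := derive_mvt is_derive_step x1.
rewrite /bump [flat 0 (1 - c)]flat_le0 ?subr_le0// !mulr0 mul0r => /eqP.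
rewrite subr_eq0 => /eqP ->.
by rewrite /step mulVf// gt_eqF// primitive_bump_gt0.
Qed.

Lemma step_ge0 x : 0 <= step x.
Proof.
have [x0|x0] := leP x 0; first by rewrite step_le0.
by rewrite -(step_le0 (lexx 0)) step_homo// ltW.
Qed.

Lemma step_le1 x : step x <= 1.
Proof.
have [x0|x0] := leP 1 x; first by rewrite step_ge1.
by rewrite -(step_ge1 (lexx 1)) step_homo// ltW.
Qed.

(** A smooth convex substitute for the positive part: 0 up to [x = 0], of slope 1 from [x = 1] on,
    and above [x - 1] everywhere. *)
Definition ramp : R -> R := primitive step.

Lemma is_derive_ramp (x : R) : is_derive x 1 ramp (step x).
Proof.
by apply: is_derive_primitive; [exact: Ck_continuous (smooth1_step 0)|exact: step_le0].
Qed.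

Lemma smooth1_ramp : smooth1 ramp.
Proof. exact: smooth1_primitive is_derive_ramp smooth1_step. Qed.

Lemma ramp_le0 x : x <= 0 -> ramp x = 0.
Proof. by apply: primitive_le0; exact: step_le0. Qed.

Lemma ramp_homo : {homo ramp : x y / x <= y}.
Proof. by apply: derive_ge0_le is_derive_ramp _ => x; exact: step_ge0. Qed.

Lemma ramp_ge0 x : 0 <= ramp x.
Proof.
have [x0|x0] := leP x 0; first by rewrite ramp_le0.
by rewrite -(ramp_le0 (lexx 0)) ramp_homo// ltW.
Qed.

Lemma ramp_ge1 x y : 1 <= x -> x <= y -> ramp y - ramp x = y - x.
Proof.
move=> x1 xy; have [c /andP[xc _] ->] := derive_mvt is_derive_ramp xy.
by rewrite step_ge1 ?mul1r// (le_trans x1).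
Qed.

Lemma ramp_ge x : x - 1 <= ramp x.
Proof.
have [x1|x1] := leP x 1.
  by rewrite (@le_trans _ _ 0) ?subr_le0// ramp_ge0.
by rewrite -(ramp_ge1 (lexx 1) (ltW x1)) lerBlDr lerDl ramp_ge0.
Qed.

(** The profile of the laminate is built from [ramp2], so that its second derivative is built from
    [step]. *)
Definition ramp2 : R -> R := primitive ramp.

Lemma is_derive_ramp2 (x : R) : is_derive x 1 ramp2 (ramp x).
Proof.
by apply: is_derive_primitive; [exact: Ck_continuous (smooth1_ramp 0)|exact: ramp_le0].
Qed.

Lemma ramp2_le0 x : x <= 0 -> ramp2 x = 0.
Proof. by apply: primitive_le0; exact: ramp_le0. Qed.

End smooth_step.

(** * Test functions and an exhaustion of [Omega] *)

Section test_functions.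
Context (R : realType) (n : nat).
Notation V := 'rV[R]_n.+1.
Implicit Types (phi psi f : V -> R) (Omega : set V) (i : 'I_n.+1).

Notation evec i := (delta_mx 0 i : V).
Notation CkV := (@Ck R V 'I_n.+1 (fun i => evec i)).

(** [foldr] differentiates first along the last entry of [s], so peeling off that entry with [rcons]
    replaces [f] by [partial i f]; this is the recursion of [Ck]. *)
Lemma smoothP f : smooth f <-> forall k, CkV k f.
Proof.
split=> [sf k|].
  elim: k f sf => [|k ih] f sf; first by split => //; have [] := sf [::].
  split=> [|i]; first by have [] := sf [::].
  exists (partial i f) => [x|].
    by apply: DeriveDef => //; have [_] := sf [::]; exact.
  by apply: ih => s; have := sf (rcons s i); rewrite foldr_rcons.
move=> kf s; elim/last_ind: s f kf => [|s i ih] f kf.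
  split; first exact: Ck_continuous (kf 0%N).
  by move=> i x; have [f' ff' _] := (kf 1%N).2 i; exact: ex_derive.
rewrite foldr_rcons; apply: ih => k.
have [f' ff' kf'] := (kf k.+1).2 i.
suff -> : partial i f = f' by [].
by apply/funext => x; exact: derive_val.
Qed.

Lemma smooth_continuous f : smooth f -> continuous f.
Proof. by move=> /(_ [::])[]. Qed.

Lemma smooth_is_derive f i x : smooth f -> is_derive x (evec i) f (partial i f x).
Proof. by move=> /(_ [::])[_ df]; apply: DeriveDef => //; exact: df. Qed.

Lemma smooth_partial f i : smooth f -> smooth (partial i f).
Proof. by move=> sf s; have := sf (rcons s i); rewrite foldr_rcons. Qed.

Lemma smooth_cst (c : R) : smooth (fun _ : V => c).
Proof. by apply/smoothP => k; exact: Ck_cst. Qed.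

Lemma smoothD f g : smooth f -> smooth g -> smooth (fun x => f x + g x).
Proof. by move=> /smoothP sf /smoothP sg; apply/smoothP => k; exact: CkD. Qed.

Lemma smoothM f g : smooth f -> smooth g -> smooth (fun x => f x * g x).
Proof. by move=> /smoothP sf /smoothP sg; apply/smoothP => k; exact: CkM. Qed.

Lemma smooth_comp (g : R -> R) f : smooth1 g -> smooth f -> smooth (g \o f).
Proof. by move=> sg /smoothP sf; apply/smoothP => k; exact: Ck_comp. Qed.

Lemma smooth_prod (J : Type) (r : seq J) (f : J -> V -> R) :
  (forall j, smooth (f j)) -> smooth (fun x => \prod_(j <- r) f j x).
Proof. by move=> sf; apply/smoothP => k; apply: Ck_prod => j; exact: (smoothP _).1 (sf j) k. Qed.

Lemma is_derive_coord i (x v : V) : is_derive x v (fun y : V => y 0 i) (v 0 i).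
Proof.
apply: cvg_is_derive; apply: cvg_near_cst; near=> h.
rewrite !mxE addrK /GRing.scale/= mulrA mulVf ?mul1r//.
by near: h; exact: nbhs_dnbhs_neq.
Unshelve. all: by end_near. Qed.

Lemma smooth_coord i : smooth (fun y : V => y 0 i).
Proof.
apply/smoothP => -[|k]; first by split=> // x; exact: coord_continuous.
apply: (@Ck_primitive _ _ _ _ _ _ (fun j _ => evec j 0 i)).
- by move=> x; exact: coord_continuous.
- by move=> j x; exact: is_derive_coord.
- by move=> j; exact: Ck_cst.
Qed.

Lemma partialD f g i x : smooth f -> smooth g ->
  partial i (fun x => f x + g x) x = partial i f x + partial i g x.
Proof.
move=> sf sg; apply: derive_val; first exact: is_deriveD
  (smooth_is_derive i x sf) (smooth_is_derive i x sg).
Qed.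

Lemma partialM f g i x : smooth f -> smooth g ->
  partial i (fun x => f x * g x) x = f x * partial i g x + g x * partial i f x.
Proof.
move=> sf sg; apply: derive_val; first exact: is_deriveM
  (smooth_is_derive i x sf) (smooth_is_derive i x sg).
Qed.

Lemma partialZ (c : R) f i x : smooth f ->
  partial i (fun x => c * f x) x = c * partial i f x.
Proof.
by move=> sf; apply: derive_val; first exact: is_deriveZ (smooth_is_derive i x sf).
Qed.

Lemma partial_comp (g g' : R -> R) f i x : (forall y : R, is_derive y 1 g (g' y)) ->
  smooth f -> partial i (g \o f) x = g' (f x) * partial i f x.
Proof.
move=> gg' sf; apply: derive_val.
exact: is_derive_comp1 (gg' (f x)) (smooth_is_derive i x sf).
Qed.

Lemma supp_notin phi x : ~ supp phi x -> phi x = 0.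
Proof.
move=> xs; apply/eqP; apply: contra_notT xs => x0.
by apply: subset_closure.
Qed.

Lemma supp_sub phi (K : set V) : closed K -> (forall x, ~ K x -> phi x = 0) ->
  supp phi `<=` K.
Proof.
move=> cK K0; rewrite (closure_id K).1//; apply: closure_subset => x /= /eqP x0.
by apply: contrapT => /K0.
Qed.

Lemma test_function_of_compact Omega phi (K : set V) : smooth phi -> compact K ->
  K `<=` Omega -> (forall x, ~ K x -> phi x = 0) -> test_function Omega phi.
Proof.
move=> sphi cK KO K0.
have clK : closed K by apply: compact_closed => //; exact: norm_hausdorff.
have sK := supp_sub clK K0.
split => //; last exact: subset_trans KO.
by apply: subclosed_compact sK => //; exact: closed_closure.
Qed.

Lemma test_function_of_supp Omega phi psi : test_function Omega phi -> smooth psi ->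
  (forall x, ~ supp phi x -> psi x = 0) -> test_function Omega psi.
Proof. by move=> [_ cK KO] spsi; exact: test_function_of_compact. Qed.

Lemma test_function_partial Omega phi i : test_function Omega phi ->
  test_function Omega (partial i phi).
Proof.
move=> tphi; have [sphi _ _] := tphi.
apply: (test_function_of_supp tphi); first exact: smooth_partial.
move=> x xs; rewrite /partial.
have -> : 'D_(evec i) phi x = 'D_(evec i) (cst 0) x.
  apply: near_eq_derive.
  have : nbhs x (~` supp phi).
    by apply: open_nbhs_nbhs; split => //; apply: closed_openC; exact: closed_closure.
  by apply: filterS => y; exact: supp_notin.
exact: derive_cst.
Qed.

Lemma test_function_comp Omega (g : R -> R) phi : smooth1 g -> g 0 = 0 ->
  test_function Omega phi -> test_function Omega (g \o phi).
Proof.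
move=> sg g0 tphi; have [sphi _ _] := tphi.
apply: (test_function_of_supp tphi); first exact: smooth_comp.
by move=> x /supp_notin /= ->.
Qed.

Lemma test_functionM Omega f phi : smooth f -> test_function Omega phi ->
  test_function Omega (fun x => f x * phi x).
Proof.
move=> sf tphi; have [sphi _ _] := tphi.
apply: (test_function_of_supp tphi); first exact: smoothM.
by move=> x /supp_notin /= ->; rewrite mulr0.
Qed.

Lemma test_functionZ Omega (c : R) phi : test_function Omega phi ->
  test_function Omega (fun x => c * phi x).
Proof. by apply: test_functionM; exact: smooth_cst. Qed.

Lemma test_functionD Omega phi psi : test_function Omega phi ->
  test_function Omega psi -> test_function Omega (fun x => phi x + psi x).
Proof.
move=> [sphi cphi phiO] [spsi cpsi psiO].
apply: (@test_function_of_compact _ _ (supp phi `|` supp psi)).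
- exact: smoothD.
- exact: compactU.
- by move=> x [/phiO|/psiO].
- by move=> x /not_orP[/supp_notin -> /supp_notin ->]; rewrite addr0.
Qed.

Lemma test_function0 Omega : test_function Omega (fun=> 0).
Proof.
apply: (@test_function_of_compact _ _ set0) => //; first exact: smooth_cst.
exact: compact0.
Qed.

Lemma test_functionB Omega phi psi : test_function Omega phi ->
  test_function Omega psi -> test_function Omega (fun x => phi x - psi x).
Proof.
move=> tphi tpsi.
have := test_functionD tphi (test_functionZ (-1) tpsi).
by congr test_function; apply/funext => x; rewrite mulN1r.
Qed.

Lemma test_function_sum Omega (J : Type) (r : seq J) (f : J -> V -> R) :
  (forall j, test_function Omega (f j)) ->
  test_function Omega (fun x => \sum_(j <- r) f j x).
Proof.
move=> tf; elim: r => [|j r ih].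
  by under eq_fun do rewrite big_nil; exact: test_function0.
by under eq_fun do rewrite big_cons; exact: test_functionD.
Qed.

Lemma test_function_bounded Omega phi : test_function Omega phi ->
  exists2 M, 0 <= M & forall x, `|phi x| <= M.
Proof.
move=> [sphi cphi _].
have /compact_bounded[M [_ MP]] : compact (phi @` supp phi).
  apply: continuous_compact => //; apply: continuous_subspaceT.
  exact: smooth_continuous.
exists (Num.max 0 (M + 1)) => [|x]; first by rewrite le_max lexx.
have [xs|/supp_notin ->] := pselect (supp phi x); last first.
  by rewrite normr0 le_max lexx.
rewrite le_max; apply/orP; right.
by apply: (MP (M + 1)); [rewrite ltrDl|exists x].
Qed.

Lemma test_function_big_box Omega phi : test_function Omega phi ->
  exists k0, forall x, ~ big_box k0 x -> phi x = 0.
Proof.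
move=> [_ /compact_bounded[M [_ MP]] _].
exists (Num.truncn (M + 1)).+1 => x xk; apply: supp_notin => xs.
apply: xk; apply: big_box_norm; apply: le_lt_trans (truncnS_gt _).
by apply: (MP (M + 1)) => //; rewrite ltrDl.
Qed.

Lemma test_function_outside Omega phi x : test_function Omega phi -> ~ Omega x ->
  phi x = 0.
Proof. by move=> [_ _ sO] xO; apply: supp_notin => /sO. Qed.

Definition cube_bump (c : V * R) (x : V) : R :=
  \prod_(i < n.+1) (flat 0 (c.2 + (x 0 i - c.1 0 i)) * flat 0 (c.2 - (x 0 i - c.1 0 i))).

Lemma smooth_cube_bump c : smooth (cube_bump c).
Proof.
apply: smooth_prod => i; apply: smoothM.
  have := smooth_comp (smooth1_comp (smooth1_flat R 0) (smooth1_affine 1 (c.2 - c.1 0 i)))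
    (smooth_coord i).
  by congr smooth; apply/funext => x /=; congr flat; ring.
have := smooth_comp (smooth1_comp (smooth1_flat R 0) (smooth1_affine (-1) (c.2 + c.1 0 i)))
  (smooth_coord i).
by congr smooth; apply/funext => x /=; congr flat; ring.
Qed.

Lemma cube_bump_ge0 c x : 0 <= cube_bump c x.
Proof. by apply: prodr_ge0 => i _; rewrite mulr_ge0 ?flat0_ge0. Qed.

Lemma cube_bump_gt0 c x : cube c.1 c.2 x -> 0 < cube_bump c x.
Proof.
move=> cx; apply: prodr_gt0 => i _.
have := cx i; rewrite ltr_norml => /andP[? ?].
by rewrite mulr_gt0 ?flat0_gt0//; lra.
Qed.

Definition closed_cube (c : V * R) : set V := [set y | forall i, `|c.1 0 i - y 0 i| <= c.2].

Lemma compact_closed_cube c : compact (closed_cube c).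
Proof.
have -> : closed_cube c = [set y | forall i, `[c.1 0 i - c.2, c.1 0 i + c.2]%classic (y 0 i)].
  apply/seteqP; split => y yc i; have := yc i; rewrite /= in_itv/= ler_norml.
    by move=> /andP[? ?]; apply/andP; split; lra.
  by move=> /andP[? ?]; apply/andP; split; lra.
apply: (@rV_compact _ _ (fun i => `[c.1 0 i - c.2, c.1 0 i + c.2]%classic)) => i.
exact: segment_compact.
Qed.

Lemma cube_bump_eq0 c x : ~ closed_cube c x -> cube_bump c x = 0.
Proof.
move=> /existsNP[i /negP]; rewrite -ltNge => cx.
rewrite /cube_bump (bigD1 i)//=; apply/eqP; rewrite mulf_eq0; apply/orP; left.
rewrite mulf_eq0; move: cx; rewrite lter_normr => /orP[] cx.
  by rewrite flat_le0 ?eqxx//; lra.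
by rewrite [X in _ || (X == _)]flat_le0 ?eqxx ?orbT//; lra.
Qed.

(** The test is on the closed cube, which is compact and contains the support of the bump. *)
Definition inner_bump Omega (k : nat) : V -> R :=
  if `[< closed_cube (rat_cube R n k) `<=` Omega >] then cube_bump (rat_cube R n k) else cst 0.

(** This is the exhaustion [b] of the overview: each sum is a test function, the sums increase with
    [k], and at each point of an open [Omega] they become positive. *)
Definition exhaust Omega (k : nat) (x : V) : R := \sum_(j < k) inner_bump Omega j x.

Lemma test_exhaust Omega k : test_function Omega (exhaust Omega k).
Proof.
apply: test_function_sum => j; rewrite /inner_bump.
case: asboolP => [cO|_]; last exact: test_function0.
apply: (@test_function_of_compact _ _ (closed_cube (rat_cube R n j))) => //.
- exact: smooth_cube_bump.
- exact: compact_closed_cube.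
- exact: cube_bump_eq0.
Qed.

Lemma inner_bump_ge0 Omega k x : 0 <= inner_bump Omega k x.
Proof. by rewrite /inner_bump; case: ifP => // _; exact: cube_bump_ge0. Qed.

Lemma exhaust_ge0 Omega k x : 0 <= exhaust Omega k x.
Proof. by apply: sumr_ge0 => j _; exact: inner_bump_ge0. Qed.

Lemma exhaust_homo Omega x : {homo (fun k => exhaust Omega k x) : k l / (k <= l)%N >-> k <= l}.
Proof.
move=> k l kl; rewrite /exhaust -(subnKC kl) big_split_ord/= lerDl.
by apply: sumr_ge0 => j _; exact: inner_bump_ge0.
Qed.

Lemma exhaust_gt0 Omega x : open Omega -> Omega x -> exists k, 0 < exhaust Omega k x.
Proof.
move=> oO Ox; have [k [kx kO]] := rat_cube_basis oO Ox.
exists k.+1; rewrite /exhaust big_ord_recr/= ltr_wpDl//.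
  by apply: sumr_ge0 => j _; exact: inner_bump_ge0.
rewrite /inner_bump; case: asboolP => [_|]; first exact: cube_bump_gt0.
by case.
Qed.

Lemma exhaust_eq0 Omega k x : ~ Omega x -> exhaust Omega k x = 0.
Proof. exact: test_function_outside (test_exhaust _ _). Qed.

End test_functions.

(** * Integrals of test functions: integration by parts and translations *)

Section real_integrals.
Context d (T : measurableType d) (R : realType) (mu : {measure set T -> \bar R}).
Context (D : set T) (mD : measurable D).
Implicit Types f g : T -> R.
Local Notation intD f := (mu.-integrable D (EFin \o f)).

Lemma RintegralE f : intD f -> (\int[mu]_(x in D) (f x)%:E)%E = (\int[mu]_(x in D) f x)%:E.
Proof. by move=> fi; rewrite /Rintegral fineK//; exact: integrable_fin_num. Qed.

Lemma Rintegrable_sum (I : Type) (r : seq I) (f : I -> T -> R) :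
  (forall i, intD (f i)) -> intD (fun x => \sum_(i <- r) f i x).
Proof.
move=> fi; rewrite (_ : EFin \o _ = (fun x => \sum_(i <- r) (f i x)%:E)%E).
  by apply: integrable_sum => // i _; exact: fi.
by apply/funext => x; rewrite /= sumEFin.
Qed.

Lemma Rintegral_sum (I : Type) (r : seq I) (f : I -> T -> R) :
  (forall i, intD (f i)) ->
  \int[mu]_(x in D) (\sum_(i <- r) f i x) = \sum_(i <- r) \int[mu]_(x in D) f i x.
Proof.
move=> fi; elim: r => [|i r ih].
  under eq_Rintegral do rewrite big_nil.
  by rewrite big_nil Rintegral_cst// mul0r.
under eq_Rintegral do rewrite big_cons.
by rewrite RintegralD//; [rewrite big_cons ih|exact: Rintegrable_sum].
Qed.

Lemma Rintegral_dct (f_ : nat -> T -> R) f g :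
  (forall k, measurable_fun D (f_ k)) -> measurable_fun D f ->
  {ae mu, forall x, D x -> f_ ^~ x @ \oo --> f x} ->
  intD g -> (forall k x, D x -> `|f_ k x| <= g x) ->
  intD f /\
  (\int[mu]_(x in D) f_ k x)%R @[k --> \oo] --> (\int[mu]_(x in D) f x)%R.
Proof.
move=> mf_ mf f_f ig fg.
have [fi _ cv] : [/\ mu.-integrable D (EFin \o f),
    [sequence (\int[mu]_(x in D) `|(f_ n x)%:E - (f x)%:E|)%E]_n @ \oo --> 0%E &
    [sequence (\int[mu]_(x in D) (f_ n x)%:E)%E]_n @ \oo --> (\int[mu]_(x in D) (f x)%:E)%E].
  apply: (@dominated_convergence _ _ _ mu D mD (fun k => EFin \o f_ k) (EFin \o f) (EFin \o g)) => //.
  - by move=> k; apply/measurable_EFinP.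
  - exact/measurable_EFinP.
  - apply: filterS f_f => x h Dx; apply: cvg_EFin; last exact: h.
    by apply: nearW.
  - by apply: aeW => x k Dx; rewrite /= lee_fin fg.
split => //; rewrite RintegralE// in cv.
exact: fine_cvg cv.
Qed.

End real_integrals.

Section integrals_of_test_functions.
Context (R : realType) (n : nat).
Notation V := 'rV[R]_n.+1.
Notation X := (lebesgue_space R n).
Notation evec i := (delta_mx 0 i : V).
Implicit Types (phi psi f : V -> R) (Omega : set V) (i : 'I_n.+1) (h : V).

Lemma integral_shift h (f : X -> \bar R) : measurable_fun setT f ->
  (\int[leb]_x f ((x : V) + h)%R = \int[leb]_x f x)%E.
Proof.
move=> mf; rewrite integralE [RHS]integralE.
congr (_ - _)%E.
  rewrite -[RHS](ge0_integral_shift h (measurable_funepos mf) (funepos_ge0 f)).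
  by apply: eq_integral => x _; rewrite !funeposE.
rewrite -[RHS](ge0_integral_shift h (measurable_funeneg mf) (funeneg_ge0 f)).
  by apply: eq_integral => x _; rewrite !funenegE.
Qed.

Lemma Rintegral_shift h (f : X -> R) : measurable_fun setT f ->
  \int[leb]_x f ((x : V) + h) = \int[leb]_x f x.
Proof.
move=> mf; rewrite /Rintegral; congr fine.
by apply: (integral_shift h (f := EFin \o f)); exact/measurable_EFinP.
Qed.

Lemma bounded_support_integrable (f : X -> R) M k : measurable_fun setT f ->
  (forall x, `|f x| <= M) -> (forall x : V, ~ big_box k x -> f x = 0) ->
  leb.-integrable [set: X] (EFin \o f).
Proof.
move=> mf fM f0.
have -> : EFin \o f = (EFin \o f) \_ (big_box k : set X).
  apply/funext => x; rewrite patchE; case: ifPn => // /negP; rewrite inE => xk.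
  by rewrite /= f0.
apply/(integrable_mkcond _ (measurable_box _)).
apply: measurable_bounded_integrable.
- exact: measurable_box.
- exact: leb_box_lty.
- exact: measurable_funTS.
- exists M; split => //; rewrite ?num_real// => y My x _.
  by apply: le_trans (fM x) _; exact: ltW.
Qed.

Lemma Rintegral_restrict Omega (f : X -> R) : (forall x, ~ Omega x -> f x = 0) ->
  \int[leb]_(x in (Omega : set X)) f x = \int[leb]_x f x.
Proof.
move=> f0; rewrite Rintegral_mkcond; congr Rintegral.
apply/funext => x; rewrite patchE; case: ifPn => // /negP; rewrite inE => xO.
by rewrite f0.
Qed.

Lemma test_function_measurable Omega phi : test_function Omega phi ->
  measurable_fun [set: X] (phi : X -> R).
Proof. by move=> [sphi _ _]; apply: continuous_measurable_leb; exact: smooth_continuous. Qed.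

Lemma test_function_integrable Omega phi : test_function Omega phi ->
  leb.-integrable [set: X] (EFin \o (phi : X -> R)).
Proof.
move=> tphi; have [M _ phiM] := test_function_bounded tphi.
have [k phik] := test_function_big_box tphi.
exact: bounded_support_integrable (test_function_measurable tphi) phiM phik.
Qed.

Lemma shift_measurable Omega phi h : test_function Omega phi ->
  measurable_fun [set: X] ((fun x : V => phi (x + h)) : X -> R).
Proof.
move=> tphi; apply: (measurableT_comp (test_function_measurable tphi)).
exact: measurable_fun_shift.
Qed.

Lemma shift_integrable Omega phi h : test_function Omega phi ->
  leb.-integrable [set: X] (EFin \o ((fun x : V => phi (x + h)) : X -> R)).
Proof.
move=> tphi; have /integrableP[mphi phioo] := test_function_integrable tphi.
apply/integrableP; split; first by apply/measurable_EFinP; exact: shift_measurable tphi.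
rewrite (@integral_shift h (fun x => `|(phi x)%:E|%E)); first exact: phioo.
by apply: measurableT_comp mphi; exact: abse_measurable.
Qed.

Section difference_quotients.
Variables (Omega : set V) (phi : V -> R) (tphi : test_function Omega phi).
Variables (i : 'I_n.+1) (t : R) (t0 : 0 < t).

(** The step divides [t] into [k.+1] equal pieces, so that a translation by [t] can be telescoped
    over translations by [s k]. *)
Let s (k : nat) : R := t / k.+1%:R.
Let q (k : nat) (x : V) : R := (phi (x + s k *: evec i) - phi x) / s k.

Let s_gt0 k : 0 < s k. Proof. by rewrite divr_gt0. Qed.

Let s_le k : s k <= t.
Proof. by rewrite ler_pdivrMr// ler_peMr ?ler1n// ltW. Qed.

Let q_cvg x : q k x @[k --> \oo] --> partial i phi x.
Proof.
have sphi : smooth phi by case: tphi.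
have h := is_derive_cvg (smooth_is_derive i x sphi).
have s0 : s k @[k --> \oo] --> 0^'.
  have s0 : s k @[k --> \oo] --> 0.
    rewrite -[X in _ --> X](mulr0 t); apply: cvgM; first exact: cvg_cst.
    exact: cvg_harmonic.
  move=> A A0; have sA : \forall k \near \oo, s k != 0 -> A (s k) := s0 _ A0.
  have : \forall k \near \oo, A (s k) by apply: filterS sA => k; apply; rewrite gt_eqF.
  by [].
have := cvg_comp _ _ s0 h; apply: cvg_trans; apply: near_eq_cvg; apply: nearW => k /=.
by rewrite /q [RHS]mulrC [s k *: _ + x]addrC.
Qed.

Let q_bound M : (forall x, `|partial i phi x| <= M) -> forall k x, `|q k x| <= M.
Proof.
move=> dM k x; have sphi : smooth phi by case: tphi.
have dl (r : R) : is_derive r 1 (fun r : R => phi (x + r *: evec i)) (partial i phi (x + r *: evec i)).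
  by apply: is_derive_line; exact: smooth_is_derive.
have [c _] := derive_mvt dl (ltW (s_gt0 k)).
rewrite scale0r addr0 subr0 /q => ->.
by rewrite mulfK ?gt_eqF.
Qed.

Let q_support : exists k0, forall k x, ~ big_box k0 x -> q k x = 0.
Proof.
have [k0 phik] := test_function_big_box tphi.
have [l tl] : exists l : nat, t < l%:R by exists (Num.truncn t).+1; exact: truncnS_gt.
(* All shifts are positive and at most [t < l], so enlarging the box by [l] captures every shifted
   support. *)
exists (k0 + l)%N => k x xk.
rewrite /q !phik ?subrr ?mul0r//; apply: contra_not xk => xk j; have := xk j.
  rewrite !in_itv/= !mxE natrD; have := ler0n R k0; move: tl t0.
  move: (l%:R) (k0%:R) => l' k0' ? ? ? /andP[? ?]; apply/andP; split; lra.
rewrite !in_itv/= !mxE natrD eqxx/=.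
have := ler0n R k0; have := s_gt0 k; have := s_le k; move: tl t0.
move: (l%:R) (k0%:R) => l' k0' ? ? ? ? ?.
by case: (j == i) => /=; rewrite ?mulr1 ?mulr0 ?addr0 => /andP[? ?];
  apply/andP; split; lra.
Qed.

Let q_measurable k : measurable_fun [set: X] (q k : X -> R).
Proof.
apply: measurable_funM; last exact: measurable_cst.
apply: measurable_funB; first exact: shift_measurable tphi.
exact: test_function_measurable tphi.
Qed.

(** Dominated convergence: the mean value theorem bounds the quotients by a bound of the partial
    derivative, and their supports stay in one box. *)
Lemma difference_quotient_cvg :
  (\int[leb]_x (q k x))%R @[k --> \oo] --> (\int[leb]_x partial i phi x)%R /\
  (\int[leb]_x (q k x ^+ 2))%R @[k --> \oo] --> (\int[leb]_x (partial i phi x ^+ 2))%R.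
Proof.
have tp := test_function_partial i tphi.
have [M M0 dM] := test_function_bounded tp.
have [k0 qk0] := q_support.
have mB : measurable (big_box k0 : set X) by exact: measurable_box.
have g_int (C : R) : leb.-integrable [set: X] (EFin \o (fun x : X => `|C| * \1_(big_box k0 : set X) x)).
  apply: (@bounded_support_integrable _ `|C| k0).
  - by apply: measurable_funM; [exact: measurable_cst|exact: measurable_indic].
  - move=> x; rewrite normrM normr_id ler_piMr// indicE.
    by case: (_ \in _); rewrite ?normr1 ?normr0 ?ler01.
  - by move=> x xk; rewrite indicE memNset// mulr0.
have mp : measurable_fun [set: X] (partial i phi : X -> R).
  exact: test_function_measurable tp.
have bd k (x : X) : setT x -> `|q k x| <= `|M| * \1_(big_box k0 : set X) x.
  move=> _; rewrite indicE; have [xk|xk] := pselect (big_box k0 x).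
    by rewrite mem_set// mulr1 [leRHS]ger0_norm//; exact: q_bound.
  by rewrite qk0// memNset// mulr0 normr0.
have bd2 k (x : X) : setT x -> `|q k x ^+ 2| <= `|M ^+ 2| * \1_(big_box k0 : set X) x.
  move=> Tx; rewrite normrX; apply: le_trans (_ : (`|M| * \1_(big_box k0 : set X) x) ^+ 2 <= _).
    by apply: lerXn2r; rewrite ?nnegrE ?mulr_ge0//; exact: bd.
  rewrite exprMn normrX indicE; case: (_ \in _); first by rewrite expr1n.
  by rewrite expr0n mulr0.
have qc : {ae leb, forall x : X, setT x -> (q k x @[k --> \oo] --> partial i phi x)}.
  by apply: aeW => x _; exact: q_cvg.
have qc2 : {ae leb, forall x : X, setT x -> (q k x ^+ 2 @[k --> \oo] --> partial i phi x ^+ 2)}.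
  apply: aeW => x _; rewrite expr2; under eq_fun do rewrite expr2.
  by apply: cvgM; exact: q_cvg.
have mq2 k : measurable_fun [set: X] (fun x : X => q k x ^+ 2) by exact: measurable_funX.
have mp2 : measurable_fun [set: X] (fun x : X => partial i phi x ^+ 2).
  exact: measurable_funX.
split.
  exact: (Rintegral_dct measurableT q_measurable mp qc (g_int M) bd).2.
exact: (Rintegral_dct measurableT mq2 mp2 qc2 (g_int (M ^+ 2)) bd2).2.
Qed.

End difference_quotients.

(** By translation invariance the integral of every difference quotient is 0; the step tends to
    0. *)
Lemma integral_partial Omega phi i : test_function Omega phi ->
  \int[leb]_x partial i phi x = 0.
Proof.
move=> tphi; have [+ _] := difference_quotient_cvg tphi i (@ltr01 R).
set u := (X in X @ \oo --> _) => ucvg.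
suff u0 : u = cst 0.
  by rewrite u0 in ucvg; apply: cvg_unique ucvg (cvg_cst _); exact: norm_hausdorff.
apply/funext => k; rewrite /u/=.
have iphi := test_function_integrable tphi.
have ishift := shift_integrable ((1 / k.+1%:R) *: evec i) tphi.
under eq_Rintegral do rewrite mulrC.
rewrite RintegralZl//; last exact: (integrableB measurableT ishift iphi).
rewrite RintegralB// Rintegral_shift ?subrr ?mulr0//.
exact: test_function_measurable tphi.
Qed.

Lemma sqr_sum_le (N : nat) (a : nat -> R) :
  (\sum_(0 <= j < N) a j) ^+ 2 <= N%:R * \sum_(0 <= j < N) a j ^+ 2.
Proof.
elim: N => [|N ih]; first by rewrite !big_nil mul0r expr0n.
rewrite !big_nat_recr//=; move: ih.
set S := \sum_(0 <= j < N) a j; set T := \sum_(0 <= j < N) _ => ih.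
have [N0|N0] := eqVneq N 0%N.
  by rewrite /S /T N0 !big_nil !add0r mul1r.
have N_gt0 : 0 < N%:R :> R by rewrite ltr0n lt0n.
have h : 2 * S * a N <= T + N%:R * a N ^+ 2.
  rewrite -(ler_pM2l N_gt0); have := sqr_ge0 (S - N%:R * a N); nra.
rewrite -natr1; nra.
Qed.

Section translation_estimates.
Variables (Omega : set V) (phi : V -> R) (tphi : test_function Omega phi).

Let D h := \int[leb]_x ((phi (x + h) - phi x) ^+ 2).

Let shift2_integrable h g :
  leb.-integrable [set: X] (EFin \o (fun x : X => (phi ((x : V) + h) - phi ((x : V) + g)) ^+ 2)).
Proof.
have [M M0 phiM] := test_function_bounded tphi.
have [k0 phik] := test_function_big_box tphi.
have mh := shift_measurable h tphi; have mg := shift_measurable g tphi.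
have mphi : measurable_fun [set: X] (fun x : X => (phi ((x : V) + h) - phi ((x : V) + g)) ^+ 2).
  by apply: measurable_funX; exact: measurable_funB.
have ih := shift_integrable h tphi; have ig := shift_integrable g tphi.
apply: le_integrable (integrableZl measurableT (2 * M) (integrableB measurableT ih ig)).
- exact: measurableT.
- exact/measurable_EFinP.
move=> x _; rewrite /= lee_fin expr2 !normrM ler_wpM2r//.
rewrite [`|2|]ger0_norm// [`|M|]ger0_norm// mulr_natl mulr2n.
by apply: le_trans (ler_normB _ _) _; exact: lerD.
Qed.

Let shift2_eq h g : \int[leb]_x ((phi (x + g + h) - phi (x + g)) ^+ 2) = D h.
Proof.
apply: (@Rintegral_shift g (fun x : X => (phi ((x : V) + h) - phi x) ^+ 2)).
apply: measurable_funX; apply: measurable_funB; first exact: shift_measurable tphi.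
exact: test_function_measurable tphi.
Qed.

(** Along the path [p] the increment of [phi] telescopes; squaring the sum of [N] terms costs the
    factor [N], and translation invariance removes the base points [p j]. *)
Let telescope_le (N : nat) (p : nat -> V) : p 0%N = 0 ->
  D (p N) <= N%:R * \sum_(0 <= j < N) D (p j.+1 - p j).
Proof.
move=> p0; pose a (x : V) j := phi (x + p j.+1) - phi (x + p j).
have aE x : phi (x + p N) - phi x = \sum_(0 <= j < N) a x j.
  by rewrite (telescope_sumr (fun j => phi (x + p j)))// p0 addr0.
have ia j : leb.-integrable [set: X] (EFin \o (fun x : X => a x j ^+ 2)).
  exact: shift2_integrable.
have iS : leb.-integrable [set: X] (EFin \o (fun x : X => \sum_(0 <= j < N) a x j ^+ 2)).
  exact: Rintegrable_sum.
apply: (@le_trans _ _ (\int[leb]_x (N%:R * \sum_(0 <= j < N) a x j ^+ 2))).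
  apply: le_Rintegral => //.
  - have := shift2_integrable (p N) 0; apply: eq_integrable => // x _.
    by rewrite /= addr0.
  - exact: (integrableZl measurableT N%:R iS).
  - by move=> x _; rewrite aE; exact: sqr_sum_le.
rewrite RintegralZl// Rintegral_sum// ler_wpM2l//.
rewrite le_eqVlt; apply/orP; left; apply/eqP; apply: eq_bigr => j _.
rewrite -[RHS](shift2_eq _ (p j)); apply: eq_Rintegral => x _.
by rewrite /a -addrA (addrC (p j)) subrK.
Qed.

(** With [k.+1] steps of length [s], telescoping bounds the left side by
    [k.+1 ^ 2 * D (s *: evec i)]. This is [t ^+ 2] times the integral of the squared difference
    quotient, whose limit is known. *)
Let translate_pos i (t : R) : 0 < t ->
  D (t *: evec i) <= t ^+ 2 * \int[leb]_x (partial i phi x ^+ 2).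
Proof.
move=> t0; have [_ qcvg] := difference_quotient_cvg tphi i t0.
have qc : t ^+ 2 * \int[leb]_x (((phi (x + (t / k.+1%:R) *: evec i) - phi x) /
    (t / k.+1%:R)) ^+ 2) @[k --> \oo] --> t ^+ 2 * \int[leb]_x (partial i phi x ^+ 2).
  by apply: cvgM => //; exact: cvg_cst.
rewrite -(cvg_lim _ qc)//; apply: limr_ge; first by apply/cvg_ex; eexists; exact: qc.
apply: nearW => k /=.
pose s := t / k.+1%:R; have s0 : 0 < s by rewrite divr_gt0.
have k0 : k.+1%:R != 0 :> R by rewrite pnatr_eq0.
have -> : t *: evec i = (k.+1%:R * s) *: evec i.
  by rewrite /s mulrCA divff// mulr1.
apply: le_trans (telescope_le (p := fun j => (j%:R * s) *: evec i) _ _) _.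
  by rewrite mul0r scale0r.
under eq_bigr do rewrite -scalerBl -mulrBl -natrB// subSnn mul1r.
rewrite sumr_const_nat subn0 -[D _ *+ _]mulr_natl mulrA.
under [in leRHS]eq_Rintegral do rewrite exprMn mulrC.
rewrite RintegralZl//; last first.
  have := shift2_integrable (s *: evec i) 0; apply: eq_integrable => // x _.
  by rewrite /= addr0.
rewrite mulrA -/(D (s *: evec i)) ler_wpM2r//.
  by apply: Rintegral_ge0 => x _; exact: sqr_ge0.
rewrite le_eqVlt; apply/orP; left; apply/eqP.
by rewrite /s exprVn exprMn exprVn invfM invrK mulrA divff ?mul1r ?expr2// sqrf_eq0 gt_eqF.
Qed.

Let D_opp h : D (- h) = D h.
Proof.
rewrite -(shift2_eq (- h) h); apply: eq_Rintegral => x _.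
by rewrite addrK -sqrrN opprB.
Qed.

Lemma translate_le i (t : R) :
  D (t *: evec i) <= t ^+ 2 * \int[leb]_x (partial i phi x ^+ 2).
Proof.
have [t0|t0|->] := ltgtP t 0; last 2 first.
- exact: translate_pos.
- rewrite scale0r expr0n mul0r /D.
  under eq_Rintegral do rewrite addr0 subrr expr0n.
  by rewrite Rintegral_cst// mul0r.
by rewrite -D_opp -scaleNr -sqrrN translate_pos// oppr_gt0.
Qed.

(** The path from 0 to [h] that changes one coordinate at a time has [n.+1] steps, each of length at
    most [L]; this is the origin of the constant. *)
Lemma translate_box_le (L : nat) h : (forall i, `|h 0 i| <= L%:R) ->
  D h <= n.+1%:R * L%:R ^+ 2 * \sum_i \int[leb]_x (partial i phi x ^+ 2).
Proof.
move=> hL; pose p k : V := \sum_(j < n.+1 | (j < k)%N) h 0 j *: evec j.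
have hE : h = p n.+1.
  by rewrite [LHS]row_sum_delta; apply: eq_bigl => j; rewrite ltn_ord.
have p0 : p 0%N = 0 by rewrite /p big_pred0.
have pS (k : 'I_n.+1) : p k.+1 - p k = h 0 k *: evec k.
  rewrite /p (bigD1 k)//= (eq_bigl (fun j : 'I_n.+1 => (j < k)%N)) ?addrK// => j.
  by rewrite ltnS [RHS]ltn_neqAle andbC.
have := telescope_le n.+1 p0; rewrite -hE => /le_trans; apply.
rewrite -mulrA ler_wpM2l// big_mkord mulr_sumr ler_sum// => i _.
rewrite pS; apply: le_trans (translate_le _ _) _.
rewrite ler_wpM2r//; first by apply: Rintegral_ge0 => x _; exact: sqr_ge0.
rewrite -[h 0 i ^+ 2]real_normK ?num_real//; apply: lerXn2r; rewrite ?nnegrE//.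
Qed.

End translation_estimates.

End integrals_of_test_functions.

(** * The semi-inner product on square-integrable functions *)

Section square_integrable.
Context d (T : measurableType d) (R : realType) (mu : {measure set T -> \bar R}).
Context (D : set T) (mD : measurable D).
Implicit Types f g h : T -> R.
Local Notation intD f := (mu.-integrable D (EFin \o f)).

Definition sqint f : Prop :=
  measurable_fun D f /\ (\int[mu]_(x in D) (f x ^+ 2)%:E < +oo)%E.

Definition inner f g : R := \int[mu]_(x in D) (f x * g x).
Local Notation ip := inner.

Lemma sqint_integrable f : sqint f -> intD (fun x => f x ^+ 2).
Proof.
move=> [mf foo]; apply/integrableP; split.
  by apply/measurable_EFinP; exact: measurable_funX.
apply: le_lt_trans foo; rewrite le_eqVlt; apply/orP; left; apply/eqP.
by apply: eq_integral => x _; rewrite /= ger0_norm// sqr_ge0.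
Qed.

Lemma integrable_sqint f : measurable_fun D f -> intD (fun x => f x ^+ 2) -> sqint f.
Proof.
move=> mf /integrableP[_ foo]; split => //; apply: le_lt_trans foo.
rewrite le_eqVlt; apply/orP; left; apply/eqP.
by apply: eq_integral => x _; rewrite /= ger0_norm// sqr_ge0.
Qed.

Lemma sqintM f g : sqint f -> sqint g -> intD (fun x => f x * g x).
Proof.
move=> sf sg; have iD := integrableD mD (sqint_integrable sf) (sqint_integrable sg).
apply: le_integrable iD => //.
  by apply/measurable_EFinP; apply: measurable_funM; [exact: sf.1|exact: sg.1].
move=> x _; rewrite /= lee_fin normrM [leRHS]ger0_norm ?addr_ge0 ?sqr_ge0//.
have := normr_ge0 (f x); have := normr_ge0 (g x).
rewrite -[f x ^+ 2]real_normK ?num_real// -[g x ^+ 2]real_normK ?num_real//.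
by move: `|f x| `|g x| => a b b0 a0; have := sqr_ge0 (a - b); nra.
Qed.

Lemma sqintD f g : sqint f -> sqint g -> sqint (fun x => f x + g x).
Proof.
move=> sf sg; have mfg : measurable_fun D (fun x => f x + g x).
  by apply: measurable_funD; [exact: sf.1|exact: sg.1].
apply: integrable_sqint => //.
have := integrableD mD (integrableD mD (sqint_integrable sf) (sqint_integrable sg))
  (integrableZl mD 2 (sqintM sf sg)).
apply: eq_integrable => // x _; rewrite /= -!EFinM -!EFinD; congr (_%:E); ring.
Qed.

Lemma sqintZ (c : R) f : sqint f -> sqint (fun x => c * f x).
Proof.
move=> sf; apply: integrable_sqint.
  by apply: measurable_funM => //; exact: sf.1.
have := integrableZl mD (c ^+ 2) (sqint_integrable sf).
by apply: eq_integrable => // x _; rewrite /= -EFinM exprMn.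
Qed.

Lemma sqintB f g : sqint f -> sqint g -> sqint (fun x => f x - g x).
Proof.
move=> sf sg; have := sqintD sf (sqintZ (-1) sg).
by congr sqint; apply/funext => x; rewrite mulN1r.
Qed.

Lemma sqint_bounded f (M : R) : (mu D < +oo)%E -> measurable_fun D f ->
  (forall x, D x -> `|f x| <= M) -> sqint f.
Proof.
move=> Doo mf fM; apply: integrable_sqint => //.
apply: measurable_bounded_integrable => //; first exact: measurable_funX.
exists (M ^+ 2); split; rewrite ?num_real// => y My x Dx.
rewrite /= normrX; apply: le_trans (ltW My).
by apply: lerXn2r; rewrite ?nnegrE// ?fM// (le_trans _ (fM x Dx)).
Qed.

Lemma ipC f g : ip f g = ip g f.
Proof. by apply: eq_Rintegral => x _; rewrite mulrC. Qed.

Lemma ip_ge0 f : 0 <= ip f f.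
Proof. by apply: Rintegral_ge0 => x _; rewrite -expr2 sqr_ge0. Qed.

Lemma ipDl f g h : sqint f -> sqint g -> sqint h ->
  ip (fun x => f x + g x) h = ip f h + ip g h.
Proof.
move=> sf sg sh; rewrite /ip -RintegralD//; try exact: sqintM.
by apply: eq_Rintegral => x _; rewrite mulrDl.
Qed.

Lemma ipZl (c : R) f g : sqint f -> sqint g -> ip (fun x => c * f x) g = c * ip f g.
Proof.
move=> sf sg; rewrite /ip -RintegralZl//; last exact: sqintM.
by apply: eq_Rintegral => x _; rewrite mulrA.
Qed.

Lemma ipBl f g h : sqint f -> sqint g -> sqint h ->
  ip (fun x => f x - g x) h = ip f h - ip g h.
Proof.
move=> sf sg sh; rewrite -mulN1r -ipZl// -ipDl//; last exact: sqintZ.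
by congr ip; apply/funext => x; rewrite mulN1r.
Qed.

Lemma ipBB f g : sqint f -> sqint g ->
  ip (fun x => f x - g x) (fun x => f x - g x) = ip f f - 2 * ip f g + ip g g.
Proof.
move=> sf sg; have sfg := sqintB sf sg.
rewrite ipBl// ![ip _ (fun x => f x - g x)]ipC !ipBl// (ipC g f); ring.
Qed.

Lemma ip_cauchy_schwarz f g : sqint f -> sqint g -> ip f g ^+ 2 <= ip f f * ip g g.
Proof.
move=> sf sg.
have quad t : 0 <= ip f f - 2 * t * ip f g + t ^+ 2 * ip g g.
  have := ip_ge0 (fun x => f x - t * g x).
  rewrite ipBB//; last exact: sqintZ.
  by rewrite [ip f (fun x => t * g x)]ipC !(ipZl, ipC _ (fun x => t * g x))//;
    [rewrite (ipC g f); congr (0 <= _); ring|exact: sqintZ..].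
have [gg0|gg0] := eqVneq (ip g g) 0.
  rewrite gg0 mulr0; have [->|fg0] := eqVneq (ip f g) 0; first by rewrite expr0n.
  (* When [ip g g = 0] the quadratic is affine in [t], and this value of [t] would make it equal to
     [-1]. *)
  have := quad ((ip f f + 1) / (2 * ip f g)); rewrite gg0 mulr0 addr0.
  have -> : 2 * ((ip f f + 1) / (2 * ip f g)) * ip f g = ip f f + 1.
    by field.
  lra.
have g_gt0 : 0 < ip g g by rewrite lt_def gg0 ip_ge0.
have := mulr_ge0 (quad (ip f g / ip g g)) (ltW g_gt0).
have -> : (ip f f - 2 * (ip f g / ip g g) * ip f g + (ip f g / ip g g) ^+ 2 * ip g g) *
    ip g g = ip f f * ip g g - ip f g ^+ 2 by field.
by rewrite subr_ge0.
Qed.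

Lemma ip_le_young f g : sqint f -> sqint g ->
  ip (fun x => f x + g x) (fun x => f x + g x) <= 2 * ip f f + 2 * ip g g.
Proof.
move=> sf sg; have sN := sqintZ (-1) sg.
have := ip_ge0 (fun x => f x - g x); rewrite ipBB//.
have -> : (fun x => f x + g x) = (fun x => f x - (-1 * g x)).
  by apply/funext => x; rewrite mulN1r opprK.
rewrite ipBB// ipZl// ![ip _ (fun x => -1 * g x)]ipC !ipZl// (ipC g f); lra.
Qed.

(** Cauchy-Schwarz for the differences; [ip g g + 1] serves as a positive bound of [ip g g] to
    divide by. *)
Lemma ip_cvg (u : nat -> T -> R) v g : (forall k, sqint (u k)) -> sqint v -> sqint g ->
  ip (fun x => u k x - v x) (fun x => u k x - v x) @[k --> \oo] --> 0 ->
  ip (u k) g @[k --> \oo] --> ip v g.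
Proof.
move=> su sv sg uv; apply/cvgrPdist_le => e e0.
have G0 : 0 < ip g g + 1 by rewrite ltr_wpDl// ip_ge0.
have e2 : 0 < e ^+ 2 / (ip g g + 1) by rewrite divr_gt0// exprn_gt0.
move/cvgrPdist_le : uv => /(_ _ e2); apply: filterS => k.
rewrite sub0r normrN ger0_norm ?ip_ge0// ler_pdivlMr// => h.
have sB := sqintB (su k) sv.
rewrite -(@ler_pXn2r _ 2)// ?nnegrE ?(ltW e0)// distrC -ipBl//.
rewrite real_normK ?num_real//; apply: le_trans (ip_cauchy_schwarz sB sg) _.
apply: le_trans h; rewrite ler_wpM2l ?ip_ge0//; lra.
Qed.

End square_integrable.

(** * Completeness in the sense of Riesz and Fischer, on a set of finite measure *)

Section completeness.
Context d (T : measurableType d) (R : realType) (mu : {measure set T -> \bar R}).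
Context (D : set T) (mD : measurable D) (Doo : (mu D < +oo)%E).
Local Notation sqint := (sqint mu D).
Local Notation ip := (inner mu D).

Lemma ge0_integral_cvg_le (f : nat -> T -> R) (g : T -> R) (e : R) :
  (forall k, measurable_fun D (f k)) -> (forall k x, 0 <= f k x) ->
  (forall x, D x -> f k x @[k --> \oo] --> g x) ->
  (\forall k \near \oo, (\int[mu]_(x in D) (f k x)%:E <= e%:E)%E) ->
  (\int[mu]_(x in D) (g x)%:E <= e%:E)%E.
Proof.
move=> mf f0 fg fe.
have -> : (\int[mu]_(x in D) (g x)%:E = \int[mu]_(x in D) limn_einf (fun k => (f k x)%:E))%E.
  apply: eq_integral => x; rewrite inE => Dx.
  have h : (f k x)%:E @[k --> \oo] --> (g x)%:E.
    by apply: cvg_EFin; [exact: nearW|exact: fg].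
  by rewrite (cvg_limn_einf_sup h).1.
apply: le_trans (fatou mu mD _ _) _.
- by move=> k; apply/measurable_EFinP.
- by move=> k x _; rewrite lee_fin.
rewrite limn_einf_lim; apply: lime_le; first exact: is_cvg_einfs.
apply: filterS fe => k ke; apply: le_trans ke.
by apply: ereal_inf_lbound; exists k => /=.
Qed.

Lemma summable_cvg (w : nat -> R) (C : R) :
  (forall n, \sum_(0 <= i < n) `|w i.+1 - w i| <= C) -> cvgn w.
Proof.
move=> wC.
have : cvgn (series (telescope w)).
  apply: normed_cvg; apply: nondecreasing_is_cvgn.
    by apply: nondecreasing_series => *; exact: normr_ge0.
  exists C => _ [n _ <-]; exact: wC.
rewrite telescopeK => /cvg_ex[l wl]; apply/cvg_ex; exists (l + w 0%N).
have : (fun n => (w n - w 0%N) + w 0%N) @ \oo --> l + w 0%N.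
  by apply: cvgD => //; exact: cvg_cst.
by under eq_fun do rewrite subrK.
Qed.

Lemma geometric_sum_le (n : nat) : \sum_(0 <= i < n) (2^-1 : R) ^+ i <= 2.
Proof.
have -> : \sum_(0 <= i < n) (2^-1 : R) ^+ i = 2 - 2 * 2^-1 ^+ n.
  elim: n => [|n ih]; first by rewrite big_nil expr0 mulr1 subrr.
  by rewrite big_nat_recr//= ih exprS; field.
by rewrite gerBl mulr_ge0// exprn_ge0// invr_ge0.
Qed.

(** The inequality [|y| <= 2^-k + 2^k y^2] turns the bound [4^-k] on squared norms into the bound
    [2^-k (mu D + 1)] on integrals of absolute values. The sum of the increments is then integrable,
    hence finite almost everywhere. *)
Lemma ae_cvg_of_summable (w : nat -> T -> R) : (forall k, sqint (w k)) ->
  (forall k, ip (fun x => w k.+1 x - w k x) (fun x => w k.+1 x - w k x) <= (4^-1) ^+ k) ->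
  {ae mu, forall x, D x -> cvgn (fun k => w k x)}.
Proof.
move=> sw wle.
pose a k x : R := `|w k.+1 x - w k x|.
have sB k : sqint (fun x => w k.+1 x - w k x) by exact: sqintB.
have ma k : measurable_fun D (a k).
  by apply: measurableT_comp; [exact: normr_measurable|exact: (sB k).1].
pose C := fine (mu D) + 1.
have Dfin : mu D \is a fin_num by rewrite ge0_fin_numE.
have ia k : (\int[mu]_(x in D) (a k x)%:E <= (2^-1 ^+ k * C)%:E)%E.
  pose b x : R := 2^-1 ^+ k + 2 ^+ k * (w k.+1 x - w k x) ^+ 2.
  have i1 : mu.-integrable D (EFin \o cst ((2^-1 : R) ^+ k)).
    apply/integrableP; split; first exact/measurable_EFinP/measurable_cst.
    under eq_integral do rewrite /=.
    by rewrite integral_cst// lte_mul_pinfty.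
  have i2 := integrableZl mD (2 ^+ k) (sqint_integrable (sB k)).
  have ib : mu.-integrable D (EFin \o b) by exact: (integrableD mD i1 i2).
  apply: (@le_trans _ _ (\int[mu]_(x in D) (b x)%:E)%E).
    apply: ge0_le_integral => //.
    - by move=> x _; rewrite lee_fin /a.
    - exact/measurable_EFinP.
    - by case/integrableP : ib.
    - move=> x _; rewrite lee_fin /a /b -[X in _ + _ * X]real_normK ?num_real//.
      set y := `|_|; have y0 : 0 <= y by exact: normr_ge0.
      have p0 : 0 < 2 ^+ k :> R by rewrite exprn_gt0.
      rewrite -(ler_pM2l p0) mulrDr exprVn divff ?gt_eqF//.
      have := sqr_ge0 (2 ^+ k * y - 2^-1); nra.
  rewrite RintegralE// lee_fin /b RintegralD// RintegralZl//; last exact: sqint_integrable.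
  rewrite Rintegral_cst// mulrDr mulr1 lerD2l.
  have := wle k; rewrite /(ip _ _); under eq_Rintegral do rewrite -expr2.
  have -> : (2^-1 : R) ^+ k = 2 ^+ k * 4^-1 ^+ k.
    by rewrite -exprMn; congr (_ ^+ _); field.
  by move=> h; rewrite ler_wpM2l// exprn_ge0.
pose H x := (\sum_(0 <= k <oo) (a k x)%:E)%E.
have mH : measurable_fun D H.
  apply: ge0_emeasurable_sum; first by move=> k x _ _; rewrite lee_fin /a.
  by move=> k _; exact/measurable_EFinP.
have H0 x : (0 <= H x)%E by apply: nneseries_ge0 => k _ _; rewrite lee_fin /a.
have iH : mu.-integrable D H.
  apply/integrableP; split => //.
  under eq_integral do rewrite gee0_abs//.
  rewrite integral_nneseries//; last 2 first.
  - by move=> k; apply/measurable_EFinP.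
  - by move=> k x _; rewrite lee_fin /a.
  apply: (@le_lt_trans _ _ (2 * C)%:E); last exact: ltry.
  apply: lime_le.
    by apply: is_cvg_nneseries => k _ _; apply: integral_ge0 => x _; rewrite lee_fin /a.
  apply: nearW => m; apply: (@le_trans _ _ (\sum_(0 <= k < m) (2^-1 ^+ k * C)%:E)%E).
    exact: lee_sum.
  rewrite sumEFin lee_fin -mulr_suml ler_wpM2r ?geometric_sum_le//.
  by rewrite addr_ge0// fine_ge0.
have := integrable_ae mD iH; apply: filterS => x h Dx.
apply: (@summable_cvg _ (fine (H x))) => m.
rewrite -lee_fin fineK ?h// -sumEFin.
by apply: nneseries_lim_ge => k _ _; rewrite lee_fin /a.
Qed.

Lemma sqint_complete (u : nat -> T -> R) : (forall k, sqint (u k)) ->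
  (forall e, 0 < e -> exists N, forall j k, (N <= j)%N -> (N <= k)%N ->
    ip (fun x => u j x - u k x) (fun x => u j x - u k x) <= e) ->
  exists2 v, sqint v &
    ip (fun x => u k x - v x) (fun x => u k x - v x) @[k --> \oo] --> 0.
Proof.
move=> su cauchy.
have [N NP] : {N : nat -> nat & forall i j k, (N i <= j)%N -> (N i <= k)%N ->
    ip (fun x => u j x - u k x) (fun x => u j x - u k x) <= (4^-1) ^+ i}.
  apply: (@choice _ _ (fun i N => forall j k, (N <= j)%N -> (N <= k)%N ->
    ip (fun x => u j x - u k x) (fun x => u j x - u k x) <= (4^-1) ^+ i)) => i.
  by apply: cauchy; rewrite exprn_gt0// invr_gt0.
(* A nondecreasing choice of indices with both [N i <= s i] and [i <= s i]. *)
pose s i := (\sum_(0 <= l < i.+1) (N l).+1)%N.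
have sS i : (s i <= s i.+1)%N by rewrite /s [leqRHS]big_nat_recr//= leq_addr.
have Ns i : (N i <= s i)%N.
  by rewrite /s big_nat_recr//= (leq_trans (leqnSn _))// leq_addl.
have si i : (i <= s i)%N.
  elim: i => // i ih; rewrite /s big_nat_recr//= -/(s i).
  by rewrite addnS ltnS (leq_trans ih)// leq_addr.
have [A [mA A0 cA]] := @ae_cvg_of_summable (fun i => u (s i)) (fun i => su _)
  (fun k => NP k _ _ (leq_trans (Ns k) (sS k)) (Ns k)).
(* Replacing the functions by 0 on a null set that contains all points of divergence makes the
   subsequence converge at every point of [D], so that its limit is measurable. *)
pose u' j x : R := u j x * \1_(~` A) x.
have mu' j : measurable_fun D (u' j).
  apply: measurable_funM; first exact: (su j).1.
  by apply: measurable_funTS; apply: measurable_indic; exact: measurableC.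
have u'0 j x : A x -> u' j x = 0.
  by move=> Ax; rewrite /u' indicE memNset ?mulr0//; exact.
have u'E j x : ~ A x -> u' j x = u j x.
  by move=> Ax; rewrite /u' indicE mem_set ?mulr1.
pose v x : R := lim (u' (s i) x @[i --> \oo]).
have u'v x : D x -> u' (s i) x @[i --> \oo] --> v x.
  move=> Dx; have [Ax|Ax] := pselect (A x).
    have h : u' (s i) x @[i --> \oo] --> (0 : R).
      by under eq_fun do rewrite u'0//; exact: cvg_cst.
    by apply/cvg_ex; exists 0.
  have : cvgn (fun k => u (s k) x) by apply: contrapT => h; apply: Ax; apply: cA => /(_ Dx).
  by rewrite /v; under eq_fun do rewrite -u'E//.
have mv : measurable_fun D v by apply: measurable_fun_cvg u'v.
have le_uu' j k : (\int[mu]_(x in D) ((u' j x - u' k x) ^+ 2)%:E <=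
    (ip (fun x => u j x - u k x) (fun x => u j x - u k x))%:E)%E.
  have sB := sqintB mD (su j) (su k).
  rewrite -RintegralE//; last exact: sqintM.
  apply: ge0_le_integral => //.
  - by move=> x _; rewrite lee_fin sqr_ge0.
  - by apply/measurable_EFinP; apply: measurable_funX; exact: measurable_funB.
  - by apply/measurable_EFinP; apply: measurable_funM; exact: sB.1.
  - move=> x _; rewrite lee_fin -expr2.
    have [Ax|Ax] := pselect (A x); first by rewrite !u'0// subrr expr0n sqr_ge0.
    by rewrite !u'E.
(* Fatou along the subsequence carries the Cauchy estimate over to the limit, and thereby the whole
   sequence converges. *)
have vu' e : 0 < e -> exists N0, forall j, (N0 <= j)%N ->
    (\int[mu]_(x in D) ((u' j x - v x) ^+ 2)%:E <= e%:E)%E.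
  move=> /cauchy[N0 N0P]; exists N0 => j jN.
  apply: (@ge0_integral_cvg_le (fun i x => (u' j x - u' (s i) x) ^+ 2)).
  - by move=> i; apply: measurable_funX; exact: measurable_funB.
  - by move=> i x; exact: sqr_ge0.
  - move=> x Dx; rewrite expr2; under eq_fun do rewrite expr2.
    by apply: cvgM; (apply: cvgB; [exact: cvg_cst|exact: u'v]).
  - exists N0 => // i /= iN; apply: le_trans (le_uu' _ _) _; rewrite lee_fin.
    by apply: N0P => //; exact: leq_trans (si i).
have su' j : sqint (u' j).
  split => //; have [_] := su j; apply: le_lt_trans; apply: ge0_le_integral => //.
  - by move=> x _; rewrite lee_fin sqr_ge0.
  - by apply/measurable_EFinP; exact: measurable_funX.
  - by apply/measurable_EFinP; apply: measurable_funX; exact: (su j).1.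
  - move=> x _; rewrite lee_fin; have [Ax|Ax] := pselect (A x).
      by rewrite u'0// expr0n sqr_ge0.
    by rewrite u'E.
have sv : sqint v.
  have [N0 /(_ N0 (leqnn _)) N0P] := vu' 1 ltr01.
  have sB : sqint (fun x => u' N0 x - v x).
    by split; [exact: measurable_funB|exact: le_lt_trans N0P (ltry _)].
  have := sqintB mD (su' N0) sB.
  by congr sqint; apply/funext => x; rewrite opprB addrC subrK.
exists v => //; apply/cvgrPdist_le => e e0.
have [N0 N0P] := vu' e e0; exists N0 => // j /= jN.
have sB := sqintB mD (su j) sv.
rewrite sub0r normrN ger0_norm ?ip_ge0// -lee_fin.
apply: le_trans (N0P j jN); rewrite -RintegralE//; last exact: sqintM.
rewrite le_eqVlt; apply/orP; left; apply/eqP.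
apply: ae_eq_integral => //.
- by apply/measurable_EFinP; apply: measurable_funM; exact: sB.1.
- by apply/measurable_EFinP; apply: measurable_funX; exact: measurable_funB.
- exists A; split => // x /= h; apply: contrapT => Ax; apply: h => Dx.
  by rewrite -expr2 u'E.
Qed.

End completeness.

Lemma L2_sqint (R : realType) (n : nat) (Omega : set 'rV[R]_n.+1) f :
  L2 Omega f <-> sqint leb (Omega : set (lebesgue_space R n)) f.
Proof. by []. Qed.

(** * The Dirichlet form: Poincare inequality and weak solutions *)

Section dirichlet_form.
Context (R : realType) (n : nat).
Notation V := 'rV[R]_n.+1.
Notation X := (lebesgue_space R n).
Notation evec i := (delta_mx 0 i : V).
Context (Omega : set V) (oO : open Omega) (Ofin : (leb (Omega : set X) < +oo)%E).
Implicit Types (phi psi f g v w : V -> R) (Dv Dw : 'I_n.+1 -> V -> R) (i : 'I_n.+1).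

Local Notation test := (test_function Omega).
Local Notation sqint := (sqint leb (Omega : set X)).
Local Notation ip := (inner leb (Omega : set X)).
Local Notation grad phi := (fun i => partial i phi).

Let mO : measurable (Omega : set X). Proof. exact: open_measurable_leb. Qed.

Definition grad_inner Dv Dw : R := \sum_(i < n.+1) ip (Dv i) (Dw i).
Local Notation gip := grad_inner.

Lemma test_function_sqint phi : test phi -> sqint phi.
Proof.
move=> tphi; have [M _ phiM] := test_function_bounded tphi.
apply: (sqint_bounded mO (M := M) Ofin); last by move=> x _; exact: phiM.
by apply: measurable_funTS; exact: test_function_measurable tphi.
Qed.

Lemma grad_sqint phi i : test phi -> sqint (partial i phi).
Proof. by move=> tphi; apply: test_function_sqint; exact: test_function_partial. Qed.

Lemma ip_testE phi psi : test phi -> ip phi psi = \int[leb]_x (phi x * psi x).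
Proof.
move=> tphi; apply: (@Rintegral_restrict _ _ Omega (fun x : X => phi x * psi x)) => x xO.
by rewrite (test_function_outside tphi xO) mul0r.
Qed.

Lemma ip_test_partial phi psi i : test phi -> test psi ->
  ip phi (partial i psi) = - ip (partial i phi) psi.
Proof.
move=> tphi tpsi; apply/eqP; rewrite -subr_eq0 opprK.
have [sphi _ _] := tphi; have [spsi _ _] := tpsi.
have := integral_partial i (test_functionM sphi tpsi).
have -> : partial i (fun x => phi x * psi x) =
    (fun x => phi x * partial i psi x + psi x * partial i phi x).
  by apply/funext => x; rewrite partialM.
have tdphi := test_function_partial i tphi; have tdpsi := test_function_partial i tpsi.
rewrite RintegralD//; last 2 first.
- exact: test_function_integrable (test_functionM sphi tdpsi).
- exact: test_function_integrable (test_functionM spsi tdphi).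
rewrite -ip_testE// -ip_testE//.
by rewrite [X in _ + X = 0 -> _]ipC => ->.
Qed.

Lemma gip_ge0 Dv : 0 <= gip Dv Dv.
Proof. by apply: sumr_ge0 => i _; exact: ip_ge0. Qed.

Lemma gipZl (c : R) Dv Dw : (forall i, sqint (Dv i)) -> (forall i, sqint (Dw i)) ->
  gip (fun i x => c * Dv i x) Dw = c * gip Dv Dw.
Proof. by move=> sv sw; rewrite mulr_sumr; apply: eq_bigr => i _; exact: ipZl. Qed.

Lemma gipBl Du Dv Dw : (forall i, sqint (Du i)) -> (forall i, sqint (Dv i)) ->
  (forall i, sqint (Dw i)) ->
  gip (fun i x => Du i x - Dv i x) Dw = gip Du Dw - gip Dv Dw.
Proof. by move=> su sv sw; rewrite -sumrB; apply: eq_bigr => i _; exact: ipBl. Qed.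

Lemma gipC Dv Dw : gip Dv Dw = gip Dw Dv.
Proof. by apply: eq_bigr => i _; exact: ipC. Qed.

(** Over a box much larger than [Omega], translates of [phi] are on average nearly orthogonal to
    [phi]. Indeed, integrating [|phi (x + h) * phi x|] in [x] and over all [h] gives [b ^+ 2] by
    Tonelli, and [b ^+ 2 <= m * a] by Cauchy-Schwarz on [Omega]. On the other hand
    [translate_box_le] bounds the squared distance between [phi] and each translate by [G].
    Together, [(2 * a - G) * q <= 2 * m * a], and [q >= 2 * (m + 1)] gives [a <= G]. *)
Lemma poincare : exists2 C, 0 <= C &
  forall phi, test phi -> ip phi phi <= C * gip (grad phi) (grad phi).
Proof.
pose m := fine (leb (Omega : set X)).
have m0 : 0 <= m by rewrite fine_ge0.
have mE : leb (Omega : set X) = m%:E by rewrite fineK// ge0_fin_numE.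
have [T0|[L LQ]] := @big_box_unbounded R n (2 * (m + 1)).
  exists 1 => // phi tphi; rewrite mul1r (ip_testE phi tphi).
  have mphi := test_function_measurable tphi.
  rewrite [leLHS](_ : _ = 0) ?gip_ge0// /Rintegral.
  have -> // : (\int[leb]_(x in [set: X]) (phi x * phi x)%:E = 0)%E.
  apply: null_set_integral T0; first exact: measurableT.
  by apply/measurable_EFinP; exact: measurable_funM.
have mQ : measurable (big_box L : set X) by exact: measurable_box.
pose q := fine (leb (big_box L : set X)).
have qE : leb (big_box L : set X) = q%:E by rewrite fineK// ge0_fin_numE// leb_box_lty.
have q_ge : 2 * (m + 1) <= q by rewrite -lee_fin -qE.
exists (n.+1%:R * L%:R ^+ 2) => [|phi tphi]; first by rewrite mulr_ge0 ?exprn_ge0.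
pose a := ip phi phi; pose b := \int[leb]_x `|phi x|.
set G := _ * gip _ _.
have a0 : 0 <= a by exact: ip_ge0.
have mphi := test_function_measurable tphi.
have [sphi _ _] := tphi.
have cphi := smooth_continuous sphi.
have tphi2 := test_functionM sphi tphi.
have iphi2 := test_function_integrable tphi2.
have aE : a = \int[leb]_x (phi x * phi x) by exact: ip_testE.
have iprod (h : V) : leb.-integrable setT (EFin \o (fun x : X => phi ((x : V) + h) * phi x)).
  have [M M0 phiM] := test_function_bounded tphi.
  apply: (le_integrable measurableT _ _ (integrableZl measurableT M (test_function_integrable tphi))).
    apply/measurable_EFinP; apply: measurable_funM; last exact: mphi.
    exact: shift_measurable tphi.
  by move=> x _; rewrite /= lee_fin !normrM ler_wpM2r// [leRHS]ger0_norm.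
(* Expand the square in the translation estimate; both squared norms equal [a] by translation
   invariance. *)
have key (h : V) : big_box L h -> 2 * a - G <= 2 * \int[leb]_x `|phi (x + h) * phi x|.
  move=> hL; have hL' i : `|h 0 i| <= L%:R.
    by have := hL i; rewrite in_itv/= !mxE ler_norml => /andP[/ltW -> ->].
  have := translate_box_le tphi hL'.
  have -> : \sum_i \int[leb]_x (partial i phi x ^+ 2) = gip (grad phi) (grad phi).
    by apply: eq_bigr => i _; rewrite (ip_testE _ (test_function_partial i tphi)).
  rewrite -/G.
  have -> : \int[leb]_x (phi (x + h) - phi x) ^+ 2 =
      2 * a - 2 * \int[leb]_x (phi (x + h) * phi x).
    have iA : leb.-integrable setT (EFin \o (fun x : X => phi ((x : V) + h) * phi ((x : V) + h))).
      exact: (shift_integrable h tphi2).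
    have iP2 := integrableZl measurableT (2 : R) (iprod h).
    have iB := integrableB measurableT (integrableD measurableT iA iphi2) iP2.
    transitivity (\int[leb]_x ((phi (x + h) * phi (x + h) + phi x * phi x) -
        2 * (phi (x + h) * phi x))).
      by apply: eq_Rintegral => x _; ring.
    rewrite RintegralB//; last exact: (integrableD measurableT iA iphi2).
    rewrite RintegralD// RintegralZl//.
    rewrite (@Rintegral_shift _ _ h (fun x : X => phi x * phi x)); last first.
      exact: measurable_funM.
    by rewrite -aE; ring.
  move=> h1; have := le_normr_Rintegral measurableT (iprod h).
  by have := ler_norm (\int[leb]_x (phi (x + h) * phi x)); lra.
have b2 : b ^+ 2 <= m * a.
  have sabs : sqint (fun x => `|phi x|).
    have [M _ phiM] := test_function_bounded tphi.
    apply: (sqint_bounded mO (M := M) Ofin).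
      by apply: measurable_funTS; apply: measurableT_comp; [exact: normr_measurable|exact: mphi].
    by move=> x _; rewrite normr_id.
  have s1 : sqint (cst 1).
    apply: (sqint_bounded mO (M := 1) Ofin); first exact: measurable_cst.
    by move=> x _; rewrite normr1.
  have := ip_cauchy_schwarz mO sabs s1.
  have -> : ip (cst 1) (cst 1) = m.
    by rewrite /ip; under eq_Rintegral do rewrite mulr1; rewrite Rintegral_cst// mul1r.
  have -> : ip (fun x => `|phi x|) (fun x => `|phi x|) = a.
    by apply: eq_Rintegral => x _; rewrite -normrM ger0_norm// -expr2 sqr_ge0.
  have -> : ip (fun x => `|phi x|) (cst 1) = b.
    rewrite /ip; under eq_Rintegral do rewrite mulr1.
    apply: (@Rintegral_restrict _ _ Omega (fun x : X => `|phi x|)) => x xO.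
    by rewrite (test_function_outside tphi xO) normr0.
  by rewrite [m * a]mulrC.
(* Only when [2 * a - G] is positive can it be integrated over the box as a nonnegative constant;
   otherwise [a <= G] is immediate. *)
have [aG|aG] := leP (2 * a - G) 0; first by rewrite -/a; lra.
pose F (z : V * V) := `|phi (z.1 + z.2) * phi z.1|.
have cF : continuous F.
  move=> z; apply: cvg_norm.
  apply: cvgM; last by apply: continuous_comp; [exact: cvg_fst|exact: cphi].
  apply: continuous_comp; last exact: cphi.
  by apply: cvgD; [exact: cvg_fst|exact: cvg_snd].
have F0 z : 0 <= F z by exact: normr_ge0.
have mI := measurable_integral_leb cF F0.
have iabs : leb.-integrable setT (EFin \o (fun x : X => `|phi x|)).
  by have := integrable_norm (test_function_integrable tphi).
have IE (h : V) : (\int[leb]_(x in [set: X]) (F (x, h))%:E =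
    (\int[leb]_x `|phi (x + h) * phi x|)%:E)%E.
  by rewrite -RintegralE//; exact: integrable_norm (iprod h).
have mabs : measurable_fun [set: X] (fun x : X => `|phi x|).
  by apply: measurableT_comp; [exact: normr_measurable|exact: mphi].
have tot : (\int[leb]_(h in [set: X]) \int[leb]_(x in [set: X]) (F (x, h))%:E = (b ^+ 2)%:E)%E.
  rewrite -(leb_tonelli cF F0).
  have inner (x : X) : (\int[leb]_(y in [set: X]) (F (x, y))%:E = b%:E * (`|phi x|)%:E)%E.
    rewrite muleC -(RintegralE measurableT iabs) -(integralZl measurableT iabs).
    have mprod : measurable_fun [set: X] (fun y : X => (`|phi x|%:E * `|phi y|%:E)%E).
      by apply: emeasurable_funM; [exact: measurable_cst|exact/measurable_EFinP].
    rewrite -(integral_shift x mprod).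
    by apply: eq_integral => y _; rewrite /F/= normrM mulrC (addrC (x : V)) EFinM.
  under eq_integral do rewrite inner.
  by rewrite (integralZl measurableT iabs) (RintegralE measurableT iabs) -EFinM expr2.
pose J (h : X) := (\int[leb]_(x in [set: X]) (F (x, h))%:E)%E.
have J0 h : (0 <= 2%:E * J h)%E.
  by apply: mule_ge0; rewrite ?lee_fin//; apply: integral_ge0 => x _; rewrite lee_fin.
have mJ : measurable_fun [set: X] (fun h => 2%:E * J h)%E.
  by apply: emeasurable_funM; [exact: measurable_cst|exact: mI].
have le1 : ((2 * a - G)%:E * q%:E <= \int[leb]_(h in (big_box L : set X)) (2%:E * J h))%E.
  rewrite -qE -(integral_cst leb mQ); apply: (ge0_le_integral leb mQ).
  - by move=> h _; rewrite lee_fin ltW.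
  - exact: measurable_cst.
  - exact: measurable_funTS mJ.
  - by move=> h hL; rewrite /J IE -EFinM lee_fin; exact: key.
have le2 : (\int[leb]_(h in (big_box L : set X)) (2%:E * J h) <=
    \int[leb]_(h in [set: X]) (2%:E * J h))%E.
  by apply: (ge0_subset_integral leb mQ measurableT mJ) => // h _; exact: J0.
have le3 : (\int[leb]_(h in [set: X]) (2%:E * J h) = (2 * b ^+ 2)%:E)%E.
  rewrite ge0_integralZl.
  - by rewrite tot.
  - exact: measurableT.
  - exact: mI.
  - by move=> x _; apply: integral_ge0 => y _; rewrite lee_fin.
  - by rewrite lee_fin.
have : (2 * a - G) * q <= 2 * b ^+ 2.
  by rewrite -lee_fin EFinM -le3; exact: le_trans le1 le2.
move=> h1; rewrite -/a.
have q0 : 0 < q by lra.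
rewrite -(ler_pM2r q0); nra.
Qed.

Definition test_approx v Dv (phi_ : nat -> V -> R) : Prop :=
  [/\ forall k, test (phi_ k),
      ip (fun x => phi_ k x - v x) (fun x => phi_ k x - v x) @[k --> \oo] --> 0 &
      forall i, ip (fun x => partial i (phi_ k) x - Dv i x)
        (fun x => partial i (phi_ k) x - Dv i x) @[k --> \oo] --> 0].

Lemma L2_cvgE (u : nat -> V -> R) v : (forall k, sqint (u k)) -> sqint v ->
  L2_cvg Omega u v <->
  ip (fun x => u k x - v x) (fun x => u k x - v x) @[k --> \oo] --> 0.
Proof.
move=> su sv; rewrite /L2_cvg.
have E k : (\int[leb]_(x in (Omega : set X)) ((u k x - v x) ^+ 2)%:E =
    (ip (fun x => u k x - v x) (fun x => u k x - v x))%:E)%E.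
  have sB := sqintB mO (su k) sv.
  by rewrite -(RintegralE mO (sqintM mO sB sB)).
under eq_fun do rewrite E.
by split=> [/fine_cvg//|h]; apply: cvg_EFin => //; exact: nearW.
Qed.

(** Integration by parts holds for the approximants, and both sides pass to the limit: limits of
    test functions automatically have the limit of the gradients as weak gradient. *)
Lemma test_approx_ibp v Dv (phi_ : nat -> V -> R) psi i : sqint v -> (forall i, sqint (Dv i)) ->
  test_approx v Dv phi_ -> test psi -> ip v (partial i psi) = - ip (Dv i) psi.
Proof.
move=> sv sDv [tphi phiv dphiv] tpsi.
have h1 := ip_cvg mO (fun k => test_function_sqint (tphi k)) sv (grad_sqint i tpsi) phiv.
have h2 := ip_cvg mO (fun k => grad_sqint i (tphi k)) (sDv i) (test_function_sqint tpsi)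
  (dphiv i).
have {}h2 : - ip (partial i (phi_ k)) psi @[k --> \oo] --> - ip (Dv i) psi.
  by apply: cvgN.
have E : (fun k => ip (phi_ k) (partial i psi)) = (fun k => - ip (partial i (phi_ k)) psi).
  by apply/funext => k; rewrite ip_test_partial.
rewrite E in h1; apply: cvg_unique h1 h2; exact: norm_hausdorff.
Qed.

Lemma H10_of_test_approx v Dv (phi_ : nat -> V -> R) : sqint v -> (forall i, sqint (Dv i)) ->
  test_approx v Dv phi_ -> H10 Omega v Dv.
Proof.
move=> sv sDv av; have [tphi phiv dphiv] := av; split.
  split=> [|i|psi i tpsi]; [exact: (L2_sqint _ _).2 sv|exact: (L2_sqint _ _).2 (sDv i)|].
  rewrite (RintegralE mO (sqintM mO sv (grad_sqint i tpsi))).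
  rewrite (RintegralE mO (sqintM mO (sDv i) (test_function_sqint tpsi))).
  by rewrite -EFinN; congr (_%:E); exact: (test_approx_ibp i sv sDv av tpsi).
exists phi_; split => //.
  by apply/L2_cvgE => // k; exact: test_function_sqint.
by move=> i; apply/L2_cvgE => // k; exact: grad_sqint.
Qed.

Lemma H10_test_approx v Dv : H10 Omega v Dv ->
  [/\ sqint v, forall i, sqint (Dv i) & exists phi_ : nat -> V -> R, test_approx v Dv phi_].
Proof.
move=> [[/L2_sqint sv L2Dv _] [phi_ [tphi phiv dphiv]]].
have sDv i : sqint (Dv i) := (L2_sqint _ _).1 (L2Dv i).
split => //; exists phi_; split => //.
  by apply: (L2_cvgE _ sv).1 phiv => k; exact: test_function_sqint.
by move=> i; apply: (L2_cvgE _ (sDv i)).1 (dphiv i) => k; exact: grad_sqint.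
Qed.

Lemma gip_cvg (Du_ : nat -> 'I_n.+1 -> V -> R) Dv Dw : (forall k i, sqint (Du_ k i)) ->
  (forall i, sqint (Dv i)) -> (forall i, sqint (Dw i)) ->
  (forall i, ip (fun x => Du_ k i x - Dv i x) (fun x => Du_ k i x - Dv i x)
    @[k --> \oo] --> 0) ->
  gip (Du_ k) Dw @[k --> \oo] --> gip Dv Dw.
Proof.
move=> su sv sw uv; rewrite /gip.
have h i := ip_cvg mO (fun k => su k i) (sv i) (sw i) (uv i).
elim: (index_enum _) => [|i r ih].
  by rewrite big_nil; under eq_fun do rewrite big_nil; exact: cvg_cst.
rewrite big_cons; under eq_fun do rewrite big_cons.
by apply: cvgD => //; exact: h.
Qed.

(** The equation of [weak_solution] between real numbers, with the gradient exposed, because shifts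
    and truncations act on it. *)
Definition wsol f v Dv : Prop := H10 Omega v Dv /\
  forall w Dw, H10 Omega w Dw -> gip Dv Dw = ip f w.

Lemma weak_solution_wsol f v : sqint f ->
  weak_solution Omega f v <-> exists Dv, wsol f v Dv.
Proof.
move=> sf.
have E Dv Dw : (forall i, sqint (Dv i)) -> (forall i, sqint (Dw i)) ->
    (\int[leb]_(x in (Omega : set X)) (\sum_(i < n.+1) Dv i x * Dw i x)%:E =
     (gip Dv Dw)%:E)%E.
  move=> sv sw; have iM i := sqintM mO (sv i) (sw i).
  by rewrite (RintegralE mO (Rintegrable_sum mO _ iM)) (Rintegral_sum mO _ iM).
split=> [[Dv hv wv]|[Dv [hv wv]]]; exists Dv => //.
  split=> // w Dw hw; have := wv _ _ hw.
  have [_ sDv _] := H10_test_approx hv; have [sw sDw _] := H10_test_approx hw.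
  by rewrite E// (RintegralE mO (sqintM mO sf sw)) => -[].
move=> w Dw hw.
have [_ sDv _] := H10_test_approx hv; have [sw sDw _] := H10_test_approx hw.
by rewrite E// (RintegralE mO (sqintM mO sf sw)) (wv _ _ hw).
Qed.

Lemma wsol_of_test f v Dv : sqint f -> H10 Omega v Dv ->
  (forall psi, test psi -> gip Dv (grad psi) = ip f psi) -> wsol f v Dv.
Proof.
move=> sf hv wv; split=> // w Dw hw.
have [_ sDv _] := H10_test_approx hv; have [sw sDw [psi_ [tpsi psiw dpsiw]]] := H10_test_approx hw.
have h1 := gip_cvg (fun k i => grad_sqint i (tpsi k)) sDw sDv dpsiw.
have h2 := ip_cvg mO (fun k => test_function_sqint (tpsi k)) sw sf psiw.
rewrite gipC ipC.
have E : (fun k => gip (grad (psi_ k)) Dv) = (fun k => ip (psi_ k) f).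
  by apply/funext => k; rewrite gipC ipC wv.
rewrite E in h1; apply: cvg_unique h1 h2; exact: norm_hausdorff.
Qed.

Lemma test_comb (c d : R) phi psi : test phi -> test psi ->
  test (fun x => c * phi x + d * psi x).
Proof. by move=> tphi tpsi; apply: test_functionD; exact: test_functionZ. Qed.

Lemma grad_comb (c d : R) phi psi i : test phi -> test psi ->
  partial i (fun x => c * phi x + d * psi x) =
  (fun x => c * partial i phi x + d * partial i psi x).
Proof.
move=> [sphi _ _] [spsi _ _]; apply/funext => x.
have sc := smoothM (smooth_cst c) sphi; have sd := smoothM (smooth_cst d) spsi.
by rewrite (partialD i x sc sd) (partialZ c i x sphi) (partialZ d i x spsi).
Qed.

Lemma ip_comb (c d : R) f g h : sqint f -> sqint g -> sqint h ->
  ip h (fun x => c * f x + d * g x) = c * ip h f + d * ip h g.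
Proof.
move=> sf sg sh; rewrite ipC (ipDl mO (sqintZ mO c sf) (sqintZ mO d sg) sh).
by rewrite (ipZl mO c sf sh) (ipZl mO d sg sh) (ipC leb (Omega : set X) h f) (ipC leb (Omega : set X) h g).
Qed.

Lemma gip_comb (c d : R) phi psi : test phi -> test psi ->
  gip (grad (fun x => c * phi x + d * psi x)) (grad (fun x => c * phi x + d * psi x)) =
  c ^+ 2 * gip (grad phi) (grad phi) + 2 * c * d * gip (grad phi) (grad psi) +
  d ^+ 2 * gip (grad psi) (grad psi).
Proof.
move=> tphi tpsi; rewrite /gip !mulr_sumr -!big_split/=; apply: eq_bigr => i _.
have sphi := grad_sqint i tphi; have spsi := grad_sqint i tpsi.
have sc := sqintD mO (sqintZ mO c sphi) (sqintZ mO d spsi).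
rewrite (grad_comb c d i tphi tpsi) (ip_comb c d sphi spsi sc).
have E h : sqint h -> ip (fun x => c * partial i phi x + d * partial i psi x) h =
    c * ip h (partial i phi) + d * ip h (partial i psi).
  by move=> sh; rewrite ipC (ip_comb c d sphi spsi sh).
rewrite (E _ sphi) (E _ spsi) (ipC leb (Omega : set X) (partial i psi) (partial i phi)).
move: (ip (partial i phi) (partial i phi)) (ip (partial i phi) (partial i psi))
  (ip (partial i psi) (partial i psi)) => A B D; ring.
Qed.

(** Dirichlet principle: a sequence of test functions minimising [E] is Cauchy for the gradient
    norm, hence in the mean square by the Poincare inequality. Its limit satisfies the
    Euler-Lagrange equation, first against test functions and then on [H10] by density. *)
Lemma wsol_exists f : sqint f -> exists v Dv, wsol f v Dv.
Proof.
move=> sf; have [C C0 pc] := poincare.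
pose E phi := gip (grad phi) (grad phi) - 2 * ip f phi.
(* With [K = ip f f * C], Cauchy-Schwarz and Poincare give [y ^+ 2 <= K * g] for [y = ip f phi] and
   [g] the energy, whence [2 * y <= g + K]. *)
have E_ge phi : test phi -> - (ip f f * C) <= E phi.
  move=> tphi; have sphi := test_function_sqint tphi.
  have := ip_cauchy_schwarz mO sf sphi; have := pc _ tphi.
  have f0 := ip_ge0 leb (Omega : set X) f.
  have := gip_ge0 (grad phi); rewrite /E.
  move: (gip _ _) (ip f f) f0 (ip f phi) (ip phi phi) => g F F0 y p g0 pg yF.
  have : y ^+ 2 <= F * C * g by apply: le_trans yF _; rewrite -mulrA ler_wpM2l.
  have FC0 : 0 <= F * C by exact: mulr_ge0.
  move: (F * C) FC0 => K K0 yK.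
  suff : 2 * y <= g + K by lra.
  have [y0|y0] := leP y 0; first by lra.
  rewrite -(@ler_pXn2r _ 2)// ?nnegrE; [|lra|lra].
  have := sqr_ge0 (g - K); nra.
pose S := [set E phi | phi in test].
have infS : has_inf S.
  split; first by exists (E (fun=> 0)); exists (fun=> 0) => //; exact: test_function0.
  by exists (- (ip f f * C)) => _ [phi tphi <-]; exact: E_ge.
pose m := inf S.
have Em phi : test phi -> m <= E phi.
  by move=> tphi; apply: ge_inf; [exact: infS.2|exists phi].
have [phi_ phiP] : {phi_ : nat -> V -> R & forall k, test (phi_ k) /\
    E (phi_ k) < m + k.+1%:R^-1}.
  apply: (@choice _ _ (fun k phi => test phi /\ E phi < m + k.+1%:R^-1)) => k.
  have k0 : 0 < k.+1%:R^-1 :> R by rewrite invr_gt0.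
  by have [_ [phi tphi <-] h] := inf_adherent k0 infS; exists phi.
have tphi k := (phiP k).1.
have Elim k : E (phi_ k) < m + k.+1%:R^-1 by exact: (phiP k).2.
have Ecomb c d phi psi : test phi -> test psi ->
    E (fun x => c * phi x + d * psi x) =
    c ^+ 2 * gip (grad phi) (grad phi) + 2 * c * d * gip (grad phi) (grad psi) +
    d ^+ 2 * gip (grad psi) (grad psi) - 2 * (c * ip f phi + d * ip f psi).
  move=> t1 t2; rewrite /E (gip_comb c d t1 t2).
  by rewrite (ip_comb c d (test_function_sqint t1) (test_function_sqint t2) sf).
have subE j k : (fun x => phi_ j x - phi_ k x) = (fun x => 1 * phi_ j x + (-1) * phi_ k x).
  by apply/funext => x; rewrite mul1r mulN1r.
(* Parallelogram identity: the left side is [2 * E (phi_ j) + 2 * E (phi_ k)] minus four times the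
   value of [E] at the midpoint, which is at least [m]. *)
have gsub j k : gip (grad (fun x => phi_ j x - phi_ k x)) (grad (fun x => phi_ j x - phi_ k x))
    <= 2 * (j.+1%:R^-1 + k.+1%:R^-1).
  rewrite subE (gip_comb 1 (-1) (tphi j) (tphi k)).
  have := Em _ (test_comb 2^-1 2^-1 (tphi j) (tphi k)).
  rewrite (Ecomb 2^-1 2^-1 _ _ (tphi j) (tphi k)).
  have := Elim j; have := Elim k; rewrite /E.
  move: (gip (grad (phi_ j)) (grad (phi_ j))) (gip (grad (phi_ j)) (grad (phi_ k)))
    (gip (grad (phi_ k)) (grad (phi_ k))) (ip f (phi_ j)) (ip f (phi_ k)) => A B D a d.
  move: (j.+1%:R^-1) (k.+1%:R^-1) => r r' *; lra.
have cauchy_grad e : 0 < e -> exists N, forall j k, (N <= j)%N -> (N <= k)%N ->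
    gip (grad (fun x => phi_ j x - phi_ k x)) (grad (fun x => phi_ j x - phi_ k x)) <= e.
  move=> e0; have e4 : 0 < 4 / e by rewrite divr_gt0.
  exists (Num.truncn (4 / e)).+1 => j k Nj Nk; apply: le_trans (gsub j k) _.
  have inv_le l : ((Num.truncn (4 / e)).+1 <= l)%N -> l.+1%:R^-1 <= e / 4.
    move=> Nl; rewrite -[e / 4]invrK invf_div lef_pV2 ?posrE//.
    apply: ltW; apply: lt_le_trans (truncnS_gt _) _.
    by rewrite ler_nat (leq_trans Nl).
  move: (inv_le _ Nj) (inv_le _ Nk).
  move: (j.+1%:R^-1) (k.+1%:R^-1) => r r' ? ?; lra.
have [v sv phiv] : exists2 v, sqint v &
    ip (fun x => phi_ k x - v x) (fun x => phi_ k x - v x) @[k --> \oo] --> 0.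
  apply: (sqint_complete mO Ofin (fun k => test_function_sqint (tphi k))) => e e0.
  have eC : 0 < e / (C + 1) by rewrite divr_gt0// ltr_wpDl.
  have [N NP] := cauchy_grad _ eC; exists N => j k Nj Nk.
  apply: le_trans (pc _ (test_functionB (tphi j) (tphi k))) _.
  apply: le_trans (ler_wpM2l C0 (NP j k Nj Nk)) _.
  by rewrite mulrCA ger_pMr// ler_pdivrMr ?ltr_wpDl// mul1r lerDl.
have [Dv DvP] : {Dv : 'I_n.+1 -> V -> R & forall i, sqint (Dv i) /\
    ip (fun x => partial i (phi_ k) x - Dv i x) (fun x => partial i (phi_ k) x - Dv i x)
      @[k --> \oo] --> 0}.
  apply: (@choice _ _ (fun i w => sqint w /\
    ip (fun x => partial i (phi_ k) x - w x) (fun x => partial i (phi_ k) x - w x)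
      @[k --> \oo] --> 0)) => i.
  have [|w sw h] := sqint_complete mO Ofin (fun k => grad_sqint i (tphi k)).
    move=> e /cauchy_grad[N NP]; exists N => j k Nj Nk.
    apply: le_trans (NP j k Nj Nk).
    rewrite /gip (bigD1 i)//= ler_wpDr//.
      by apply: sumr_ge0 => l _; exact: ip_ge0.
    rewrite subE (grad_comb 1 (-1) i (tphi j) (tphi k)) le_eqVlt; apply/orP; left; apply/eqP.
    by congr (inner _ _ _ _); apply/funext => x; rewrite mul1r mulN1r.
  by exists w.
have sDv i := (DvP i).1; have dphiv i := (DvP i).2.
have av : test_approx v Dv phi_ by [].
exists v, Dv; apply: wsol_of_test => //; first exact: H10_of_test_approx av.
move=> psi tpsi; apply/eqP; rewrite -subr_eq0; apply/eqP.
set x := _ - _; pose P := gip (grad psi) (grad psi).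
have P0 : 0 <= P by exact: gip_ge0.
have gc := gip_cvg (fun k i => grad_sqint i (tphi k)) sDv (fun i => grad_sqint i tpsi) dphiv.
(* Compare [E] at [phi_ k] and at [phi_ k + t psi]. The first is within [1 / k.+1] of the infimum,
   so the first and second variations together are nonnegative in the limit. *)
have quad t : 0 <= 2 * t * x + t ^+ 2 * P.
  have lim_l : 2 * t * (gip (grad (phi_ k)) (grad psi) - ip f psi) + t ^+ 2 * P + k.+1%:R^-1
      @[k --> \oo] --> 2 * t * x + t ^+ 2 * P + 0.
    apply: cvgD; last exact: cvg_harmonic.
    apply: cvgD; last exact: cvg_cst.
    apply: cvgM; first exact: cvg_cst.
    by apply: cvgB => //; exact: cvg_cst.
  rewrite -[leRHS]addr0 -(cvg_lim _ lim_l)//.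
  apply: limr_ge; first by apply/cvg_ex; eexists; exact: lim_l.
  apply: nearW => k.
  have := Em _ (test_comb 1 t (tphi k) tpsi); rewrite (Ecomb 1 t _ _ (tphi k) tpsi).
  have := Elim k; rewrite /E -/P.
  move: (gip (grad (phi_ k)) (grad (phi_ k))) (gip (grad (phi_ k)) (grad psi))
    (ip f (phi_ k)) (ip f psi) => A B a d.
  move: (k.+1%:R^-1) => r *; lra.
move: (x) P P0 quad => {}x P P0 quad.
apply: contrapT => /eqP x0.
have x2 : 0 < x ^+ 2 by rewrite lt_def sqrf_eq0 x0 sqr_ge0.
(* Nearly the minimiser of the quadratic; [P + 1] replaces [P], which may be 0. The value is
   negative unless [x = 0]. *)
have := quad (- x / (P + 1)).
have -> : 2 * (- x / (P + 1)) * x + (- x / (P + 1)) ^+ 2 * P =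
    - (x ^+ 2 * (P + 2) / (P + 1) ^+ 2) by field; lra.
rewrite oppr_ge0 leNgt => /negP; apply.
by apply: divr_gt0; [apply: mulr_gt0 => //; lra|apply: exprn_gt0; lra].
Qed.

End dirichlet_form.

(** * Smooth truncations, comparison, and the sign of the integral of the source *)

Section truncations.
Context (R : realType) (n : nat).
Notation V := 'rV[R]_n.+1.
Notation X := (lebesgue_space R n).
Context (Omega : set V) (oO : open Omega) (Ofin : (leb (Omega : set X) < +oo)%E).
Implicit Types (phi psi f g v w : V -> R) (Dv Dw : 'I_n.+1 -> V -> R) (i : 'I_n.+1).

Local Notation test := (test_function Omega).
Local Notation sqint := (sqint leb (Omega : set X)).
Local Notation ip := (inner leb (Omega : set X)).
Local Notation gip := (grad_inner Omega).
Local Notation grad phi := (fun i => partial i phi).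

Let mO : measurable (Omega : set X). Proof. exact: open_measurable_leb. Qed.

Lemma H10_test phi : test phi -> H10 Omega phi (grad phi).
Proof.
move=> tphi; have sphi := test_function_sqint oO Ofin tphi.
have sdphi i := grad_sqint oO Ofin i tphi.
apply: (H10_of_test_approx oO Ofin (phi_ := fun=> phi) sphi sdphi).
have z0 (h : V -> R) : ip (fun x => h x - h x) (fun x => h x - h x) = 0.
  by rewrite /(inner _ _); under eq_Rintegral do rewrite subrr mul0r; rewrite Rintegral_cst// mul0r.
split=> //.
  by under eq_fun do rewrite z0; exact: cvg_cst.
by move=> i; under eq_fun do rewrite z0; exact: cvg_cst.
Qed.

Section lipschitz.
Variables (T T' : R -> R) (M : R).
Hypothesis sT : smooth1 T.
Hypothesis T0 : T 0 = 0.
Hypothesis dT : forall x : R, is_derive x 1 T (T' x).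
Hypothesis M0 : 0 <= M.
Hypothesis TM : forall x, `|T' x| <= M.

Lemma lipschitz_le a b : `|T a - T b| <= M * `|a - b|.
Proof.
wlog ab : a b / b <= a.
  move=> h; have [/h//|/ltW/h] := leP b a.
  by rewrite [`|T b - _|]distrC [`|b - _|]distrC.
have [c _ ->] := derive_mvt dT ab.
by rewrite normrM ler_wpM2r.
Qed.

Let cT : continuous T. Proof. exact: Ck_continuous (sT 0%N). Qed.

Let mT : measurable_fun [set: R] T. Proof. exact: continuous_measurable_fun. Qed.

Lemma sqint_lipschitz v : sqint v -> sqint (T \o v).
Proof.
move=> sv; have mTv : measurable_fun (Omega : set X) (T \o v).
  by apply: measurableT_comp; [exact: mT|exact: sv.1].
apply: (integrable_sqint mTv).
apply: le_integrable (integrableZl mO (M ^+ 2) (sqint_integrable sv)) => //.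
  by apply/measurable_EFinP; exact: measurable_funX.
move=> x _; rewrite /= lee_fin [leLHS]ger0_norm ?sqr_ge0//.
have -> : M ^+ 2 * v x ^+ 2 = (M * v x) ^+ 2 by rewrite exprMn.
rewrite [leRHS]ger0_norm ?sqr_ge0// -[leLHS]real_normK ?num_real//.
rewrite -[leRHS]real_normK ?num_real//; apply: lerXn2r; rewrite ?nnegrE//.
rewrite normrM [`|M|]ger0_norm//.
by have := lipschitz_le (v x) 0; rewrite T0 !subr0.
Qed.

Lemma ip_lipschitz u v : sqint u -> sqint v ->
  ip (fun x => T (u x) - T (v x)) (fun x => T (u x) - T (v x)) <=
  M ^+ 2 * ip (fun x => u x - v x) (fun x => u x - v x).
Proof.
move=> su sv; have sB := sqintB mO su sv.
have sTB := sqintB mO (sqint_lipschitz su) (sqint_lipschitz sv).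
rewrite /(inner _ _) -(RintegralZl _ mO (sqintM mO sB sB)).
apply: (le_Rintegral mO (sqintM mO sTB sTB)).
  exact: (integrableZl mO (M ^+ 2) (sqintM mO sB sB)).
move=> x _; rewrite -!expr2 -exprMn -[leLHS]real_normK ?num_real//.
rewrite -[leRHS]real_normK ?num_real//; apply: lerXn2r; rewrite ?nnegrE//.
by rewrite normrM [`|M|]ger0_norm//; exact: lipschitz_le.
Qed.

Lemma approx_lipschitz v (phi_ : nat -> V -> R) : sqint v -> (forall k, test (phi_ k)) ->
  ip (fun x => phi_ k x - v x) (fun x => phi_ k x - v x) @[k --> \oo] --> 0 ->
  ip (fun x => T (phi_ k x) - T (v x)) (fun x => T (phi_ k x) - T (v x)) @[k --> \oo] --> 0.
Proof.
move=> sv tphi phiv.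
have h : M ^+ 2 * ip (fun x => phi_ k x - v x) (fun x => phi_ k x - v x) @[k --> \oo] --> 0.
  by rewrite -[X in _ --> X](mulr0 (M ^+ 2)); apply: cvgM => //; exact: cvg_cst.
apply: squeeze_cvgr (cvg_cst 0) h; apply: nearW => k.
rewrite ip_ge0/=; apply: ip_lipschitz => //.
exact: (test_function_sqint oO Ofin (tphi k)).
Qed.

Lemma grad_trunc phi i : test phi ->
  partial i (T \o phi) = (fun x => T' (phi x) * partial i phi x).
Proof. by move=> [sphi _ _]; apply/funext => x; rewrite (partial_comp i x dT sphi). Qed.

(** The defect from replacing the gradient of [z] by that of [phi_ k] in the equation tested with
    [T \o phi_ k]. The truncation acts on approximants only, so the gradient of [T \o z] never
    appears. *)
Let error Dz (phi_ : nat -> V -> R) k :=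
  gip (fun i x => partial i (phi_ k) x - Dz i x) (grad (T \o phi_ k)).

(** Cauchy-Schwarz: one factor tends to 0, and the other stays bounded since [|T'| <= M] and the
    gradients of the approximants converge. *)
Let error_cvg (z : V -> R) Dz (phi_ : nat -> V -> R) : (forall i, sqint (Dz i)) ->
  test_approx Omega z Dz phi_ -> error Dz phi_ k @[k --> \oo] --> 0.
Proof.
move=> sDz [tphi _ dphi].
have key i : ip (fun x => partial i (phi_ k) x - Dz i x) (partial i (T \o phi_ k))
    @[k --> \oo] --> 0.
  pose A k := ip (fun x => partial i (phi_ k) x - Dz i x) (fun x => partial i (phi_ k) x - Dz i x).
  pose D := ip (Dz i) (Dz i).
  have A_cvg : A k @[k --> \oo] --> 0 by exact: dphi.
  have bound_cvg : A k * (M ^+ 2 * (2 * A k + 2 * D)) @[k --> \oo] --> 0.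
    rewrite -[X in _ --> X](mul0r (M ^+ 2 * (2 * 0 + 2 * D))); apply: cvgM => //.
    apply: cvgM; first exact: cvg_cst.
    by apply: cvgD; [apply: cvgM => //|]; exact: cvg_cst.
  apply/cvgrPdist_le => e e0; have e2 : 0 < e ^+ 2 by rewrite exprn_gt0.
  move/cvgrPdist_le : bound_cvg => /(_ _ e2); apply: filterS => k.
  rewrite !sub0r !normrN => h; rewrite -(@ler_pXn2r _ 2)// ?nnegrE ?(ltW e0)//.
  rewrite real_normK ?num_real//; apply: le_trans (le_trans (ler_norm _) h).
  have sp := grad_sqint oO Ofin i (tphi k).
  have sB := sqintB mO sp (sDz i).
  have tT := test_function_comp sT T0 (tphi k).
  have sTp := grad_sqint oO Ofin i tT.
  apply: le_trans (ip_cauchy_schwarz mO sB sTp) _.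
  rewrite ler_wpM2l ?ip_ge0//.
  apply: (@le_trans _ _ (M ^+ 2 * ip (partial i (phi_ k)) (partial i (phi_ k)))).
    rewrite /(inner _ _) -(RintegralZl _ mO (sqintM mO sp sp)).
    apply: (le_Rintegral mO (sqintM mO sTp sTp)).
      exact: (integrableZl mO (M ^+ 2) (sqintM mO sp sp)).
    move=> x _; rewrite (grad_trunc i (tphi k)) -!expr2 exprMn ler_wpM2r ?sqr_ge0//.
    rewrite -[leLHS]real_normK ?num_real//; apply: lerXn2r; rewrite ?nnegrE//.
  rewrite ler_wpM2l ?exprn_ge0//.
  have := ip_le_young mO sB (sDz i).
  by under [X in X <= _ -> _]eq_Rintegral do rewrite subrK.
rewrite /error /grad_inner.
rewrite [X in _ --> X](_ : 0 = \sum_(i < n.+1) (0 : R)); last by rewrite big1.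
elim: (index_enum _) => [|i r ih].
  by rewrite big_nil; under eq_fun do rewrite big_nil; exact: cvg_cst.
rewrite big_cons; under eq_fun do rewrite big_cons.
by apply: cvgD => //; exact: key.
Qed.

Let trunc_energy (z : V -> R) Dz (phi_ : nat -> V -> R) g k : (forall i, sqint (Dz i)) ->
  (forall k, test (phi_ k)) -> wsol Omega g z Dz ->
  gip (grad (phi_ k)) (grad (T \o phi_ k)) = ip g (T \o phi_ k) + error Dz phi_ k.
Proof.
move=> sDz tphi [_ wz]; have tT := test_function_comp sT T0 (tphi k).
have sp i := grad_sqint oO Ofin i (tphi k).
have sTp i := grad_sqint oO Ofin i tT.
have hT := H10_test tT.
rewrite -(wz _ _ hT) /error (gipBl oO sp sDz sTp).
move: (gip _ _) (gip Dz _) => a b; ring.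
Qed.

(** For the approximants, the energy tested against the truncation is the integral of [T' (phi_ k)]
    times the squared gradient, hence nonnegative. *)
Lemma monotone_trunc_ge0 g (z : V -> R) Dz : sqint g -> wsol Omega g z Dz ->
  (forall x, 0 <= T' x) -> 0 <= ip g (T \o z).
Proof.
move=> sg wz T'0; have [hz _] := wz; have [sz sDz [phi_ az]] := H10_test_approx oO Ofin hz.
have [tphi phiz _] := az.
have sTphi k := test_function_sqint oO Ofin (test_function_comp sT T0 (tphi k)).
have c1 := ip_cvg mO sTphi (sqint_lipschitz sz) sg (approx_lipschitz sz tphi phiz).
have c2 : ip (T \o phi_ k) g + error Dz phi_ k @[k --> \oo] --> ip (T \o z) g + 0.
  by apply: cvgD => //; exact: error_cvg az.
rewrite ipC -[leRHS]addr0 -(cvg_lim _ c2)//.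
apply: limr_ge; first by apply/cvg_ex; eexists; exact: c2.
apply: nearW => k; rewrite ipC -(trunc_energy k sDz tphi wz).
apply: sumr_ge0 => i _; apply: Rintegral_ge0 => x _.
by rewrite (grad_trunc i (tphi k)) mulrCA mulr_ge0// -expr2 sqr_ge0.
Qed.

(** Slopes in [[-1, 0]] satisfy [T' ^+ 2 <= - T']. Hence the energy of [T \o phi_ k] is at most
    minus the energy tested against it, and so at most [- error], because [g] and [T] are
    nonnegative. The Poincare inequality then forces [T \o phi_ k] to 0. *)
Lemma antitone_trunc_eq0 g (z : V -> R) Dz : sqint g -> wsol Omega g z Dz ->
  (forall x, Omega x -> 0 <= g x) -> (forall x, 0 <= T x) -> (forall x, -1 <= T' x <= 0) ->
  ip (T \o z) (T \o z) = 0.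
Proof.
move=> sg wz g0 Tge0 T'1; have [hz _] := wz; have [sz sDz [phi_ az]] := H10_test_approx oO Ofin hz.
have [tphi phiz _] := az.
have [C C0 pc] := poincare oO Ofin.
have tT k := test_function_comp sT T0 (tphi k).
have sTphi k := test_function_sqint oO Ofin (tT k).
have sTz := sqint_lipschitz sz.
have cT2 := approx_lipschitz sz tphi phiz.
have b1 k : ip (T \o phi_ k) (T \o phi_ k) <= - (C * error Dz phi_ k).
  apply: le_trans (pc _ (tT k)) _; rewrite -mulrN ler_wpM2l//.
  apply: (@le_trans _ _ (- gip (grad (phi_ k)) (grad (T \o phi_ k)))).
    rewrite /grad_inner -sumrN; apply: ler_sum => i _.
    have sp := grad_sqint oO Ofin i (tphi k); have sTp := grad_sqint oO Ofin i (tT k).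
    rewrite -mulN1r /(inner _ _) -(RintegralZl _ mO (sqintM mO sp sTp)).
    apply: (le_Rintegral mO (sqintM mO sTp sTp)).
      exact: (integrableZl mO (-1) (sqintM mO sp sTp)).
    move=> x _; rewrite (grad_trunc i (tphi k)).
    have /andP[] := T'1 (phi_ k x); move: (T' _) (partial _ _ _) => t p t1 t2.
    have := sqr_ge0 p; have : 0 <= - t * (1 + t) by apply: mulr_ge0; lra.
    nra.
  rewrite (trunc_energy k sDz tphi wz) lerN2 lerDr.
  apply: Rintegral_ge0 => x Ox; apply: mulr_ge0; [exact: g0|exact: Tge0].
apply/eqP; rewrite eq_le ip_ge0 andbT.
have c : 2 * ip (fun x => T (phi_ k x) - T (z x)) (fun x => T (phi_ k x) - T (z x)) +
    2 * (- (C * error Dz phi_ k)) @[k --> \oo] --> 2 * 0 + 2 * (- (C * 0)).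
  apply: cvgD; first by apply: cvgM => //; exact: cvg_cst.
  apply: cvgM; first exact: cvg_cst.
  apply: cvgN; apply: cvgM; first exact: cvg_cst.
  exact: error_cvg az.
rewrite -[leRHS](_ : 2 * 0 + 2 * (- (C * 0)) = 0); last by ring.
rewrite -(cvg_lim _ c)//; apply: limr_ge; first by apply/cvg_ex; eexists; exact: c.
apply: nearW => k.
(* The factors [-1] write [T \o z] as the sum of a difference tending to 0 and [T \o phi_ k], in the
   form that [ip_le_young] expects. *)
have sB := sqintB mO (sqintZ mO (-1) (sTphi k)) (sqintZ mO (-1) sTz).
have E1 : ip (fun x => (-1 * T (phi_ k x)) - (-1 * T (z x))) (fun x => (-1 * T (phi_ k x)) - (-1 * T (z x))) =
    ip (fun x => T (phi_ k x) - T (z x)) (fun x => T (phi_ k x) - T (z x)).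
  by apply: eq_Rintegral => x _; ring.
have := ip_le_young mO sB (sTphi k); rewrite E1.
have -> : ip (fun x => (-1 * T (phi_ k x)) - (-1 * T (z x)) + T (phi_ k x))
    (fun x => (-1 * T (phi_ k x)) - (-1 * T (z x)) + T (phi_ k x)) = ip (T \o z) (T \o z).
  by apply: eq_Rintegral => x _ /=; ring.
have := b1 k; move: (error Dz phi_ k) (ip (T \o z) (T \o z))
  (ip (T \o phi_ k) (T \o phi_ k)) => e a b.
move: (ip _ _) => d; lra.
Qed.

End lipschitz.

Definition lap w : V -> R := fun x => \sum_i partial i (partial i w) x.

Lemma test_lap w : test w -> test (lap w).
Proof.
move=> tw; apply: test_function_sum => i.
by do 2!apply: test_function_partial.
Qed.

(** Used with [c = 1] to compare [v] with [w], and with [c = - tau k] to add a multiple of the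
    exhaustion. *)
Lemma wsol_shift f v Dv w (c : R) : sqint f -> wsol Omega f v Dv -> test w ->
  wsol Omega (fun x => f x + c * lap w x) (fun x => v x - c * w x)
    (fun i x => Dv i x - c * partial i w x).
Proof.
move=> sf [hv wv] tw; have [sv sDv [phi_ [tphi phiv dphiv]]] := H10_test_approx oO Ofin hv.
have sw := test_function_sqint oO Ofin tw.
have sdw i := grad_sqint oO Ofin i tw.
have slw := test_function_sqint oO Ofin (test_lap tw).
have [sm_w _ _] := tw.
apply: (wsol_of_test oO Ofin (sqintD mO sf (sqintZ mO c slw))).
  apply: (@H10_of_test_approx _ _ _ oO Ofin _ _ (fun k x => phi_ k x - c * w x)).
  - exact: (sqintB mO sv (sqintZ mO c sw)).
  - by move=> i; exact: (sqintB mO (sDv i) (sqintZ mO c (sdw i))).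
  have tB k : test (fun x => phi_ k x - c * w x).
    exact: (test_functionB (tphi k) (test_functionZ c tw)).
  split=> //.
    have E k : ip (fun x => phi_ k x - c * w x - (v x - c * w x))
        (fun x => phi_ k x - c * w x - (v x - c * w x)) =
        ip (fun x => phi_ k x - v x) (fun x => phi_ k x - v x).
      by apply: eq_Rintegral => x _; ring.
    by under eq_fun do rewrite E.
  move=> i.
  have E k : ip (fun x => partial i (fun x => phi_ k x - c * w x) x - (Dv i x - c * partial i w x))
      (fun x => partial i (fun x => phi_ k x - c * w x) x - (Dv i x - c * partial i w x)) =
      ip (fun x => partial i (phi_ k) x - Dv i x) (fun x => partial i (phi_ k) x - Dv i x).
    have -> : (fun x => phi_ k x - c * w x) = (fun x => 1 * phi_ k x + (- c) * w x).
      by apply/funext => x; rewrite mul1r mulNr.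
    rewrite (grad_comb 1 (- c) i (tphi k) tw).
    by apply: eq_Rintegral => x _; ring.
  by under eq_fun do rewrite E; exact: dphiv.
move=> psi tpsi.
have sdpsi i := grad_sqint oO Ofin i tpsi; have spsi := test_function_sqint oO Ofin tpsi.
have hpsi := H10_test tpsi.
rewrite (gipBl oO sDv (fun i => sqintZ mO c (sdw i)) sdpsi) (gipZl oO c sdw sdpsi).
rewrite (wv _ _ hpsi) (ipDl mO sf (sqintZ mO c slw) spsi) (ipZl mO c slw spsi).
rewrite -mulrN; congr (_ + c * _).
have -> : ip (lap w) psi = \sum_i ip (partial i (partial i w)) psi.
  rewrite -(Rintegral_sum mO _ (fun i => sqintM mO (grad_sqint oO Ofin i (test_function_partial i tw)) spsi)).
  by apply: eq_Rintegral => x _; rewrite /lap mulr_suml.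
rewrite /grad_inner -sumrN; apply: eq_bigr => i _.
by rewrite (ip_test_partial i (test_function_partial i tw) tpsi) opprK.
Qed.

(** Weak maximum principle for [z = v - w], whose source [f + lap w] is nonnegative. The negative
    part is smoothed to [T s = d * ramp (- s / d)]; as [ramp y >= y - 1], the vanishing of [T \o z]
    gives [z >= - d], and [d] runs through the numbers [1 / k.+1]. *)
Lemma comparison f v Dv w : sqint f -> wsol Omega f v Dv -> test w ->
  (forall x, 0 <= w x) -> (forall x, Omega x -> 0 <= f x + lap w x) ->
  {ae leb, forall x : X, Omega x -> 0 <= v x}.
Proof.
move=> sf wv tw w0 flw.
have wz := wsol_shift 1 sf wv tw.
have slw := test_function_sqint oO Ofin (test_lap tw).
have sg := sqintD mO sf (sqintZ mO 1 slw).
pose z x := v x - 1 * w x.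
have [[sz sDz _] _] : H10 Omega z (fun i x => Dv i x - 1 * partial i w x) := wz.1.
have key (d : R) : 0 < d -> {ae leb, forall x : X, Omega x -> - d <= z x}.
  move=> d0; pose T s := d * ramp (- d^-1 * s + 0).
  pose T' (s : R) := d * (- d^-1 * step (- d^-1 * s + 0)).
  have sT : smooth1 T.
    move=> k; apply: CkZ; apply: smooth1_comp; first exact: smooth1_ramp.
    exact: smooth1_affine.
  have T0 : T 0 = 0 by rewrite /T mulr0 addr0 ramp_le0 ?mulr0.
  have dT (s : R) : is_derive s 1 T (T' s).
    by apply: is_deriveZ; apply: derive_affine => y; exact: is_derive_ramp.
  have T'E s : T' s = - step (- d^-1 * s + 0).
    by rewrite /T' mulrA mulrN divff ?gt_eqF// mulN1r.
  have T'1 s : -1 <= T' s <= 0.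
    by rewrite T'E lerN2 oppr_le0 step_ge0 step_le1.
  have TM s : `|T' s| <= 1.
    by rewrite T'E normrN ger0_norm ?step_ge0 ?step_le1.
  have Tge0 s : 0 <= T s by rewrite mulr_ge0 ?ramp_ge0// ltW.
  have g0 x : Omega x -> 0 <= f x + 1 * lap w x by move=> Ox; rewrite mul1r flw.
  have := antitone_trunc_eq0 sT T0 dT ler01 TM sg wz g0 Tge0 T'1.
  have sTz := sqint_lipschitz sT T0 dT ler01 TM sz.
  have mTz : measurable_fun (Omega : set X) (fun x : X => (T (z x) * T (z x))%:E).
    by apply/measurable_EFinP; apply: measurable_funM; exact: sTz.1.
  move=> I0.
  have : (\int[leb]_(x in (Omega : set X)) `|(T (z x) * T (z x))%:E| = 0)%E.
    transitivity ((ip (T \o z) (T \o z))%:E); last by rewrite I0.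
    rewrite -(RintegralE mO (sqintM mO sTz sTz)); apply: eq_integral => x _.
    by rewrite gee0_abs// lee_fin mulr_ge0.
  move/(ae_eq_integral_abs leb mO mTz); apply: filterS => x h Ox.
  have := h Ox => -[] /eqP; rewrite mulf_eq0 orbb => /eqP Tz0.
  have := ramp_ge (- d^-1 * z x + 0); move: Tz0 => /eqP.
  rewrite mulf_eq0 gt_eqF//= => /eqP ->.
  by rewrite addr0 mulNr subr_le0 lerNl; rewrite ler_pdivlMl// mulrN1.
have inv_gt0 k : 0 < k.+1%:R^-1 :> R by rewrite invr_gt0.
have := ae_foralln (fun k => key _ (inv_gt0 k)); apply: filterS => x h Ox.
suff z0 : 0 <= z x by have := w0 x; move: z0; rewrite /z; lra.
rewrite leNgt; apply/negP => z0.
have := h (Num.truncn (- z x)^-1) Ox; rewrite lerNl leNgt => /negP; apply.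
have nz : 0 < - z x by rewrite oppr_gt0.
by rewrite -[ltRHS]invrK ltf_pV2 ?posrE ?invr_gt0// truncnS_gt.
Qed.

Lemma ae_ge0_source f v Dv : measurable_fun (Omega : set X) f ->
  (forall x, `|f x| <= 1) -> wsol Omega f v Dv ->
  {ae leb, forall x : X, Omega x -> 0 <= v x} ->
  0 <= \int[leb]_(x in (Omega : set X)) f x.
Proof.
move=> mf f1 wv v0.
have sf : sqint f by apply: (sqint_bounded mO (M := 1) Ofin mf) => x _; exact: f1.
have [[sv _ _] _] : H10 Omega v Dv := wv.1.
pose b k := exhaust Omega k.
have tb k : test (b k) by exact: test_exhaust.
have slb k := test_function_sqint oO Ofin (test_lap (tb k)).
have s1 : sqint (cst 1).
  by apply: (sqint_bounded mO (M := 1) Ofin); [exact: measurable_cst|move=> x _; rewrite normr1].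
have ilb k : leb.-integrable (Omega : set X) (EFin \o (fun x : X => lap (b k) x)).
  by have := sqintM mO (slb k) s1; apply: eq_integrable => // x _ /=; rewrite mulr1.
pose L k := \int[leb]_(x in (Omega : set X)) `|lap (b k) x|.
have L0 k : 0 <= L k by apply: Rintegral_ge0.
(* Chosen after [b k], whose Laplacian may be large: the error [tau k * L k] is at most
   [1 / k.+1]. *)
pose tau k := (k.+1%:R * (L k + 1))^-1.
have tau_gt0 k : 0 < tau k by rewrite invr_gt0 mulr_gt0// ltr_wpDl.
have tauL k : tau k * L k <= k.+1%:R^-1.
  rewrite /tau invfM -mulrA ger_pMr ?invr_gt0// mulrC ler_pdivrMr ?ltr_wpDl//.
  by rewrite mul1r lerDl.
(* The width of the truncation is of smaller order than [tau k], so that at a point of [Omega] where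
   [v] vanishes [tau k * b k] still exceeds [2 * eps k] eventually. *)
pose eps k := tau k / k.+1%:R.
have eps_gt0 k : 0 < eps k by rewrite divr_gt0.
(* Two ramps one unit apart: the difference climbs from 0 at [s = 0] to 1 at [s = 2 * eps k]. *)
pose T k s := ramp ((eps k)^-1 * s + 0) - ramp ((eps k)^-1 * s + (-1)).
pose T' k s := (eps k)^-1 * step ((eps k)^-1 * s + 0) - (eps k)^-1 * step ((eps k)^-1 * s + (-1)).
have sT k : smooth1 (T k).
  move=> l; apply: CkB.
    exact: (smooth1_comp (@smooth1_ramp R) (smooth1_affine (eps k)^-1 0)).
  exact: (smooth1_comp (@smooth1_ramp R) (smooth1_affine (eps k)^-1 (-1))).
have T0 k : T k 0 = 0 by rewrite /T mulr0 !add0r !ramp_le0 ?subrr// lerN10.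
have dT k (s : R) : is_derive s 1 (T k) (T' k s).
  by apply: is_deriveB; apply: derive_affine => y; exact: is_derive_ramp.
have stepB (y : R) : 0 <= step (y + 0) - step (y + (-1)) <= 1.
  rewrite subr_ge0 step_homo ?lerD2l ?lerN10//=.
  by rewrite lerBlDr (le_trans (step_le1 _))// lerDl step_ge0.
have T'E k s : T' k s = (eps k)^-1 * (step ((eps k)^-1 * s + 0) - step ((eps k)^-1 * s + (-1))).
  by rewrite /T' mulrBr.
have T'ge0 k s : 0 <= T' k s.
  by rewrite T'E mulr_ge0 ?invr_ge0 ?(ltW (eps_gt0 k))//; case/andP: (stepB ((eps k)^-1 * s)).
have e0 k : 0 <= (eps k)^-1 by rewrite invr_ge0 ltW.
have TM k s : `|T' k s| <= (eps k)^-1.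
  rewrite ger0_norm// T'E ger_pMr ?invr_gt0//.
  by case/andP: (stepB ((eps k)^-1 * s)).
have T01 k s : 0 <= T k s <= 1.
  rewrite subr_ge0 ramp_homo ?lerD2l ?lerN10//=.
  have le10 : (eps k)^-1 * s + (-1) <= (eps k)^-1 * s + 0 by rewrite lerD2l lerN10.
  rewrite /T; have [c _ ->] := derive_mvt (@is_derive_ramp R) le10.
  by rewrite addr0 opprD addrA subrr sub0r opprK mulr1 step_le1.
have T1 k s : 2 * eps k <= s -> T k s = 1.
  move=> es; rewrite /T ramp_ge1 ?lerD2l ?lerN10//; first by ring.
  have -> : 1 <= (eps k)^-1 * s - 1 = (2 * eps k <= s) => //.
  by rewrite lerBrDr ler_pdivlMl// mulrC; congr (_ * _ <= _); ring.
pose z k x := v x - (- tau k) * b k x.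
have lower k : - k.+1%:R^-1 <= ip f (T k \o z k).
  have wz := wsol_shift (- tau k) sf wv (tb k).
  have [[sz _ _] _] : H10 Omega (z k) _ := wz.1.
  have sg := sqintD mO sf (sqintZ mO (- tau k) (slb k)).
  have sTz := sqint_lipschitz (sT k) (T0 k) (dT k) (e0 k) (TM k) sz.
  have := monotone_trunc_ge0 (sT k) (T0 k) (dT k) (e0 k) (TM k) sg wz (T'ge0 k).
  rewrite (ipDl mO sf (sqintZ mO (- tau k) (slb k)) sTz) (ipZl mO _ (slb k) sTz).
  have : - L k <= ip (lap (b k)) (T k \o z k).
    rewrite /L -mulN1r -(RintegralZl _ mO); last exact: integrable_norm (ilb k).
    apply: (le_Rintegral mO _ (sqintM mO (slb k) sTz)).
      exact: (integrableZl mO (-1) (integrable_norm (ilb k))).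
    move=> x _ /=; have /andP[] := T01 k (z k x).
    move: (T k (z k x)) (lap (b k) x) => t a t0 t1.
    have := ler_norm (- a); rewrite normrN => na; have := normr_ge0 a.
    move: (`|a|) na => c na c0; have [a0|a0] := leP 0 a; nra.
  have := tauL k; have := tau_gt0 k; have := L0 k.
  move: (ip f _) (ip _ _) (L k) (tau k) (k.+1%:R^-1) => p q l t r l0 t0 tl lq pq.
  have : t * - l <= t * q by rewrite ler_pM2l.
  lra.
have mT k : measurable_fun [set: R] (T k).
  by apply: continuous_measurable_fun; exact: Ck_continuous (sT k 0%N).
have mz k : measurable_fun (Omega : set X) (z k).
  have [mw _] := sqintB mO sv (sqintZ mO (- tau k) (test_function_sqint oO Ofin (tb k))).
  exact: mw.
have mfT k : measurable_fun (Omega : set X) (fun x : X => f x * T k (z k x)).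
  by apply: measurable_funM => //; apply: measurableT_comp; [exact: mT|exact: mz].
have cvgf : {ae leb, forall x : X, Omega x -> f x * T k (z k x) @[k --> \oo] --> f x}.
  apply: filterS v0 => x vx Ox; have {}vx := vx Ox.
  rewrite -[X in _ --> X]mulr1; apply: cvgM; first exact: cvg_cst.
  have [k0 b0] := exhaust_gt0 oO Ox.
  apply: cvg_near_cst; exists (maxn k0 (Num.truncn (2 / exhaust Omega k0 x)).+1) => // k.
  rewrite /= geq_max => /andP[kk0 kt]; apply: T1.
  have bk : exhaust Omega k0 x <= b k x by exact: exhaust_homo.
  have tk : 2 / exhaust Omega k0 x <= k.+1%:R.
    apply: ltW; apply: lt_le_trans (truncnS_gt _) _.
    by rewrite ler_nat (leq_trans kt).
  rewrite /z mulNr opprK /eps; apply: (@le_trans _ _ (tau k * b k x)); last by rewrite lerDr.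
  rewrite mulrCA ler_pM2l// ler_pdivrMr// mulrC.
  rewrite ler_pdivrMr// in tk; apply: le_trans tk _.
  by rewrite ler_wpM2l.
have i1 : leb.-integrable (Omega : set X) (EFin \o (fun _ : X => (1 : R))).
  by have := sqint_integrable s1; apply: eq_integrable => // x _ /=; rewrite expr1n.
have [_ lim] : leb.-integrable (Omega : set X) (EFin \o f) /\
    \int[leb]_(x in (Omega : set X)) (f x * T k (z k x)) @[k --> \oo] -->
    \int[leb]_(x in (Omega : set X)) f x.
  apply: (Rintegral_dct mO mfT mf cvgf i1) => k x _.
  rewrite normrM mulr_ile1//.
  by case/andP: (T01 k (z k x)) => t0 t1; rewrite ger0_norm.
have lim2 : \int[leb]_(x in (Omega : set X)) (f x * T k (z k x)) + k.+1%:R^-1 @[k --> \oo] -->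
    \int[leb]_(x in (Omega : set X)) f x + 0.
  by apply: cvgD => //; exact: cvg_harmonic.
rewrite -[leRHS]addr0 -(cvg_lim _ lim2)//.
apply: limr_ge; first by apply/cvg_ex; eexists; exact: lim2.
by apply: nearW => k; have := lower k; rewrite -subr_ge0 opprK.
Qed.

End truncations.

(** * The one-dimensional profile of the laminate *)

Section profile.
Context (R : realType) (a : R) (n1 n2 : nat).
Hypothesis a_ge0 : 0 <= a.
Hypothesis n1_gt0 : (0 < n1)%N.
Hypothesis n12 : (n1 < n2)%N.

Lemma derive_translate (f f' : R -> R) (b x : R) : (forall y : R, is_derive y 1 f (f' y)) ->
  is_derive x 1 (fun y => f (y - b)) (f' (x - b)).
Proof.
move=> ff'; have := derive_affine 1 (- b) x ff'; rewrite !mul1r.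
by under eq_fun do rewrite mul1r.
Qed.

Lemma derive_reflect (f f' : R -> R) (b x : R) : (forall y : R, is_derive y 1 f (f' y)) ->
  is_derive x 1 (fun y => f (b - y)) (- f' (b - x)).
Proof.
move=> ff'; have := derive_affine (-1) b x ff'; rewrite !mulN1r [- x + b]addrC.
by under eq_fun do rewrite mulN1r addrC.
Qed.

(* [tent step] is [a], then [- slope], then 0, up to transitions of unit width; its
   integral [tent ramp] returns to 0 for this value. *)
Definition slope : R := a * n1%:R / (n2%:R - n1%:R).

Let width_gt0 : 0 < n2%:R - n1%:R :> R. Proof. by rewrite subr_gt0 ltr_nat. Qed.

Let slopeE : slope * (n2%:R - n1%:R) = a * n1%:R.
Proof. by rewrite /slope mulfVK// gt_eqF. Qed.

Lemma slope_ge0 : 0 <= slope.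
Proof. by rewrite divr_ge0 ?mulr_ge0// ltW. Qed.

(** A combination of translates commutes with differentiation, so [tent ramp2], [tent ramp] and
    [tent step] are successive derivatives. *)
Definition tent (f : R -> R) (y : R) : R :=
  a * f y - (a + slope) * f (y - n1%:R) + slope * f (y - n2%:R).

Lemma is_derive_tent (f f' : R -> R) (x : R) : (forall y : R, is_derive y 1 f (f' y)) ->
  is_derive x 1 (tent f) (tent f' x).
Proof.
move=> ff'; apply: is_deriveD; last by apply: is_deriveZ; exact: derive_translate.
by apply: is_deriveB; apply: is_deriveZ => //; exact: derive_translate.
Qed.

Lemma smooth1_tent f : smooth1 f -> smooth1 (tent f).
Proof.
move=> sf; have sh (b : R) : smooth1 (fun y => f (y - b)).
  have := smooth1_comp sf (smooth1_affine 1 (- b)).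
  by congr smooth1; apply/funext => y /=; rewrite mul1r.
by move=> k; apply: CkD; [apply: CkB|]; apply: CkZ; (exact: sf) || (exact: sh).
Qed.

Lemma tent_le0 f y : (forall x, x <= 0 -> f x = 0) -> y <= 0 -> tent f y = 0.
Proof.
move=> f0 y0; have := ler0n R n1; have := ler0n R n2 => p1 p2.
by rewrite /tent !f0 ?mulr0 ?subrr ?addr0//; lra.
Qed.

Let L : R := n2%:R + 1.

Lemma tent_step_ge y : L <= y -> tent (@step R) y = 0.
Proof.
rewrite /L => yL; have := ler0n R n1; have := width_gt0 => p1 p2.
by rewrite /tent !step_ge1; [ring|lra..].
Qed.

(** Past [L] all three ramps are affine of slope 1. The coefficients add up to 0, and the remaining
    constant vanishes by the choice of [slope]. *)
Lemma tent_ramp_ge y : L <= y -> tent (@ramp R) y = 0.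
Proof.
rewrite /L => yL; have := ler0n R n1; have := width_gt0 => p1 p2.
have rE (x : R) : 1 <= x -> ramp x = ramp 1 + (x - 1).
  by move=> x1; rewrite -(ramp_ge1 (lexx 1) x1) addrC subrK.
rewrite /tent (rE y) ?(rE (y - n1%:R)) ?(rE (y - n2%:R)); [|lra..].
transitivity (a * n1%:R - slope * (n2%:R - n1%:R)); first by ring.
by rewrite slopeE subrr.
Qed.

(** As [n1 >= 1], the first transition is complete before the second begins, so the negative
    contribution is always accompanied by the full [a]. *)
Lemma tent_step_lb y : - slope <= tent (@step R) y.
Proof.
have := slope_ge0; have := step_ge0 (y - n2%:R); have := step_le1 (y - n1%:R).
have := step_ge0 (y - n1%:R); have := step_ge0 y; have n1_1 : 1 <= n1%:R :> R by rewrite ler1n.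
rewrite /tent; have [y1|y1] := leP 1 y.
  rewrite (step_ge1 y1); move: (step (y - n1%:R)) (step (y - n2%:R)) slope.
  move=> s t b _ s0 s1 t0 b0; have h1 : 0 <= a * (1 - s) by rewrite mulr_ge0// subr_ge0.
  have h2 : 0 <= b * (1 - s) by rewrite mulr_ge0// subr_ge0.
  have h3 : 0 <= b * t by exact: mulr_ge0.
  lra.
rewrite (@step_le0 _ (y - n1%:R)); last by lra.
rewrite (@step_le0 _ (y - n2%:R)); last by have := width_gt0; lra.
move: (step y) slope => s b s0 _ _ _ b0; rewrite !mulr0 subr0 addr0.
by rewrite (le_trans _ (mulr_ge0 a_ge0 s0))// oppr_le0.
Qed.

Lemma tent_step_plateau y : 1 <= y <= n1%:R -> tent (@step R) y = a.
Proof.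
move=> /andP[y1 yn]; rewrite /tent (step_ge1 y1).
rewrite (@step_le0 _ (y - n1%:R)); last by lra.
rewrite (@step_le0 _ (y - n2%:R)); last by have := width_gt0; lra.
by rewrite !mulr0 mulr1 subr0 addr0.
Qed.

(* [ramp] is convex: compare its difference quotients over [y - n1, y] and
   [y - n2, y - n1]. *)
Lemma tent_ramp_bounds y : 0 <= tent (@ramp R) y <= a * n1%:R.
Proof.
have p1 := ler0n R n1; have p2 := width_gt0.
have h1 : y - n1%:R <= y by lra.
have h2 : y - n2%:R <= y - n1%:R by lra.
have [c1 /andP[c11 c12] E1] := derive_mvt (@is_derive_ramp R) h1.
have [c2 /andP[c21 c22] E2] := derive_mvt (@is_derive_ramp R) h2.
have -> : tent (@ramp R) y = a * n1%:R * (step c1 - step c2).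
  transitivity (a * (ramp y - ramp (y - n1%:R)) -
      slope * (ramp (y - n1%:R) - ramp (y - n2%:R))); first by rewrite /tent; ring.
  rewrite E1 E2; transitivity (a * n1%:R * step c1 - slope * (n2%:R - n1%:R) * step c2).
    by ring.
  by rewrite slopeE; ring.
have s12 : step c2 <= step c1 by apply: step_homo; exact: le_trans c11.
have an : 0 <= a * n1%:R by exact: mulr_ge0.
rewrite mulr_ge0 ?subr_ge0//= ler_piMr//.
by have := step_le1 c1; have := step_ge0 c2; lra.
Qed.

Let P := tent (@ramp2 R).
Let dP (y : R) : is_derive y 1 P (tent (@ramp R) y).
Proof. by apply: is_derive_tent => x; exact: is_derive_ramp2. Qed.

Let P_homo : {homo P : x y / x <= y}.
Proof. by apply: derive_ge0_le dP _ => x; case/andP: (tent_ramp_bounds x). Qed.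

Let P_le0 y : y <= 0 -> P y = 0.
Proof. by apply: tent_le0; exact: ramp2_le0. Qed.

Let P_ge y : L <= y -> P y = P L.
Proof.
move=> Ly; have [c /andP[Lc _]] := derive_mvt dP Ly.
by rewrite (tent_ramp_ge Lc) mul0r => /eqP; rewrite subr_eq0 => /eqP.
Qed.

Let L_gt0 : 0 < L. Proof. by rewrite ltr_wpDl. Qed.

Definition period : nat := (2 * n2.+1)%N.

Let periodE : period%:R = L + L.
Proof. by rewrite /period natrM -[n2.+1%:R]natr1 /L; ring. Qed.

(** [P] climbs from 0 to the constant [P L] over [[0, L]]. Together with its mirror image it forms a
    bump on a period of length [2 * L], vanishing outside it, so that copies join smoothly. *)
Definition profile (y : R) : R := P y + P (period%:R - y) - P L.
Definition profile1 (y : R) : R := tent (@ramp R) y - tent (@ramp R) (period%:R - y).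
Definition profile2 (y : R) : R := tent (@step R) y + tent (@step R) (period%:R - y).

Lemma is_derive_profile (y : R) : is_derive y 1 profile (profile1 y).
Proof.
have h0 : is_derive y 1 (cst (P L) : R -> R) 0 by exact: is_derive_cst.
have h1 : is_derive y 1 (fun x => P x + P (period%:R - x)) (profile1 y).
  by apply: is_deriveD; [exact: dP|exact: derive_reflect].
by rewrite -[profile1 y]subr0; exact: (is_deriveB h1 h0).
Qed.

Lemma is_derive_profile1 (y : R) : is_derive y 1 profile1 (profile2 y).
Proof.
have dt (x : R) : is_derive x 1 (tent (@ramp R)) (tent (@step R) x).
  by apply: is_derive_tent => z; exact: is_derive_ramp.
rewrite /profile2 -[X in _ + X]opprK.
by apply: is_deriveB; exact: derive_reflect.
Qed.

Lemma smooth1_profile2 : smooth1 profile2.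
Proof.
have st := smooth1_tent (@smooth1_step R).
move=> k; apply: CkD; first exact: st.
have := smooth1_comp st (smooth1_affine (-1) period%:R) k.
by congr Ck; apply/funext => y /=; rewrite mulN1r addrC.
Qed.

Lemma smooth1_profile : smooth1 profile.
Proof.
apply: smooth1_primitive is_derive_profile _.
exact: smooth1_primitive is_derive_profile1 smooth1_profile2.
Qed.

Lemma profile_outside (y : R) : ~ (0 < y < period%:R) ->
  [/\ profile y = 0, profile1 y = 0 & profile2 y = 0].
Proof.
move=> /negP; rewrite negb_and -!leNgt periodE => /orP[] y0.
  have L1 : L <= L + L - y by have := L_gt0; lra.
  rewrite /profile /profile1 /profile2 periodE (P_le0 y0) (P_ge L1) add0r subrr.
  rewrite (tent_ramp_ge L1) (tent_step_ge L1).
  by rewrite !tent_le0 ?subrr ?addr0//; [exact: step_le0|exact: ramp_le0].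
have L1 : L <= y by have := L_gt0; lra.
have L2 : L + L - y <= 0 by lra.
rewrite /profile /profile1 /profile2 periodE (P_le0 L2) (P_ge L1) addr0 subrr.
rewrite (tent_ramp_ge L1) (tent_step_ge L1).
by rewrite !tent_le0 ?subrr ?addr0//; [exact: step_le0|exact: ramp_le0].
Qed.

(** In either half of the period one of the two mirrored terms is past [L], hence constant, and
    bounds for a single [tent] apply. *)
Let halves (y : R) : L <= period%:R - y \/ L <= y.
Proof. by rewrite periodE; have [|] := leP L y; [right|left; lra]. Qed.

Lemma profile_ge0 y : 0 <= profile y.
Proof.
have P0 x : 0 <= P x.
  have [x0|x0] := leP x 0; first by rewrite P_le0.
  by rewrite -(P_le0 (lexx 0)) P_homo// ltW.
rewrite /profile; case: (halves y) => /P_ge ->; last by rewrite addrAC subrr add0r.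
by rewrite addrK.
Qed.

Lemma profile_le y : profile y <= P L.
Proof.
have PL x : P x <= P L.
  have [x0|x0] := leP x L; first exact: P_homo.
  by rewrite P_ge// ltW.
by rewrite /profile lerBlDr lerD.
Qed.

Lemma profile1_le y : `|profile1 y| <= a * n1%:R.
Proof.
rewrite /profile1; have /andP[] := tent_ramp_bounds y.
have /andP[] := tent_ramp_bounds (period%:R - y).
move: (tent _ _) (tent _ _) (a * _) => s t u *; rewrite ler_norml; lra.
Qed.

Lemma profile2_ge y : - slope <= profile2 y.
Proof.
rewrite /profile2; case: (halves y) => /tent_step_ge ->; rewrite ?addr0 ?add0r;
  exact: tent_step_lb.
Qed.

Lemma profile2_plateau (y : R) : 1 <= y <= n1%:R \/ 1 <= period%:R - y <= n1%:R ->
  profile2 y = a.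
Proof.
have n1L : n1%:R <= L by have := width_gt0; rewrite /L; lra.
rewrite /profile2; case=> /[dup] /andP[y1 yn] /tent_step_plateau ->.
  by rewrite tent_step_ge ?addr0//; move: n1L; rewrite periodE; lra.
by rewrite tent_step_ge ?add0r//; move: n1L yn; rewrite periodE; lra.
Qed.

Lemma profile_bound : exists2 C, 0 <= C & forall y, profile y <= C.
Proof.
by exists (P L); [exact: le_trans (profile_ge0 0) (profile_le 0)|exact: profile_le].
Qed.

(** The unit cells [[c, c + 1]] inside one of the two plateaus [[1, n1]] and
    [[period - n1, period - 1]], which are [n1 - 1] each. *)
Definition good_cell (c : nat) : bool :=
  ((0 < c) && (c < n1))%N || ((period - n1 <= c) && (c < period.-1))%N.

Lemma profile2_good_cell (c : nat) (y : R) : good_cell c -> c%:R <= y < c%:R + 1 ->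
  profile2 y = a.
Proof.
move=> gc /andP[cy yc]; apply: profile2_plateau.
case/orP: gc => /andP[c0 cn]; [left|right].
  have c1 : 1 <= c%:R :> R by rewrite ler1n.
  have cn1 : c%:R + 1 <= n1%:R :> R by rewrite natr1 ler_nat.
  by apply/andP; split; lra.
have c1 : period%:R - n1%:R <= c%:R :> R.
  rewrite -natrB ?ler_nat//.
  by rewrite /period mulSn (leq_trans (ltnW n12))// (leq_trans (leqnSn _))// leq_addr.
have c2 : c%:R + 1 + 1 <= period%:R :> R.
  by rewrite !natr1 ler_nat; move: cn; rewrite /period mulSn /=.
by apply/andP; split; lra.
Qed.

Lemma card_good_cell : (2 * n1.-1 <= \sum_(c < period) good_cell c)%N.
Proof.
have one_sum m p : (forall c, (m <= c < p)%N -> good_cell c) ->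
    (\sum_(m <= c < p) good_cell c = p - m)%N.
  move=> h; rewrite (eq_big_nat _ _ (F2 := fun=> 1%N)); last by move=> c /h ->.
  by rewrite sum_nat_const_nat muln1.
rewrite -(big_mkord xpredT (fun c => nat_of_bool (good_cell c))).
have le1 : (n1 <= period - n1)%N by rewrite /period; lia.
have cat m p r : (m <= p)%N -> (p <= r)%N -> (\sum_(m <= c < r) good_cell c =
    \sum_(m <= c < p) good_cell c + \sum_(p <= c < r) good_cell c)%N.
  by move=> mp pr; rewrite -big_cat_nat.
rewrite (cat 0%N 1%N) 1?(cat 1%N n1) 1?(cat n1 (period - n1)%N)
  1?(cat (period - n1)%N period.-1); try by rewrite /period; lia.
rewrite (one_sum 1%N n1); last by move=> c; rewrite /good_cell => /andP[-> ->].
rewrite (one_sum (period - n1)%N period.-1).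
  by rewrite /period; lia.
by move=> c; rewrite /good_cell => /andP[-> ->]; rewrite orbT.
Qed.

End profile.

(** * Periodic repetition of the profile *)

Section tiles.
Context (R : realType) (N : nat).
Hypothesis N_gt0 : (0 < N)%N.
Implicit Types (F : R -> R) (y : R).

(** A finite sum is differentiated term by term; the cutoff keeps the relevant arguments in a
    bounded interval, covered by [M] copies. *)
Definition tiles F (M : nat) y : R := \sum_(k < M) F (y - k%:R * N%:R).

Lemma tiles_cell F (M k0 : nat) y : (forall z, ~ (0 < z < N%:R) -> F z = 0) ->
  (k0 < M)%N -> 0 <= y - k0%:R * N%:R <= N%:R -> tiles F M y = F (y - k0%:R * N%:R).
Proof.
move=> F0 k0M /andP[y0 yN]; rewrite /tiles (bigD1 (Ordinal k0M))//= big1 ?addr0// => k kk0.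
apply: F0 => /andP[h1 h2].
have n0 : 0 < N%:R :> R by rewrite ltr0n.
have [kk|kk|kk] := ltngtP k k0.
- have : k%:R + 1 <= k0%:R :> R by rewrite natr1 ler_nat.
  by rewrite -(ler_pM2r n0) mulrDl mul1r; lra.
- have : k0%:R + 1 <= k%:R :> R by rewrite natr1 ler_nat.
  by rewrite -(ler_pM2r n0) mulrDl mul1r; lra.
- by move: kk0; rewrite -val_eqE/= kk eqxx.
Qed.

(** Transfers pointwise bounds from one cell to the tiling; at a point interior to no cell the value
    is [F 0 = 0]. *)
Lemma tiles_value F (M : nat) y : (forall z, ~ (0 < z < N%:R) -> F z = 0) ->
  exists z, tiles F M y = F z.
Proof.
move=> F0; have [[k /andP[h1 h2]]|h] := pselect (exists k : 'I_M, 0 < y - k%:R * N%:R < N%:R).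
  exists (y - k%:R * N%:R); apply: tiles_cell => //.
  by rewrite (ltW h1) (ltW h2).
exists 0; rewrite /tiles big1 => [|k _]; first by rewrite F0// ltxx.
by apply: F0 => hk; apply: h; exists k.
Qed.

Lemma is_derive_tiles F F' (M : nat) (y : R) : (forall z : R, is_derive z 1 F (F' z)) ->
  is_derive y 1 (tiles F M) (tiles F' M y).
Proof.
move=> FF'; rewrite /tiles; elim: (index_enum _) => [|k r ih].
  rewrite big_nil; under eq_fun do rewrite big_nil.
  exact: (is_derive_cst (0 : R)).
rewrite big_cons; under eq_fun do rewrite big_cons.
by apply: is_deriveD => //; exact: derive_translate.
Qed.

Lemma smooth1_tiles F M : smooth1 F -> smooth1 (tiles F M).
Proof.
move=> sF k; apply: Ck_sum => j.
have := smooth1_comp sF (smooth1_affine 1 (- (j%:R * N%:R))) k.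
by congr Ck; apply/funext => y /=; rewrite mul1r.
Qed.

End tiles.

(** * Layered functions and the averaging argument *)

Section layers.
Context (R : realType) (n : nat).
Notation V := 'rV[R]_n.+1.
Notation X := (lebesgue_space R n).

Lemma lap_layer (Q Q1 Q2 : R -> R) (eta : V -> R) (x : V) :
  smooth1 Q -> smooth1 Q1 -> (forall y : R, is_derive y 1 Q (Q1 y)) ->
  (forall y : R, is_derive y 1 Q1 (Q2 y)) -> smooth eta ->
  lap (fun x => Q (x 0 0) * eta x) x =
  Q (x 0 0) * lap eta x + 2 * Q1 (x 0 0) * partial 0 eta x + Q2 (x 0 0) * eta x.
Proof.
move=> sQ sQ1 dQ dQ1 seta.
pose c (i : 'I_n.+1) : R := (delta_mx 0 i : V) 0 0.
have sc := @smooth_coord R n 0.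
have sQc := smooth_comp sQ sc; have sQ1c := smooth_comp sQ1 sc.
have pc i y : partial i (fun y : V => y 0 0) y = c i.
  by apply: derive_val; exact: is_derive_coord.
have p1 i y : partial i (fun x => Q (x 0 0) * eta x) y =
    Q (y 0 0) * partial i eta y + c i * (Q1 (y 0 0) * eta y).
  rewrite (partialM i y sQc seta) (partial_comp i y dQ sc) pc /=; ring.
have p2 i y : partial i (partial i (fun x => Q (x 0 0) * eta x)) y =
    Q (y 0 0) * partial i (partial i eta) y + 2 * c i * Q1 (y 0 0) * partial i eta y +
    c i ^+ 2 * Q2 (y 0 0) * eta y.
  have -> : partial i (fun x => Q (x 0 0) * eta x) =
      (fun y => Q (y 0 0) * partial i eta y + c i * (Q1 (y 0 0) * eta y)).
    by apply/funext => z; exact: p1.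
  have spe := smooth_partial i seta.
  have s1 := smoothM sQc spe; have s2 := smoothM sQ1c seta.
  have s3 := smoothM (smooth_cst (c i)) s2.
  rewrite (partialD i y s1 s3) (partialZ (c i) i y s2) (partialM i y sQc spe).
  rewrite (partialM i y sQ1c seta) (partial_comp i y dQ sc) (partial_comp i y dQ1 sc) pc /=.
  ring.
rewrite /lap; under eq_bigr do rewrite p2.
rewrite !big_split/= -mulr_sumr; congr (_ + _ + _).
  rewrite (bigD1 0)//= big1 ?addr0 /c ?mxE ?eqxx ?mulr1// => i i0.
  by rewrite mxE eq_sym (negbTE i0) andbF mulr0 !mul0r.
rewrite (bigD1 0)//= big1 ?addr0 /c ?mxE ?eqxx ?expr1n ?mul1r// => i i0.
by rewrite mxE eq_sym (negbTE i0) andbF expr0n !mul0r.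
Qed.

Lemma lap_flat (eta : V -> R) (U : set V) (x : V) (b : R) : open U -> U x ->
  (forall y, U y -> eta y = b) -> (forall i, partial i eta x = 0) /\ lap eta x = 0.
Proof.
move=> oU Ux etaU.
have p1 i y : U y -> partial i eta y = 0.
  move=> Uy; rewrite /partial (@near_eq_derive _ _ _ eta (cst b)); first exact: derive_cst.
  by apply: filterS (open_nbhs_nbhs (conj oU Uy)) => z; exact: etaU.
split=> [i|]; first exact: p1.
rewrite /lap big1// => i _.
rewrite /partial -/(partial i eta) (@near_eq_derive _ _ _ (partial i eta) (cst 0)).
  exact: derive_cst.
by apply: filterS (open_nbhs_nbhs (conj oU Ux)) => z; exact: p1.
Qed.

(** Double counting: integrate over [U] the number of sets [A j] that contain [x]. *)
Lemma pigeonhole_measure (N g : nat) (U : set X) (A : 'I_N -> set X) (t : R) :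
  measurable U -> (leb U < +oo)%E -> (forall j, measurable (A j)) ->
  (forall x, U x -> (g <= \sum_(j < N) (x \in A j))%N) ->
  (forall j, (leb (A j) <= t%:E)%E) ->
  g%:R * fine (leb U) <= N%:R * t.
Proof.
move=> mU Ufin mA gA At.
have Unum : leb U \is a fin_num by rewrite ge0_fin_numE.
rewrite -lee_fin EFinM fineK//.
rewrite -(integral_cst leb mU).
apply: (@le_trans _ _ (\int[leb]_(x in U) (\sum_(j < N) (\1_(A j) x)%:E))%E).
  apply: (ge0_le_integral leb mU).
  - by move=> x _; rewrite lee_fin.
  - exact: measurable_cst.
  - apply: emeasurable_sum => j; apply/measurable_EFinP.
    by apply: measurable_funTS; exact: measurable_indic.
  - move=> x Ux; rewrite /= sumEFin lee_fin.
    under eq_bigr do rewrite indicE.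
    by rewrite -natr_sum ler_nat gA.
rewrite ge0_integral_sum//; last first.
  by move=> j; apply/measurable_EFinP; apply: measurable_funTS; exact: measurable_indic.
apply: (@le_trans _ _ (\sum_(j < N) t%:E)%E).
  apply: lee_sum => j _; rewrite integral_indic//.
  apply: le_trans (At j); apply: le_measure; rewrite ?inE//.
  exact: measurableI.
by rewrite sumEFin lee_fin sumr_const card_ord mulr_natl.
Qed.

End layers.

(** The bound on [slope] amounts to [n1 < gamma * n2], whereas the unit transitions cost a bounded
    number of cells. So [n1 / n2] is placed near [theta + d], the midpoint of [theta] and [gamma],
    with [d * n2 >= 3] to absorb rounding and transitions. *)
Lemma density_parameters (R : realType) (theta gamma : R) : 0 <= theta -> theta < gamma -> gamma < 1 ->
  exists n1 n2 : nat, [/\ (0 < n1)%N, (n1 < n2)%N, slope (1 - gamma) n1 n2 < gamma &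
    theta * (n2%:R + 1) <= n1%:R - 1].
Proof.
move=> th0 thg g1; pose d := (gamma - theta) / 2.
have d0 : 0 < d by rewrite /d; lra.
pose n2 := (Num.truncn (3 / d)).+1; pose n1 := Num.truncn ((theta + d) * n2%:R).
have n2d : 3 <= d * n2%:R.
  have := truncnS_gt (3 / d); rewrite -/n2 ltr_pdivrMr// mulrC; exact: ltW.
have /andP[n1l n1u] : n1%:R <= (theta + d) * n2%:R < n1.+1%:R.
  by apply: truncn_itv; rewrite mulr_ge0 ?addr_ge0// ltW.
rewrite -natr1 in n1u.
have n2_gt0 : 0 < n2%:R :> R by rewrite ltr0n.
have key : theta * (n2%:R + 1) <= n1%:R - 1.
  by have := n1u; rewrite /d in n2d *; lra.
have th1 : (theta + d) * n2%:R < gamma * n2%:R by rewrite ltr_pM2r// /d; lra.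
have n1g := le_lt_trans n1l th1.
have n12 : n1%:R < n2%:R :> R by rewrite (lt_trans n1g)// gtr_pMl.
have n10 : 1 <= n1%:R :> R.
  have : 0 <= theta * (n2%:R + 1) by rewrite mulr_ge0// addr_ge0// ltW.
  lra.
exists n1, n2; split=> //; [by rewrite -(ler1n R)|by rewrite -(ltr_nat R)|].
by rewrite /slope ltr_pdivrMr ?subr_gt0//; lra.
Qed.

(** * The laminate and the choice of its shift *)

Section laminates.
Context (R : realType) (n : nat).
Notation V := 'rV[R]_n.+1.
Notation X := (lebesgue_space R n).
Context (gamma : R) (gamma_lt1 : gamma < 1) (n1 n2 : nat).
Hypothesis n1_gt0 : (0 < n1)%N.
Hypothesis n12 : (n1 < n2)%N.
Let a : R := 1 - gamma.
Hypothesis slope_lt : slope a n1 n2 < gamma.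
Let N := period n2.
Let N_gt0 : (0 < N)%N. Proof. by rewrite /N /period. Qed.
Let a_ge0 : 0 <= a. Proof. by rewrite subr_ge0 ltW. Qed.

Let T := tiles N (profile a n1 n2).
Let T1 := tiles N (profile1 a n1 n2).
Let T2 := tiles N (profile2 a n1 n2).

(** With [i] the integer part of [y + h], the shifts [j < N] carry the point through the cells
    [(i + j) %% N], each residue once; every good cell is therefore met by exactly one shift. Since
    [i < 2 * h], all these points lie within the first [2 * h + 2] copies. *)
Lemma tiles_good_cells (h : nat) (y : R) : `|y| < h%:R ->
  (2 * n1.-1 <= \sum_(j < N) (a <= T2 (2 * h).+2 (y + h%:R + j%:R))%R)%N.
Proof.
rewrite ltr_norml => /andP[y1 y2]; have y0 : 0 <= y + h%:R by lra.
pose i := Num.truncn (y + h%:R).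
have /andP[iy yi] : i%:R <= y + h%:R < i.+1%:R by exact: truncn_itv.
have ih : (i < 2 * h)%N by rewrite -(ltr_nat R) natrM; lra.
pose f (j : 'I_N) : 'I_N := Ordinal (ltn_pmod (i + j) N_gt0).
have f_inj : injective f.
  move=> j k /(congr1 val)/= /eqP; rewrite eqn_modDl !modn_small// => /eqP.
  exact: val_inj.
apply: (leq_trans (card_good_cell a_ge0 n1_gt0 n12)).
rewrite -/N (reindex_inj f_inj); apply: leq_sum => j _.
case gc : good_cell => //.
rewrite -natr1 in yi.
have jN := ltn_ord j.
have dm : (i%:R + j%:R : R) = ((i + j) %/ N)%:R * N%:R + ((i + j) %% N)%:R.
  by rewrite -natrM -!natrD -divn_eq.
have mN : ((i + j) %% N)%:R + 1 <= N%:R :> R by rewrite natr1 ler_nat ltn_pmod.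
have m0 : 0 <= ((i + j) %% N)%:R :> R by [].
have kM : ((i + j) %/ N < (2 * h).+2)%N.
  rewrite ltn_divLR//; apply: (@leq_trans (2 * h + N)%N); first by lia.
  by rewrite addnC !mulSn leq_add2l (leq_trans (leq_pmulr _ N_gt0))// leq_addl.
rewrite /T2 (tiles_cell N_gt0 _ kM).
- rewrite (profile2_good_cell a n12 gc) ?lexx// /=; apply/andP; split; lra.
- by move=> z /(profile_outside a n12)[].
- by apply/andP; split; lra.
Qed.

(** On [A], contained in the open set [U] where [eta = 1], the derivatives of [eta] vanish and the
    Laplacian is the second derivative of the tiling, at least [1 - gamma]. Elsewhere in [Omega] the
    source is [gamma], which exceeds [slope] by enough to pay for the terms created by the
    cutoff. *)
Lemma laminate (c : R) (U Omega : set V) (eta : V -> R) :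
  open U -> (leb (U : set X) < +oo)%E -> U `<=` Omega ->
  test_function Omega eta -> (forall x, 0 <= eta x <= 1) ->
  (forall x, U x -> eta x = 1) ->
  (n2%:R + 1) * c < (n1%:R - 1) * fine (leb (U : set X)) ->
  exists A : set V, [/\ measurable_set A, A `<=` Omega, (c%:E < leb (A : set X))%E &
    exists w : V -> R, [/\ test_function Omega w, forall x, 0 <= w x &
      forall x, Omega x -> 0 <= source Omega A gamma x + lap w x]].
Proof.
move=> oU Ufin UO teta eta01 eta1 cU.
have [M2 M20 eta2] := test_function_bounded (test_lap teta).
have [M1 M10 eta1'] := test_function_bounded (test_function_partial 0 teta).
have [C0 C00 pC0] := profile_bound a_ge0 n12.
have [h0 etah] := test_function_big_box teta.
have sl0 := slope_ge0 a_ge0 n12.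
pose C1 := a * n1%:R; have C10 : 0 <= C1 by exact: mulr_ge0.
pose D := C0 * M2 + 2 * C1 * M1.
have D0 : 0 <= D by rewrite addr_ge0// ?mulr_ge0.
(* The cutoff terms are at most [e * D], using [e <= 1] for the one with [e ^+ 2]; this has to fit
   into [gamma - slope]. The [+ 1] covers [D = 0]. *)
pose e := (gamma - slope a n1 n2) / (D + 1).
have D1 : 0 < D + 1 by rewrite ltr_wpDl.
have e0 : 0 < e by rewrite divr_gt0// subr_gt0.
have e1 : e <= 1.
  have h1 : gamma - slope a n1 n2 <= 1 by rewrite lerBlDr (le_trans (ltW gamma_lt1))// lerDl.
  by rewrite ler_pdivrMr// mul1r (le_trans h1)// lerDr.
have eD : e * D <= gamma - slope a n1 n2.
  have : e * (D + 1) = gamma - slope a n1 n2 by rewrite mulfVK// gt_eqF.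
  lra.
(* Bounds [|x 0 0| / e] on [U], which lies in the box [big_box h0] because [eta] is nonzero there;
   the offset [h] in [b j] makes the arguments of the tiling positive. *)
pose h := (Num.truncn (e^-1 * h0%:R)).+1.
pose M := (2 * h).+2.
pose b (j : 'I_N) : R := h%:R + j%:R.
pose A (j : 'I_N) : set V := U `&` [set x | a <= T2 M (e^-1 * x 0 0 + b j)].
have out F z : F = profile a n1 n2 \/ F = profile1 a n1 n2 \/ F = profile2 a n1 n2 ->
    ~ (0 < z < N%:R) -> F z = 0 :> R.
  by move=> FE /(profile_outside a n12)[? ? ?]; case: FE => [|[|]] ->.
have sT2 : smooth1 (T2 M) by apply: smooth1_tiles; exact: smooth1_profile2.
have sT1 : smooth1 (T1 M).
  by apply: smooth1_tiles; exact: smooth1_primitive (is_derive_profile1 a n1 n2) (smooth1_profile2 a n1 n2).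
have sT : smooth1 (T M) by apply: smooth1_tiles; exact: smooth1_profile.
have dT (y : R) : is_derive y 1 (T M) (T1 M y).
  by apply: is_derive_tiles; exact: is_derive_profile.
have dT1 (y : R) : is_derive y 1 (T1 M) (T2 M y).
  by apply: is_derive_tiles; exact: is_derive_profile1.
have T_ge0 y : 0 <= T M y.
  rewrite /T; have [z ->] := tiles_value N_gt0 M y (fun z => @out (profile a n1 n2) z (or_introl erefl)).
  exact: profile_ge0.
have T_le y : T M y <= C0.
  rewrite /T; by have [z ->] := tiles_value N_gt0 M y (fun z => @out (profile a n1 n2) z (or_introl erefl)).
have T1_le y : `|T1 M y| <= C1.
  rewrite /T1; have [z ->] := tiles_value N_gt0 M y
    (fun z => @out (profile1 a n1 n2) z (or_intror (or_introl erefl))).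
  exact: profile1_le.
have T2_ge y : - slope a n1 n2 <= T2 M y.
  rewrite /T2; have [z ->] := tiles_value N_gt0 M y
    (fun z => @out (profile2 a n1 n2) z (or_intror (or_intror erefl))).
  exact: profile2_ge.
have cT2 j : continuous (fun x : V => T2 M (e^-1 * x 0 0 + b j)).
  have := smooth_comp (smooth1_comp sT2 (smooth1_affine e^-1 (b j))) (@smooth_coord R n 0).
  exact: smooth_continuous.
have mU : measurable (U : set X) by exact: open_measurable_leb.
have mA j : measurable (A j : set X).
  apply: measurableI => //.
  have := continuous_measurable_leb (cT2 j) => /(_ measurableT `[a, +oo[%classic (measurable_itv _)).
  by congr (measurable _); apply/seteqP; split => x /=; rewrite in_itv/= andbT; tauto.
have gA x : U x -> (2 * n1.-1 <= \sum_(j < N) (x \in (A j : set X)))%N.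
  move=> Ux; have xh : `|e^-1 * x 0 0| < h%:R.
    have [xb|xb] := pselect (big_box h0 x); last first.
      by have := etah x xb; rewrite eta1// => /eqP; rewrite oner_eq0.
    rewrite normrM ger0_norm ?invr_ge0 ?ltW//.
    have x0h : `|x 0 0| <= h0%:R.
      by have := xb 0; rewrite /= !mxE in_itv/= ler_norml => /andP[/ltW-> ->].
    apply: le_lt_trans (truncnS_gt (e^-1 * h0%:R)).
    by apply: ler_wpM2l; rewrite // invr_ge0 ltW.
  apply: (leq_trans (tiles_good_cells xh)); apply: leq_sum => j _.
  by case: leP => // ha; rewrite lt0b; apply/mem_set; split=> //=; rewrite /b addrA.
(* Otherwise averaging would give [2 * (n1 - 1) * |U| <= N * c] with [N = 2 * (n2 + 1)], against the
   assumption on [c]. *)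
have [j cA] : exists j, (c%:E < leb (A j : set X))%E.
  apply: contrapT => nA.
  have := @pigeonhole_measure R n N (2 * n1.-1) U A c mU Ufin mA gA.
  have Ac j : (leb (A j : set X) <= c%:E)%E.
    by rewrite leNgt; apply/negP => cA; apply: nA; exists j.
  move=> /(_ Ac); apply/negP; rewrite -ltNge /N /period !natrM.
  rewrite -subn1 natrB// -mulrA -[X in _ < X]mulrA ltr_pM2l//.
  by move: cU; rewrite natr1.
exists (A j); split; [exact: mA|by move=> x [/UO]|exact: cA|].
pose Q t := e ^+ 2 * T M (e^-1 * t + b j).
pose Q1 t := e * T1 M (e^-1 * t + b j).
pose Q2 t := T2 M (e^-1 * t + b j).
have ene : e != 0 by rewrite gt_eqF.
have dQ (y : R) : is_derive y 1 Q (Q1 y).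
  have -> : Q1 y = e ^+ 2 *: (e^-1 * T1 M (e^-1 * y + b j)).
    by rewrite -[RHS]/(e ^+ 2 * (e^-1 * _)) mulrA expr2 mulfK.
  by apply: is_deriveZ; exact: derive_affine.
have dQ1 (y : R) : is_derive y 1 Q1 (Q2 y).
  have -> : Q2 y = e *: (e^-1 * T2 M (e^-1 * y + b j)).
    by rewrite -[RHS]/(e * (e^-1 * _)) mulVKf.
  by apply: is_deriveZ; exact: derive_affine.
have sQ : smooth1 Q.
  move=> k; apply: CkZ; exact: (smooth1_comp sT (smooth1_affine e^-1 (b j))).
have sQ1 : smooth1 Q1.
  move=> k; apply: CkZ; exact: (smooth1_comp sT1 (smooth1_affine e^-1 (b j))).
have [seta _ _] := teta.
have sQc := smooth_comp sQ (@smooth_coord R n 0).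
exists (fun x : V => Q (x 0 0) * eta x); split.
- exact: test_functionM sQc teta.
- by move=> x; have /andP[eta0 _] := eta01 x; rewrite mulr_ge0// mulr_ge0 ?sqr_ge0.
move=> x Ox; rewrite (lap_layer x sQ sQ1 dQ dQ1 seta) /source !indicE.
have [xA|xA] := pselect (A j x).
  have [fl1 fl2] := lap_flat oU xA.1 eta1.
  have -> : (x \in A j) = true by exact/mem_set.
  have -> : (x \in Omega `\` A j) = false by apply/negbTE/negP => /set_mem[].
  rewrite fl1 fl2 (eta1 _ xA.1) !mulr0 !mulr1 !add0r; have := xA.2; rewrite /a /Q2 /=; lra.
have -> : (x \in A j) = false by apply/negbTE/negP => /set_mem.
have -> : (x \in Omega `\` A j) = true by apply/mem_set.
have q0 : - (e * (C0 * M2)) <= Q (x 0 0) * lap eta x.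
  rewrite lerNl -mulrN (le_trans (ler_norm _))// normrM normrN mulrA ler_pM//.
  rewrite ger0_norm; last by rewrite mulr_ge0// sqr_ge0.
  have Tx : e * T M (e^-1 * x 0 0 + b j) <= C0.
    by rewrite (le_trans _ (T_le (e^-1 * x 0 0 + b j)))// ler_piMl.
  by rewrite /Q expr2 -mulrA; apply: ler_wpM2l; [exact: ltW|exact: Tx].
have q1 : - (e * (2 * C1 * M1)) <= 2 * Q1 (x 0 0) * partial 0 eta x.
  rewrite lerNl -mulrN (le_trans (ler_norm _))// normrM normrN mulrA ler_pM//.
  rewrite normrM ger0_norm// mulrCA ler_wpM2l// normrM gtr0_norm//.
  by rewrite ler_wpM2l// ltW.
have q2 : - slope a n1 n2 <= Q2 (x 0 0) * eta x.
  have /andP[u0 u1] := eta01 x; have := T2_ge (e^-1 * x 0 0 + b j).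
  rewrite /Q2; move: (T2 _ _) (eta x) u0 u1 (slope _ _ _) sl0 => q u u0 u1 B B0 qB.
  have h1 : 0 <= (q + B) * u by rewrite mulr_ge0// -lerBlDr sub0r.
  have h2 : 0 <= B * (1 - u) by rewrite mulr_ge0// subr_ge0.
  lra.
rewrite mulr1 mulr0 subr0.
move: eD q0 q1 q2; rewrite /D mulrDr; lra.
Qed.

End laminates.

(** * Inner approximation of [Omega], the source, and the value of [C_plus] *)

Section theorem.
Context (R : realType) (n : nat).
Notation V := 'rV[R]_n.+1.
Notation X := (lebesgue_space R n).
Context (Omega : set V) (oO : open Omega) (Ofin : (leb (Omega : set X) < +oo)%E).

Let mO : measurable (Omega : set X). Proof. exact: open_measurable_leb. Qed.

(** Open sets increasing to [Omega], on which the test function [step (k.+1%:R * exhaust Omega k x)]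
    equals 1; this is the cutoff of the laminate. *)
Definition core (k : nat) : set V := [set x | 1 < k.+1%:R * exhaust Omega k x].

Lemma open_core k : open (core k).
Proof.
have [sphi _ _] := test_exhaust Omega k.
have cphi : continuous (fun x => k.+1%:R * exhaust Omega k x).
  exact: smooth_continuous (smoothM (smooth_cst k.+1%:R) sphi).
have -> : core k = (fun x => k.+1%:R * exhaust Omega k x) @^-1` [set y | 1 < y] by [].
by apply: open_comp => // x _; exact: cphi.
Qed.

Lemma core_sub k : core k `<=` Omega.
Proof.
move=> x cx; apply: contrapT => Ox; move: cx.
by rewrite /core /= exhaust_eq0// mulr0 ltr10.
Qed.

Lemma bigcup_core : \bigcup_k core k = Omega.
Proof.
apply/seteqP; split => [x [k _]|x Ox]; first exact: core_sub.
have [k0 e0] := exhaust_gt0 oO Ox.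
pose k := maxn k0 (Num.truncn (exhaust Omega k0 x)^-1).
exists k => //; rewrite /core /=.
apply: (@lt_le_trans _ _ (k.+1%:R * exhaust Omega k0 x)); last first.
  by rewrite ler_wpM2l//; apply: exhaust_homo; exact: leq_maxl.
rewrite -ltr_pdivrMr// mul1r; apply: (lt_le_trans (truncnS_gt _)).
by rewrite ler_nat ltnS leq_maxr.
Qed.

Lemma core_homo : nondecreasing_seq core.
Proof.
move=> k l kl; apply/subsetPset => x; rewrite /core /= => /lt_le_trans; apply.
by apply: ler_pM; rewrite ?exhaust_ge0 ?ler_nat//; exact: exhaust_homo.
Qed.

Lemma leb_core_gt (t : \bar R) : (t < leb (Omega : set X))%E ->
  exists k, (t < leb (core k : set X))%E.
Proof.
move=> tO; have mc k : measurable (core k : set X).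
  by apply: open_measurable_leb; exact: open_core.
have : leb (core k : set X) @[k --> \oo] --> leb (Omega : set X).
  pose F : nat -> set X := core.
  have mF : measurable (\bigcup_k F k) by rewrite [\bigcup_k F k]bigcup_core.
  have := @nondecreasing_cvg_mu _ X R leb F mc mF core_homo.
  by rewrite [\bigcup_k F k]bigcup_core.
have nO : nbhs (leb (Omega : set X)) [set y | (t < y)%E].
  by apply: open_nbhs_nbhs; split; [exact: open_ereal_gt_ereal|exact: tO].
by move=> /(_ _ nO)[k _ /(_ k (leqnn k))]; exists k.
Qed.

Lemma good_set (gamma c : R) : 0 <= c -> gamma < 1 -> (c%:E < gamma%:E * leb (Omega : set X))%E ->
  exists A : set V, [/\ measurable_set A, A `<=` Omega, (c%:E < leb (A : set X))%E &
    exists w : V -> R, [/\ test_function Omega w, forall x, 0 <= w x &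
      forall x, Omega x -> 0 <= source Omega A gamma x + lap w x]].
Proof.
move=> c0 g1; have Onum : leb (Omega : set X) \is a fin_num by rewrite ge0_fin_numE.
set m := fine (leb (Omega : set X)).
have m0 : 0 <= m by exact: fine_ge0.
rewrite -(fineK Onum) -/m -EFinM lte_fin => cgm.
have mgt0 : 0 < m.
  by rewrite lt0r m0 andbT; apply: contraTneq cgm => ->; rewrite mulr0 -leNgt.
have cm : c / m < gamma by rewrite ltr_pdivrMr.
(* A density strictly between [c / m] and [gamma]: [c / theta < m] leaves room to replace [Omega] by
   a core, and [theta < gamma] leaves room for the transitions of the profile. *)
pose theta := (c / m + gamma) / 2.
have th1 : c / m < theta by rewrite /theta; lra.
have th2 : theta < gamma by rewrite /theta; lra.
have th0 : 0 < theta by rewrite (le_lt_trans _ th1)// divr_ge0.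
have [k ck] : exists k, ((c / theta)%:E < leb (core k : set X))%E.
  apply: leb_core_gt; rewrite -(fineK Onum) lte_fin -/m.
  by rewrite ltr_pdivrMr// mulrC -ltr_pdivrMr.
have [n1 [n2 [n10 n12 sl key]]] := density_parameters (ltW th0) th2 g1.
have cfin : (leb (core k : set X) < +oo)%E.
  by apply: le_lt_trans Ofin; apply: le_measure; rewrite ?inE//;
    [exact: open_measurable_leb (@open_core k)|exact: core_sub].
apply: (laminate g1 n10 n12 sl (@open_core k) cfin (@core_sub k)
  (eta := @step R \o (fun x => k.+1%:R * exhaust Omega k x))).
- apply: test_function_comp; [exact: smooth1_step|exact: step_le0|].
  exact: test_functionZ (test_exhaust Omega k).
- by move=> x; rewrite /= step_ge0 step_le1.
- by move=> x /ltW; exact: step_ge1.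
have cfin' : leb (core k : set X) \is a fin_num by rewrite ge0_fin_numE.
move: ck; rewrite -(fineK cfin') lte_fin ltr_pdivrMr// => ck.
apply: (@lt_le_trans _ _ ((n2%:R + 1) * (fine (leb (core k : set X)) * theta))).
  by rewrite ltr_pM2l// ltr_wpDl.
rewrite mulrCA mulrC [_ * theta]mulrC; apply: ler_wpM2r => //; exact: fine_ge0.
Qed.

Section source.
Context (gamma : R) (gamma_gt0 : 0 < gamma) (gamma_lt1 : gamma < 1).
Context (A : set V) (mA : measurable_set A) (AO : A `<=` Omega).

Lemma sourceE x : Omega x -> source Omega A gamma x = gamma - \1_(A : set X) x.
Proof.
move=> Ox; rewrite /source !indicE; have [xA|xA] := pselect (A x).
  rewrite (mem_set xA) (_ : (x \in Omega `\` A) = false) /=; first by ring.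
  by apply/negbTE/negP => /set_mem[].
rewrite (_ : (x \in A) = false) /=; last by apply/negbTE/negP => /set_mem.
by rewrite (mem_set (conj Ox xA : (Omega `\` A) x)) /=; ring.
Qed.

Lemma source_le1 x : `|source Omega A gamma x| <= 1.
Proof.
rewrite /source !indicE; have [xA|xA] := pselect (A x).
  rewrite (mem_set xA) (_ : (x \in Omega `\` A) = false) /=.
    by rewrite mulr0 mulr1 sub0r normrN ger0_norm ?subr_ge0; [rewrite gerBl; exact: ltW|exact: ltW].
  by apply/negbTE/negP => /set_mem[].
rewrite (_ : (x \in A) = false) /=; last by apply/negbTE/negP => /set_mem.
rewrite mulr0 subr0 normrM normr_nat gtr0_norm//.
by case: (x \in _); rewrite ?mulr1 ?mulr0 ?ler01// ltW.
Qed.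

Lemma measurable_source : measurable_fun (Omega : set X) (source Omega A gamma).
Proof.
apply: measurable_funB; apply: measurable_funM => //; apply: measurable_funTS.
  exact: measurable_indic (measurableD mO mA).
Qed.

Lemma sqint_source : sqint leb (Omega : set X) (source Omega A gamma).
Proof.
apply: (sqint_bounded mO (M := 1) Ofin measurable_source) => x _.
exact: source_le1.
Qed.

(** Existence excludes the default value of [xget], so the chosen representative does solve the
    equation. *)
Lemma dirichlet_sol_wsol :
  exists Dv, wsol Omega (source Omega A gamma) (dirichlet_sol Omega A gamma) Dv.
Proof.
apply/(weak_solution_wsol oO Ofin _ sqint_source).
have [v [Dv vs]] := wsol_exists oO Ofin sqint_source.
apply: xgetPex; exists v; apply/(weak_solution_wsol oO Ofin _ sqint_source).
by exists Dv.
Qed.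

Lemma integral_source :
  \int[leb]_(x in (Omega : set X)) source Omega A gamma x =
  gamma * fine (leb (Omega : set X)) - fine (leb (A : set X)).
Proof.
transitivity (\int[leb]_(x in (Omega : set X)) (gamma - \1_(A : set X) x)).
  by apply: eq_Rintegral => x /set_mem; exact: sourceE.
have ic : leb.-integrable (Omega : set X) (EFin \o cst gamma).
  apply: measurable_bounded_integrable => //.
  exists `|gamma|; split=> [|y gy x _]; [exact: num_real|exact: ltW].
have iA : leb.-integrable (Omega : set X) (EFin \o \1_(A : set X)).
  apply: measurable_bounded_integrable => //.
  exists 1; split=> [|y y1 x _]; first exact: num_real.
  by rewrite /= indicE normr_nat (le_trans _ (ltW y1))// lern1 leq_b1.
rewrite RintegralB// Rintegral_cst//; congr (_ - fine _).
by rewrite integral_indic// setIidl.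
Qed.

End source.

(** Outside [Omega] the patched value [+oo] satisfies the lower bound trivially. *)
Lemma ess_inf_on_ge0 (v : V -> R) : (0 <= ess_inf_on Omega v)%E <->
  {ae leb, forall x : X, Omega x -> 0 <= v x}.
Proof.
split=> [/ess_infP|] h; [|apply/ess_infP]; apply: filterS h => x.
  by move=> + Ox; rewrite /patch mem_set//= lee_fin.
rewrite /patch; case: ifPn => [/set_mem Ox /(_ Ox)|_ _]; first by rewrite /= lee_fin.
exact: leey.
Qed.

End theorem.

Theorem theorem1 (R : realType) (n : nat) (gamma : R)
  (gamma_gt0 : 0 < gamma) (gamma_lt1 : gamma < 1)
  (Omega : set 'rV[R]_n.+1) (Omega_neq0 : Omega !=set0)
  (Omega_open : open Omega) (Omega_finite : (leb Omega < +oo)%E) :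
  C_plus Omega gamma = (gamma%:E * leb Omega)%E.
Proof.
have Onum : leb Omega \is a fin_num by rewrite ge0_fin_numE.
apply/eqP; rewrite eq_le; apply/andP; split.
  rewrite -(fineK Onum) -EFinM; apply: ereal_inf_lbound.
  exists (gamma * fine (leb Omega)); last by [].
  split; first by apply: mulr_ge0; [exact: ltW|exact: fine_ge0].
  move=> A mA AO; rewrite EFinM (fineK Onum) => leA; rewrite ltNge; apply/negP.
  move=> /(ess_inf_on_ge0 Omega) v0.
  have [Dv vs] := dirichlet_sol_wsol Omega_open Omega_finite gamma_gt0 gamma_lt1 mA.
  have := ae_ge0_source Omega_open Omega_finite
    (measurable_source Omega_open gamma mA)
    (source_le1 Omega gamma_gt0 gamma_lt1 A) vs v0.
  rewrite (integral_source Omega_open Omega_finite gamma mA AO) subr_ge0; apply/negP.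
  have Anum : leb A \is a fin_num.
    rewrite ge0_fin_numE// (le_lt_trans _ Omega_finite)//.
    by apply: le_measure => //; rewrite inE//; exact: open_measurable_leb.
  by rewrite -ltNge -lte_fin EFinM !fineK.
(* An admissible [c] below [gamma * |Omega|] is contradicted by a set of measure above [c] whose
   solution is nonnegative. *)
apply: le_ereal_inf_tmp => _ [c [c0 cP] <-]; rewrite leNgt; apply/negP => cO.
have [A [mA AO cA [w [tw w0 fw]]]] := good_set Omega_open Omega_finite c0 gamma_lt1 cO.
have := cP A mA AO cA; rewrite ltNge => /negP; apply.
have [Dv vs] := dirichlet_sol_wsol Omega_open Omega_finite gamma_gt0 gamma_lt1 mA.
apply/(ess_inf_on_ge0 Omega).
exact: (comparison Omega_open Omega_finite
  (sqint_source Omega_open Omega_finite gamma_gt0 gamma_lt1 mA) vs tw w0 fw).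
Qed.
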